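(* Let $P$ be a kernel on $A$ that has summable continuity rate, i.e. $\sum_{k\ge0}(1-\alpha_k)<\infty$, and that is very weakly non-null. Let $\mathbf X$ be the stationary chain compatible with $P$ and $\mathbf X^{[k]}$ its canonical $k$-steps Markov approximation. Then there exists a constant $C<+\infty$ such that, for all sufficiently large $k$, $$\bar d(\mathbf X,\mathbf X^{[k]})\le C(1-\alpha_k).$$
   Context: Alphabet and pasts. $A=\{1,\dots,N\}$ with $N\in\{1,2,\dots\}\cup\{\infty\}$ ($A=\{1,2,\dots\}$ if $N=\infty$). $A^{-\mathbb N}$ is the set of pasts $\underline a=\ldots a_{-2}a_{-1}$; $a_{-k}^{-1}=a_{-k}\ldots a_{-1}$ (empty string if $k=0$). Concatenation is written in temporal order: $\underline z a_{-k}^{-1}$ is the past whose last $k$ symbols are $a_{-k}^{-1}$, preceded by $\underline z$. Kernels, chains. A kernel is a (measurable) function $P:A\times A^{-\mathbb N}\to[0,1]$ with $\sum_{a\in A}P(a|\underline x)=1$ for all $\underline x$. A stationary chain $\mathbf X=(X_n)_{n\in\mathbb Z}$ with law $\mu$ on $A^{\mathbb Z}$ is compatible with $P$ if $\mu(X_0=a|X_{-\infty}^{-1}=\underline x)=P(a|\underline x)$ for all $a$ and $\mu$-a.e. $\underline x$. The canonical $k$-steps Markov approximation $\mathbf X^{[k]}$ is the stationary $k$-step Markov chain compatible with $P^{[k]}(a|x_{-k}^{-1})=\mu(X_0=a|X_{-k}^{-1}=x_{-k}^{-1})$, with $(X^{[k]}_1,\dots,X^{[k]}_k)$ distributed as $(X_1,\dots,X_k)$.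 For stationary chains, $\bar d(\mathbf X,\mathbf Y)=\inf\mathbb P(\bar X_0\ne\bar Y_0)$, infimum over all couplings $(\bar{\mathbf X},\bar{\mathbf Y})$ of $\mathbf X$ and $\mathbf Y$. Continuity. $\alpha_k(a|a_{-k}^{-1})=\inf_{\underline z}P(a|\underline z a_{-k}^{-1})$, $\alpha_k(a_{-k}^{-1})=\sum_{a\in A}\alpha_k(a|a_{-k}^{-1})$, $\alpha_k=\inf_{a_{-k}^{-1}\in A^k}\alpha_k(a_{-k}^{-1})$ for $k\ge0$. The update function $F^{(1)}$. For each $\underline a$, partition $[0,1[$ into left-closed right-open (possibly empty) intervals $I^{(1)}_k(a|a_{-k}^{-1})$, $k\in\{0,1,\dots\}\cup\{\infty\}$, $a\in A$, with lengths $|I^{(1)}_k(a|a_{-k}^{-1})|=\alpha_k(a|a_{-k}^{-1})-\alpha_{k-1}(a|a_{-(k-1)}^{-1})$ for $0\le k<\infty$ (with $\alpha_{-1}(a|\emptyset)=0$) and $|I^{(1)}_\infty(a|\underline a)|=P(a|\underline a)-\lim_k\alpha_k(a|a_{-k}^{-1})$, placed consecutively from left to right in the order: all $I_0^{(1)}(1|\emptyset),I_0^{(1)}(2|\emptyset),\dots$, then $I^{(1)}_1(1|a_{-1}),I^{(1)}_1(2|a_{-1}),\dots$, and so on, finally the $I^{(1)}_\infty(\cdot|\underline a)$. Put $F^{(1)}(\underline a,u)=a$ if $u\in\bigcup_kI^{(1)}_k(a|a_{-k}^{-1})$. Very weak non-nullness (for $P$ with $\alpha_k\to1$). Let $k^\star$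 be the smallest $k\ge0$ with $\alpha_k>0$. For $u\in[0,1[$ put $F^\star(a_{-k^\star}^{-1},u)=F^{(1)}(\underline b,u\,\alpha_{k^\star})$ for any $\underline b$ with $b_{-k^\star}^{-1}=a_{-k^\star}^{-1}$ (this does not depend on the choice of $\underline b$). For $m\ge k^\star+1$ let $E_m$ be the set of all $u_{-m+1}^0=(u_{-m+1},\dots,u_0)\in[0,\alpha_{k^\star}[^m$ such that, when starting from the string $a_{-k^\star}^{-1}\in A^{k^\star}$ one generates successively $m$ symbols at times $-m+1,\dots,0$, the symbol at time $n$ being $F^\star$ applied to the $k^\star$ preceding symbols and $u_n/\alpha_{k^\star}$, the string of the last $k^\star$ generated symbols (times $-k^\star+1,\dots,0$) does not depend on the initial string $a_{-k^\star}^{-1}$. (If $k^\star=0$ and $m=1$, $E_1=\bigcup_{a\in A}I_0^{(1)}(a|\emptyset)=[0,\alpha_0[$.) $P$ is very weakly non-null if there is $m\ge k^\star+1$ with $\mathbb P(U_{-m+1}^0\in E_m)>0$, where the $U_i$ are i.i.d. uniform on $[0,1[$. *)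

(* Defs.v *)
From HB Require Import structures.
From mathcomp Require Import all_boot all_order all_algebra.
From mathcomp Require Import all_classical all_reals all_analysis.

Set Implicit Arguments.
Unset Strict Implicit.
Unset Printing Implicit Defensive.

Import Order.TTheory GRing.Theory Num.Theory.
Import numFieldNormedType.Exports.

Local Open Scope classical_set_scope.
Local Open Scope ring_scope.

(* The nonempty alphabet A = {1, ..., n + 1} (for N = Some n) or
   A = {1, 2, ...} (for N = None), relabelled from 0: the natural number a
   stands for the letter a + 1, so the order of the letters is that of nat. *)
Definition in_alphabet (N : option nat) (a : nat) : bool :=
  if N is Some n then (a <= n)%N else true.

Record letter (N : option nat) :=
  Letter { letter_index :> nat; _ : in_alphabet N letter_index }.

HB.instance Definition _ (N : option nat) := [isSub for @letter_index N].
HB.instance Definition _ (N : option nat) := [Countable of letter N by <:].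

Lemma in_alphabet0 (N : option nat) : in_alphabet N 0.
Proof. by case: N. Qed.

HB.instance Definition _ (N : option nat) :=
  isPointed.Build (letter N) (Letter (in_alphabet0 N)).

(* For a countable alphabet, the coordinate events {x_i = a} generate the
   product sigma-algebra on A^I. *)
Definition coordinate_events (I : Type) (N : option nat) :
    set (set (I -> letter N)) :=
  [set B | exists i a, B = [set x | x i = a]].
Arguments coordinate_events : clear implicits.

(* A past x encodes ... a_{-2} a_{-1} with x i = a_{-(i+1)}; accordingly a
   string a_{-k}^{-1} is the sequence [:: a_{-1}; ...; a_{-k}], most recent
   letter first. *)
Definition past (N : option nat) :=
  g_sigma_algebraType (coordinate_events nat N).
Definition trajectory (N : option nat) :=
  g_sigma_algebraType (coordinate_events int N).

Definition recent (N : option nat) (x : past N) (k : nat) : seq (letter N) :=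
  mkseq x k.

(* The past "z s" whose most recent letters are those of s. *)
Definition extend_past (N : option nat) (s : seq (letter N)) (z : past N) :
    past N :=
  fun i => nth (z (i - size s)%N) s i.

Definition past_of (N : option nat) (w : trajectory N) : past N :=
  fun i => w (- (i.+1)%:Z).

Definition time_shift (N : option nat) (w : trajectory N) : trajectory N :=
  fun n => w (n + 1).

Section Kernels.
Context {R : realType} {N : option nat}.
Implicit Types (P : letter N -> past N -> R) (mu nu : probability (trajectory N) R).

(* [P a x] stands for P(a | x). *)

Definition is_kernel P : Prop :=
  [/\ forall a, measurable_fun [set: past N] (P a),
      forall a x, 0 <= P a x <= 1
    & forall x, \esum_(a in [set: letter N]) (P a x)%:E = 1%E].

Definition stationary mu : Prop :=
  forall B : set (trajectory N), measurable B -> mu (@time_shift N @^-1` B) = mu B.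

(* mu(X_0 = a | X_{-oo}^{-1} = x) = P(a | x) for mu-a.e. x, i.e. P(a | .) is a
   version of the conditional probability of {X_0 = a} given the past. *)
Definition compatible mu P : Prop :=
  forall (a : letter N) (B : set (past N)), measurable B ->
    mu ([set w | w 0 = a] `&` @past_of N @^-1` B) =
    (\int[mu]_(w in @past_of N @^-1` B) (P a (past_of w))%:E)%E.

(* mu(X_0 = a | X_{-k}^{-1} = x_{-k}^{-1}), with value 0 when the conditioning
   event is null. *)
Definition markov_kernel mu (k : nat) (a : letter N) (x : past N) : R :=
  fine (mu [set w | w 0 = a /\ recent (past_of w) k = recent x k]) /
  fine (mu [set w | recent (past_of w) k = recent x k]).

Definition first_letters (k : nat) (w : trajectory N) : k.-tuple (letter N) :=
  [tuple w (i.+1)%:Z | i < k].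

Definition is_markov_approximation mu (k : nat) nu : Prop :=
  [/\ stationary nu,
      compatible nu (markov_kernel mu k)
    & forall D : set (k.-tuple (letter N)),
        nu (first_letters k @^-1` D) = mu (first_letters k @^-1` D)].

(* A coupling of stationary chains is a stationary chain on A x A with the
   given marginals. Were joint stationarity not required, the infimum in dbar
   would reduce to the total variation distance between the laws of X_0 and
   Y_0, which is 0 between X and its Markov approximations for k >= 1. *)
Definition is_coupling mu nu
    (pi : probability (trajectory N * trajectory N)%type R) : Prop :=
  [/\ forall B : set (trajectory N), measurable B ->
        pi (fst @^-1` B) = mu B,
      forall B : set (trajectory N), measurable B ->
        pi (snd @^-1` B) = nu B
    & forall B : set (trajectory N * trajectory N), measurable B ->
        pi ((fun w => (time_shift w.1, time_shift w.2)) @^-1` B) = pi B].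

Definition dbar mu nu : \bar R :=
  ereal_inf [set pi [set w | w.1 0 <> w.2 0] |
    pi in [set pi : probability (trajectory N * trajectory N)%type R |
           is_coupling mu nu pi]].

(* alpha_k(a | a_{-k}^{-1}), alpha_k(a_{-k}^{-1}) and alpha_k, where k is the
   length of the string s. *)
Definition alpha_letter P (a : letter N) (s : seq (letter N)) : R :=
  inf (range (fun z => P a (extend_past s z))).

Definition alpha_string P (s : seq (letter N)) : R :=
  fine (\esum_(a in [set: letter N]) (alpha_letter P a s)%:E).

Definition alpha P (k : nat) : R :=
  inf (range (fun s : k.-tuple (letter N) => alpha_string P s)).

Definition summable_continuity_rate P : Prop :=
  (\sum_(0 <= k <oo) (1 - alpha P k)%:E < +oo)%E.

(* The levels 0, 1, ..., oo of the partition of [0, 1[, with None for oo. *)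
Definition level_lt (j k : option nat) : bool :=
  match j, k with
  | Some j, Some k => (j < k)%N
  | Some _, None => true
  | None, _ => false
  end.

Definition interval_before (p q : option nat * letter N) : bool :=
  level_lt p.1 q.1 || ((p.1 == q.1) && (p.2 < q.2)%N).

Definition interval_length P (x : past N) (p : option nat * letter N) : R :=
  match p.1 with
  | Some 0%N => alpha_letter P p.2 (recent x 0)
  | Some k.+1 =>
      alpha_letter P p.2 (recent x k.+1) - alpha_letter P p.2 (recent x k)
  | None => P p.2 x - limn (fun k => alpha_letter P p.2 (recent x k))
  end.

Definition interval_left P (x : past N) (p : option nat * letter N) : R :=
  fine (\esum_(q in [set q | interval_before q p]) (interval_length P x q)%:E).

(* I^{(1)}_k(a | x_{-k}^{-1}), for p = (k, a). *)
Definition I1 P (x : past N) (p : option nat * letter N) : set R :=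
  `[interval_left P x p, interval_left P x p + interval_length P x p[%classic.

(* For a kernel P, the letter is uniquely determined when u is in [0, 1[. *)
Definition F1 P (x : past N) (u : R) : letter N :=
  get [set a | exists k, I1 P x (k, a) u].

(* k is k*, the smallest index with alpha_k > 0. *)
Definition is_kstar P (k : nat) : Prop :=
  0 < alpha P k /\ forall j, 0 < alpha P j -> (k <= j)%N.

(* For strings of length k = k* and u in [0, 1[, the result does not depend on
   the past used to extend s (here the constant one). *)
Definition Fstar P (k : nat) (s : seq (letter N)) (u : R) : letter N :=
  F1 P (extend_past s point) (u * alpha P k).

(* The last k letters after generating successively one letter for each entry
   of u, the head of u being used first, from the initial string s. *)
Definition generate P (k : nat) (s : seq (letter N)) (u : seq R) :
    seq (letter N) :=
  foldl (fun t v => take k (Fstar P k t (v / alpha P k) :: t)) s u.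

(* The set E_m; u = [:: u_{-m+1}; ...; u_0], and k stands for k*. *)
Definition coalescence_set P (k m : nat) : set (m.-tuple R) :=
  [set u | (forall i, 0 <= tnth u i < alpha P k) /\
           forall s s' : k.-tuple (letter N),
             generate P k s u = generate P k s' u].
Arguments coalescence_set : clear implicits.

(* rho is the law of m independent random variables uniform on [0, 1[. *)
Definition iid_uniform (m : nat) (rho : probability (m.-tuple R) R) : Prop :=
  forall B : 'I_m -> set R, (forall i, measurable (B i)) ->
    rho [set u | forall i, B i (tnth u i)] =
    (\prod_(i < m) uniform_prob (@ltr01 R) (B i))%E.

Definition very_weakly_non_null P : Prop :=
  exists k m (rho : probability (m.-tuple R) R),
    [/\ is_kstar P k, (k.+1 <= m)%N, iid_uniform rho
      & (0 < rho (coalescence_set P k m))%E].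

End Kernels.

(* Main.v *)
(* Let pi be a stationary coupling of X and Y = X^[k] and let L be the current
   number of consecutive agreements.  By stationarity, "a disagreement followed
   by k agreements" has the same probability as "k agreements followed by a
   disagreement"; the latter is at most 1 - alpha_k if the one-step transitions
   are coupled maximally once the last k letters agree.  If the same uniform
   variables moreover drive both chains through F* on [0, alpha_{k*}[, then after
   any disagreement the two chains coalesce on their last k* letters during the
   next m steps with probability at least P(E_m), and from then on agree until
   L = k with probability at least prod_{l >= k*} alpha_l, which is positive by
   summability.  Hence P(E_m) (prod_l alpha_l) pi(X_0 <> Y_0) <= (m + 1) (1 - alpha_k).

   To get such a coupling, the pair of chains is run from the empty history with
   the conditional laws given finite strings; a Banach limit of its window
   probabilities is consistent and stationary with the right marginals (mass
   cannot escape because the marginal laws do not move), and is realised by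
   nested intervals of [0, 1[. *)

Require Import Defs.
From HB Require Import structures.
From mathcomp Require Import all_boot all_order all_algebra.
From mathcomp Require Import all_classical all_reals all_analysis.
From mathcomp Require Import measurable_realfun lra zify.

Set Implicit Arguments.
Unset Strict Implicit.
Unset Printing Implicit Defensive.

Import Order.TTheory GRing.Theory Num.Theory.
Import numFieldNormedType.Exports.

Local Open Scope classical_set_scope.
Local Open Scope ring_scope.

(** * Sums over countable types *)

(** The transition of the pair depends on its whole history, so no invariant law is at hand. Running
    from the empty history keeps every history finite, hence in a countable set, and every
    probability a sum. Nothing is lost at the start: the conditional laws given short strings
    already give each chain its stationary window laws.

    Two demands on the joint kernel seem to compete: it must contain the step by F* with a common
    uniform variable, and it must be maximal once the last letters agree. They are compatible
    because from equal strings the F* part sits on the diagonal, so the residual marginals can be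
    matched on top of it.

    The alphabet may be infinite and a Banach limit is only finitely additive, so an equality
    between a limit of sums and a sum of limits needs a summable dominating family; the
    time-independent marginal window laws provide it.

    In the constant, m + 1 bounds the number of times at which a run of k agreements can be
    completed: a disagreement is watched over the next m + k - k* letters, and completion falls
    among the last m - k* + 1 of these times, a number free of k. *)

Section Esum.
Context {R : realType}.
Local Open Scope ereal_scope.

Lemma esumZl (T : choiceType) (S : set T) (c : R) (f : T -> \bar R) :
  (0 <= c)%R -> (forall i, 0 <= f i) ->
  \esum_(i in S) (c%:E * f i) = c%:E * \esum_(i in S) f i.
Proof.
move=> c0 f0; rewrite /esum -ereal_supZl//; last first.
  by apply/set0P; exists 0; exists set0; [exact: fsets_set0|rewrite fsbig_set0].
rewrite image_comp; congr ereal_sup; apply: eq_imagel => X [finX XS] /=.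
by rewrite ge0_mule_fsumr.
Qed.

Lemma esum_pair (T1 T2 : choiceType) (f : T1 -> T2 -> \bar R) :
  (forall i j, 0 <= f i j) ->
  \esum_(k in [set: T1 * T2]) f k.1 k.2 =
  \esum_(i in [set: T1]) \esum_(j in [set: T2]) f i j.
Proof.
move=> f0; rewrite esum_esum//; congr (esum _ _).
by apply/seteqP; split.
Qed.

Lemma esum_exchange (T1 T2 : choiceType) (f : T1 -> T2 -> \bar R) :
  (forall i j, 0 <= f i j) ->
  \esum_(i in [set: T1]) \esum_(j in [set: T2]) f i j =
  \esum_(j in [set: T2]) \esum_(i in [set: T1]) f i j.
Proof.
move=> f0; rewrite -esum_pair// -(@esum_pair _ _ (fun j i => f i j))//.
rewrite (reindex_esum [set: T2 * T1] setT (fun k => (k.2, k.1)))//.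
by split=> // [[a b] [c d] _ _ [-> ->]//|[a b] _]; exists (b, a).
Qed.

Lemma esum_single (T : choiceType) (a : T) (f : T -> \bar R) :
  0 <= f a -> (forall b, b != a -> f b = 0) ->
  \esum_(b in [set: T]) f b = f a.
Proof.
move=> fa fb; rewrite -[RHS](esum_set1 fa) [RHS]esum_mkcond.
apply: eq_esum => b _; case: ifPn => //; rewrite in_set1 => /fb//.
Qed.

Lemma esum_ge_term (T : choiceType) (a : T) (f : T -> \bar R) :
  (forall b, 0 <= f b) -> f a <= \esum_(b in [set: T]) f b.
Proof.
move=> f0; rewrite -{1}(@esum_set1 R _ a f)// esum_mkcond.
by apply: le_esum => b _; case: ifP.
Qed.

Lemma esum_EFin (T : choiceType) (f : T -> R) (c : R) :
  (forall a, 0 <= f a)%R -> \esum_(a in [set: T]) (f a)%:E <= c%:E ->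
  exists2 s : R, (0 <= s <= c)%R & \esum_(a in [set: T]) (f a)%:E = s%:E.
Proof.
move=> f0 fc; have s0 : 0 <= \esum_(a in [set: T]) (f a)%:E.
  by apply: esum_ge0 => a _; rewrite lee_fin.
have sfin : \esum_(a in [set: T]) (f a)%:E \is a fin_num.
  by rewrite ge0_fin_numE// (le_lt_trans fc)// ltry.
exists (fine (\esum_(a in [set: T]) (f a)%:E)); last by rewrite fineK.
by rewrite fine_ge0// -lee_fin fineK.
Qed.

Lemma esum_subE (T : choiceType) (f g : T -> R) (s t : R) :
  (forall a, 0 <= g a <= f a)%R ->
  \esum_(a in [set: T]) (f a)%:E = s%:E -> \esum_(a in [set: T]) (g a)%:E = t%:E ->
  \esum_(a in [set: T]) (f a - g a)%:E = (s - t)%:E.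
Proof.
move=> gf fs gt; have h0 a : (0 <= f a - g a)%R by have := gf a; lra.
have g0 a : (0 <= g a)%R by have := gf a; lra.
have : \esum_(a in [set: T]) ((f a - g a)%:E + (g a)%:E) = s%:E.
  by rewrite -fs; apply: eq_esum => a _; rewrite -EFinD subrK.
rewrite esumD//; try by move=> a _; rewrite lee_fin.
by rewrite gt => fE; rewrite EFinB -fE addeK.
Qed.

(* The part of the two marginals not used by [gamma] is coupled maximally:
   the common mass goes to the diagonal, the rest is coupled independently. *)
Lemma coupling_extension (T : choiceType) (kappa kappa' : T -> R)
    (gamma : T -> T -> R) (rs cs : T -> R) :
  (forall a b, 0 <= gamma a b)%R ->
  (forall a, \esum_(b in [set: T]) (gamma a b)%:E = (rs a)%:E) ->
  (forall b, \esum_(a in [set: T]) (gamma a b)%:E = (cs b)%:E) ->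
  (forall a, rs a <= kappa a)%R -> (forall b, cs b <= kappa' b)%R ->
  \esum_(a in [set: T]) (kappa a)%:E = 1 ->
  \esum_(b in [set: T]) (kappa' b)%:E = 1 ->
  exists w : T -> T -> R,
    [/\ forall a b, (gamma a b <= w a b)%R,
        forall a, \esum_(b in [set: T]) (w a b)%:E = (kappa a)%:E,
        forall b, \esum_(a in [set: T]) (w a b)%:E = (kappa' b)%:E
      & forall a, (gamma a a + Num.min (kappa a - rs a) (kappa' a - cs a)
                   <= w a a)%R].
Proof.
move=> g0 rsE csE rsk csk k1 k'1.
have rs0 a : (0 <= rs a)%R.
  by rewrite -lee_fin -rsE esum_ge0// => b _; rewrite lee_fin.
have cs0 a : (0 <= cs a)%R.
  by rewrite -lee_fin -csE esum_ge0// => b _; rewrite lee_fin.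
have [t _ tE] : exists2 t : R, (0 <= t <= 1)%R &
    \esum_(a in [set: T]) (rs a)%:E = t%:E.
  by apply: esum_EFin => //; rewrite -k1; apply: le_esum => a _; rewrite lee_fin.
(* Rows and columns of [gamma] have the same total mass, so the two residuals [r] and [r'] also have
   equal mass and can be coupled with each other. *)
have tE' : \esum_(a in [set: T]) (cs a)%:E = t%:E.
  rewrite -tE; under eq_esum do rewrite -csE.
  under [RHS]eq_esum do rewrite -rsE.
  by rewrite esum_exchange// => i j; rewrite lee_fin.
pose r a := (kappa a - rs a)%R; pose r' a := (kappa' a - cs a)%R.
have r0 a : (0 <= r a)%R by rewrite subr_ge0.
have r'0 a : (0 <= r' a)%R by rewrite subr_ge0.
have rE : \esum_(a in [set: T]) (r a)%:E = (1 - t)%:E.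
  by apply: esum_subE => // a; rewrite rs0 rsk.
have r'E : \esum_(a in [set: T]) (r' a)%:E = (1 - t)%:E.
  by apply: esum_subE => // a; rewrite cs0 csk.
pose m a := Num.min (r a) (r' a).
have m0 a : (0 <= m a)%R by rewrite le_min r0 r'0.
have mr a : (m a <= r a)%R by rewrite ge_min lexx.
have mr' a : (m a <= r' a)%R by rewrite ge_min lexx orbT.
have [v _ vE] : exists2 v : R, (0 <= v <= 1 - t)%R &
    \esum_(a in [set: T]) (m a)%:E = v%:E.
  by apply: esum_EFin => //; rewrite -rE; apply: le_esum => a _; rewrite lee_fin.
pose u a := (r a - m a)%R; pose u' a := (r' a - m a)%R.
have u0 a : (0 <= u a)%R by rewrite subr_ge0.
have u'0 a : (0 <= u' a)%R by rewrite subr_ge0.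
pose D := (1 - t - v)%R.
have uE : \esum_(a in [set: T]) (u a)%:E = D%:E.
  by apply: esum_subE => // a; rewrite m0 mr.
have u'E : \esum_(a in [set: T]) (u' a)%:E = D%:E.
  by apply: esum_subE => // a; rewrite m0 mr'.
have D0 : (0 <= D)%R.
  by rewrite -lee_fin -uE esum_ge0// => b _; rewrite lee_fin.
have uD a : (u a <= D)%R.
  by rewrite -lee_fin -uE (@esum_ge_term T a (EFin \o u))// => b; rewrite lee_fin /=.
have u'D a : (u' a <= D)%R.
  by rewrite -lee_fin -u'E (@esum_ge_term T a (EFin \o u'))// => b; rewrite lee_fin /=.
(* The independent part is normalised by [D]. If [D] is 0 the residuals vanish as well, so the value
   0 of [D^-1] does no harm. *)
have DK x : (0 <= x <= D)%R -> (D^-1 * x * D = x)%R.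
  have [D00 xD|D00 _] := eqVneq D 0%R; first by rewrite D00 mulr0; lra.
  by rewrite mulrAC mulVf// mul1r.
pose w a b := (gamma a b + ((if a == b then m a else 0) + D^-1 * u a * u' b))%R.
have d0 a b : (0 <= if a == b then m a else 0 :> R)%R by case: ifP.
have e0 a b : (0 <= D^-1 * u a * u' b)%R by rewrite !mulr_ge0// invr_ge0.
have c0 a : (0 <= D^-1 * u a)%R by rewrite mulr_ge0// invr_ge0.
have c0' a : (0 <= D^-1 * u' a)%R by rewrite mulr_ge0// invr_ge0.
exists w; split.
- by move=> a b; rewrite /w lerDl addr_ge0.
- move=> a; rewrite /w; under eq_esum do rewrite !EFinD.
  rewrite esumD//; try by move=> b _; rewrite ?adde_ge0 ?lee_fin.
  rewrite esumD//; try by move=> b _; rewrite ?adde_ge0 ?lee_fin.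
  under [X in _ + (_ + X)]eq_esum do rewrite EFinM.
  rewrite esumZl//; try by move=> b; rewrite lee_fin.
  rewrite u'E [X in _ + (X + _)](@esum_single _ a) ?lee_fin//; last first.
    by move=> b; rewrite eq_sym => /negbTE ->.
  by rewrite eqxx rsE -EFinM DK ?u0 ?uD// -!EFinD /u /r; congr EFin; lra.
- move=> b; rewrite /w; under eq_esum do rewrite !EFinD.
  rewrite esumD//; try by move=> a _; rewrite ?adde_ge0 ?lee_fin.
  rewrite esumD//; try by move=> a _; rewrite ?adde_ge0 ?lee_fin.
  under [X in _ + (_ + X)]eq_esum do rewrite mulrAC EFinM.
  rewrite esumZl//; try by move=> a; rewrite lee_fin.
  rewrite uE [X in _ + (X + _)](@esum_single _ b) ?lee_fin//; last first.
    by move=> a /negbTE ->.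
  by rewrite eqxx csE -EFinM DK ?u'0 ?u'D// -!EFinD /u' /r'; congr EFin; lra.
- by move=> a; rewrite /w eqxx lerD2l -/(r a) -/(r' a) -/(m a) lerDl.
Qed.

End Esum.

(** * Laws of growing histories *)

Section Histories.
Context {R : realType} (T : choiceType) (J : seq T -> T -> R).
Local Open Scope ereal_scope.

(* Histories are lists of letters, most recent first; [J z] is the law of the
   next letter given the history [z], and [iter n step g z] the expected value
   of [g] after [n] further letters. *)
Definition step (g : seq T -> \bar R) (z : seq T) : \bar R :=
  \esum_(t in [set: T]) ((J z t)%:E * g (t :: z)).

Definition indic_seq (B : pred (seq T)) (z : seq T) : \bar R := (B z)%:R%:E.

Lemma indic_seq_ge0 B z : 0 <= indic_seq B z.
Proof. by rewrite lee_fin. Qed.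

Lemma indic_seq_le1 B z : indic_seq B z <= 1.
Proof. by rewrite lee_fin lern1 leq_b1. Qed.

Hypothesis J_ge0 : forall z t, (0 <= J z t)%R.
Hypothesis J_sum : forall z, \esum_(t in [set: T]) (J z t)%:E = 1.

Lemma step_ge0 g z : (forall y, 0 <= g y) -> 0 <= step g z.
Proof.
by move=> g0; apply: esum_ge0 => t _; rewrite mule_ge0 ?lee_fin.
Qed.

Lemma iter_step_ge0 n g z : (forall y, 0 <= g y) -> 0 <= iter n step g z.
Proof.
by move=> g0; elim: n z => [|n IHn] z //=; exact: step_ge0.
Qed.

(** Only histories of length [n + size z] are reached, so the comparison is required there alone;
    later arguments use this to discard histories too short for a window. *)
Lemma le_iter_step n g h z :
  (forall y, size y = (n + size z)%N -> g y <= h y) ->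
  iter n step g z <= iter n step h z.
Proof.
elim: n z => [|n IHn] z gh /=; first exact: gh.
apply: le_esum => t _; apply: lee_wpmul2l; first by rewrite lee_fin.
by apply: IHn => y /= yE; apply: gh; rewrite yE addnS.
Qed.

Lemma eq_iter_step n g h z :
  (forall y, size y = (n + size z)%N -> g y = h y) ->
  iter n step g z = iter n step h z.
Proof.
by move=> gh; apply/eqP; rewrite eq_le !le_iter_step// => y /gh ->.
Qed.

Lemma iter_step_esum (I : choiceType) n (g : I -> seq T -> \bar R) z :
  (forall i y, 0 <= g i y) ->
  iter n step (fun y => \esum_(i in [set: I]) g i y) z =
  \esum_(i in [set: I]) iter n step (g i) z.
Proof.
move=> g0; elim: n z => [|n IHn] z //=; rewrite /step.
under eq_esum do rewrite IHn.
rewrite esum_exchange; last first.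
  by move=> i t; rewrite mule_ge0 ?lee_fin ?iter_step_ge0.
apply: eq_esum => t _; rewrite esumZl// => i; exact: iter_step_ge0.
Qed.

Lemma iter_stepD n g h z : (forall y, 0 <= g y) -> (forall y, 0 <= h y) ->
  iter n step (fun y => g y + h y) z = iter n step g z + iter n step h z.
Proof.
move=> g0 h0; elim: n z => [|n IHn] z //=; rewrite /step -esumD; last 2 first.
- by move=> t _; rewrite mule_ge0 ?lee_fin ?iter_step_ge0.
- by move=> t _; rewrite mule_ge0 ?lee_fin ?iter_step_ge0.
by apply: eq_esum => t _; rewrite IHn ge0_muleDr ?iter_step_ge0.
Qed.

Lemma iter_step_sum (I : Type) (r : seq I) n (g : I -> seq T -> \bar R) z :
  (forall i y, 0 <= g i y) ->
  iter n step (fun y => \sum_(i <- r) g i y) z =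
  \sum_(i <- r) iter n step (g i) z.
Proof.
move=> g0; elim: r => [|i r IHr].
  rewrite big_nil; elim: n z => [|n IHn] z /=; first by rewrite big_nil.
  by apply: esum1 => t _; rewrite IHn mule0.
rewrite big_cons -IHr -iter_stepD//; last by move=> y; exact: sume_ge0.
by apply: eq_iter_step => y _; rewrite big_cons.
Qed.

(** The tail [drop n y] is the history from which the [n] steps began, so a function of it is known
    in advance and factors out, as in conditioning on the past. *)
Lemma iter_step_drop n (g : seq T -> \bar R) (h : seq T -> R) z :
  (forall y, 0 <= g y) -> (forall y, 0 <= h y)%R ->
  iter n step (fun y => (h (drop n y))%:E * g y) z =
  (h z)%:E * iter n step g z.
Proof.
move=> g0; elim: n h z => [|n IHn] h z h0 /=.
  by rewrite drop0.
rewrite /step -esumZl//; last first.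
  by move=> t; rewrite mule_ge0 ?lee_fin ?iter_step_ge0.
apply: eq_esum => t _.
have -> : iter n step (fun y => (h (drop n.+1 y))%:E * g y) (t :: z) =
          iter n step (fun y => (h (behead (drop n y)))%:E * g y) (t :: z).
  by apply: eq_iter_step => y _; rewrite -addn1 addnC -drop_drop drop1.
by rewrite (IHn (h \o behead))//= muleCA.
Qed.

Lemma iter_stepZ n (c : R) (g : seq T -> \bar R) z :
  (0 <= c)%R -> (forall y, 0 <= g y) ->
  iter n step (fun y => c%:E * g y) z = c%:E * iter n step g z.
Proof. by move=> c0 g0; rewrite (@iter_step_drop n g (fun=> c)). Qed.

Lemma iter_step1 n z : iter n step (fun=> 1) z = 1.
Proof.
elim: n z => [|n IHn] z //=; rewrite /step.
by under eq_esum do rewrite IHn mule1.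
Qed.

Lemma iter_step_cst n (c : R) z : (0 <= c)%R ->
  iter n step (fun=> c%:E) z = c%:E.
Proof.
move=> c0; rewrite -[RHS]mule1 -(iter_step1 n z) -iter_stepZ//.
by apply: eq_iter_step => y _; rewrite mule1.
Qed.

Lemma iter_step_shift n (h : seq T -> R) z :
  (forall y, 0 <= h y)%R ->
  iter n step (fun y => (h (drop n y))%:E) z = (h z)%:E.
Proof.
move=> h0; rewrite -[RHS]mule1 -(iter_step1 n z) -iter_step_drop//.
by apply: eq_iter_step => y _; rewrite mule1.
Qed.

Lemma iter_step_indic_fin n B z : iter n step (indic_seq B) z \is a fin_num.
Proof.
rewrite ge0_fin_numE ?iter_step_ge0//; last exact: indic_seq_ge0.
apply: (@le_lt_trans _ _ 1); last exact: ltry.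
by rewrite -(iter_step1 n z); apply: le_iter_step => y _; exact: indic_seq_le1.
Qed.

Definition prob_after n (B : pred (seq T)) : R :=
  fine (iter n step (indic_seq B) [::]).

Lemma prob_afterE n B :
  (prob_after n B)%:E = iter n step (indic_seq B) [::].
Proof.
by rewrite fineK// iter_step_indic_fin.
Qed.

Lemma prob_after_ge0 n B : (0 <= prob_after n B)%R.
Proof. by rewrite -lee_fin prob_afterE iter_step_ge0//; exact: indic_seq_ge0. Qed.

Lemma prob_after_le1 n B : (prob_after n B <= 1)%R.
Proof.
rewrite -lee_fin prob_afterE -(iter_step1 n [::]).
by apply: le_iter_step => y _; exact: indic_seq_le1.
Qed.

Definition has_recent (w : seq T) : pred (seq T) :=
  fun y => take (size w) y == w.

(** Forgetting the newest letter moves the clock back by one. This loss of one time unit is why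
    consistency on this side will rest on the shift invariance of the limit. *)
Lemma prob_after_cons n w :
  \esum_(t in [set: T]) (prob_after n.+1 (has_recent (t :: w)))%:E =
  (prob_after n (has_recent w))%:E.
Proof.
under eq_esum do rewrite prob_afterE.
rewrite -iter_step_esum; last by move=> *; exact: indic_seq_ge0.
rewrite prob_afterE -addn1 iterD; apply: eq_iter_step => z _.
rewrite -[RHS](@iter_step_shift 1 (fun y => (has_recent w y)%:R%R) z)//.
apply: eq_iter_step => -[//|a y _]; rewrite /indic_seq /= drop0.
rewrite (@esum_single _ _ a) ?lee_fin//; last first.
  by move=> t ta; rewrite /has_recent /= eqseq_cons eq_sym (negbTE ta).
by rewrite /has_recent /= eqseq_cons eqxx.
Qed.

(** Forgetting the oldest letter keeps the clock, but an older letter must exist, whence the strict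
    bound on [size w]. *)
Lemma prob_after_rcons n w : (size w < n)%N ->
  \esum_(t in [set: T]) (prob_after n (has_recent (rcons w t)))%:E =
  (prob_after n (has_recent w))%:E.
Proof.
move=> wn; under eq_esum do rewrite prob_afterE.
rewrite -iter_step_esum; last by move=> *; exact: indic_seq_ge0.
rewrite prob_afterE; apply: eq_iter_step => y; rewrite addn0 => yn.
case: y yn => [|a y' yn]; first by move=> yn; rewrite -yn in wn.
set y := a :: y'; have wy : (size w < size y)%N by rewrite yn.
rewrite /indic_seq /has_recent.
rewrite (@esum_single _ _ (nth a y (size w))) ?lee_fin//; last first.
  move=> t; rewrite size_rcons (take_nth a)// eqseq_rcons => /negbTE.
  by rewrite eq_sym => ->; rewrite andbF.
by rewrite size_rcons (take_nth a)// eqseq_rcons eqxx andbT.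
Qed.

Section Law.
Variables (p : seq T -> R).
Hypothesis p_nil : p [::] = 1%R.
Hypothesis p_cons : forall a s, (p (a :: s) = J s a * p s)%R.

Lemma prob_after_full w : prob_after (size w) (has_recent w) = p w.
Proof.
elim: w => [|a w IHw].
  by rewrite p_nil /prob_after /= /indic_seq /has_recent.
apply: EFin_inj; rewrite p_cons -IHw EFinM !prob_afterE -iter_stepZ//; last first.
  by move=> y; exact: indic_seq_ge0.
rewrite (_ : size (a :: w) = size w + 1)%N ?addn1// -addn1 iterD; apply: eq_iter_step => y.
rewrite addn0 => yw; rewrite /= /step (@esum_single _ _ a); last 2 first.
- by rewrite mule_ge0 ?lee_fin.
- move=> b ba; rewrite /indic_seq /has_recent /= eqseq_cons (negbTE ba).
  by rewrite mule0.
have yt : take (size w) y = y by rewrite -yw take_size.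
rewrite /indic_seq /has_recent /= eqseq_cons eqxx /= yt.
by case: eqP => [->//|_]; rewrite !mule0.
Qed.

(** Prolong [w] towards the past, using [p_rcons], until it fills all [n] letters; then the history
    itself is prescribed and its probability is the product of the conditional ones. Hence the
    window laws do not move although the process starts from nothing. *)
Lemma prob_after_recent n w :
  (forall s, \esum_(a in [set: T]) (p (rcons s a))%:E = (p s)%:E) ->
  (size w <= n)%N -> prob_after n (has_recent w) = p w.
Proof.
move=> p_rcons; move: {2}(n - size w)%N (erefl (n - size w)%N) => i.
elim: i w => [|i IHi] w wi wn.
  have <- : size w = n by lia.
  exact: prob_after_full.
apply: EFin_inj; rewrite -prob_after_rcons; last by lia.
rewrite -p_rcons; apply: eq_esum => a _; congr EFin.
by apply: IHi; rewrite size_rcons; lia.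
Qed.

End Law.

End Histories.

(** * Runs of agreement in a joint history *)

Section Mismatch.
Context {R : realType} (T : choiceType) (J : seq T -> T -> R) (dg : pred T).
Local Open Scope ereal_scope.
Local Notation step := (step J).
Hypothesis J_ge0 : forall z t, (0 <= J z t)%R.
Hypothesis J_sum : forall z, \esum_(t in [set: T]) (J z t)%:E = 1.

Definition agree (j : nat) (z : seq T) : bool :=
  (j <= size z)%N && all dg (take j z).

Definition mismatch (z : seq T) : bool := if z is t :: _ then ~~ dg t else false.

Definition agree_exactly (j : nat) (z : seq T) : bool :=
  agree j z && mismatch (drop j z).

Lemma agree_cons j t z : agree j.+1 (t :: z) = dg t && agree j z.
Proof. by rewrite /agree /= ltnS andbCA. Qed.

Lemma agreeW i j z : (i <= j)%N -> agree j z -> agree i z.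
Proof.
move=> ij /andP[jz]; rewrite /agree (leq_trans ij jz) /= => za.
by rewrite -(subnKC ij) takeD all_cat in za; case/andP: za.
Qed.

Lemma agreeS j z : agree j.+1 z = agree j z && ~~ mismatch (drop j z) && (j < size z)%N.
Proof.
elim: j z => [|j IHj] [|t z] //; first by rewrite /agree /= andbT take0 /= andbT negbK.
by rewrite !agree_cons IHj !andbA.
Qed.

(** Take the least position [j >= k] holding a mismatch: everything more recent agrees, so the [k]
    letters right after that mismatch form the required run, seen from [i = j - k] letters ago. *)
Lemma agree_mismatch_exactly k n z : (k <= n)%N -> agree k z ->
  mismatch (drop n z) ->
  exists2 i, (i <= n - k)%N & agree_exactly k (drop i z).
Proof.
move=> kn za zm.
have ex : exists j, (k <= j)%N && mismatch (drop j z) by exists n; rewrite kn.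
case: (ex_minnP ex) => j /andP[kj jm] jmin; exists (j - k)%N.
  by have := jmin n; rewrite kn zm => /(_ isT); lia.
have jz : (j < size z)%N.
  by rewrite ltnNge; apply/negP => /drop_oversize jz; rewrite jz in jm.
have aj : agree j z.
  have H i : (k <= i <= j)%N -> agree i z.
    elim: i => [|i IHi]; first by rewrite leqn0 => /andP[/eqP <-].
    move=> /andP[ki ij]; move: ki; rewrite leq_eqVlt => /orP[/eqP <- //|ki].
    have iz : agree i z by apply: IHi; lia.
    have iltz : (i < size z)%N by lia.
    rewrite agreeS iz iltz andbT /=; apply/negP => im.
    by have := jmin i; rewrite im andbT => /(_ ki); lia.
  by apply: H; rewrite kj leqnn.
rewrite /agree_exactly drop_drop subnKC// jm andbT /agree size_drop.
apply/andP; split; first by lia.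
have := aj => /andP[_]; rewrite -{1}(subnK kj) takeD all_cat => /andP[_].
by [].
Qed.

Section Bound.
Variables (k0 m k : nat) (al : nat -> R) (rho0 : R).
Hypothesis (k0k : (k0 <= k)%N) (k0m : (k0 <= m)%N).
Hypothesis al_ge0 : forall j, (0 <= al j)%R.
Hypothesis al_le1 : forall j, (al j <= 1)%R.
Hypothesis rho0_ge0 : (0 <= rho0)%R.
Hypothesis match_ge : forall j z, (k0 <= j <= k)%N -> agree j z ->
  (al j)%:E <= \esum_(t in [set: T]) (J z t * (dg t)%:R)%:E.
Hypothesis coalesce_ge : forall z, (k0 <= size z)%N ->
  rho0%:E <= iter m step (indic_seq (agree k0)) z.

Let eps : R := (rho0 * \prod_(k0 <= l < k) al l)%R.

Lemma agree_run_ge i j z : (k0 <= j)%N -> (j + i <= k)%N -> agree j z ->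
  (\prod_(j <= l < j + i) al l)%R%:E <=
  iter i step (indic_seq (agree (j + i))) z.
Proof.
elim: i j z => [|i IHi] j z k0j jik za.
  by rewrite addn0 big_geq// /indic_seq /= za.
have jlt : (j < j + i.+1)%N by lia.
rewrite (big_ltn jlt) /=.
have jk : (k0 <= j <= k)%N by rewrite k0j; lia.
rewrite EFinM muleC; apply: le_trans.
  apply: lee_wpmul2l (match_ge jk za); rewrite lee_fin.
  by apply: prodr_ge0 => l _; exact: al_ge0.
rewrite -esumZl; last 2 first.
- by apply: prodr_ge0 => l _; exact: al_ge0.
- by move=> t; rewrite lee_fin mulr_ge0.
apply: le_esum => t _; rewrite EFinM muleCA; apply: lee_wpmul2l.
  by rewrite lee_fin.
case: (boolP (dg t)) => dt; last first.
  by rewrite mule0 iter_step_ge0// => y; exact: indic_seq_ge0.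
rewrite mule1 -addSnnS; apply: IHi.
- exact: leqW.
- by rewrite addSnnS.
- by rewrite agree_cons dt.
Qed.

Lemma agree_return_ge z : (k0 <= size z)%N ->
  eps%:E <= iter (m + (k - k0)) step (indic_seq (agree k)) z.
Proof.
move=> k0z; rewrite iterD /eps mulrC EFinM.
have pr0 : (0 <= \prod_(k0 <= l < k) al l)%R.
  by apply: prodr_ge0 => l _; exact: al_ge0.
apply: (@le_trans _ _ ((\prod_(k0 <= l < k) al l)%R%:E *
    iter m step (indic_seq (agree k0)) z)).
  by apply: lee_wpmul2l; [rewrite lee_fin|exact: coalesce_ge].
rewrite -iter_stepZ//; last by move=> y; exact: indic_seq_ge0.
apply: le_iter_step => // y _; rewrite {1}/indic_seq.
case: (boolP (agree k0 y)) => ya; last first.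
  by rewrite mule0 iter_step_ge0// => x; exact: indic_seq_ge0.
have := @agree_run_ge (k - k0) k0 y (leqnn _); rewrite subnKC// => /(_ (leqnn _) ya).
by rewrite mule1.
Qed.

Let n' := (m + (k - k0))%N.

(** After a mismatch at time [n] there are [k] agreements at time [n + n'] with probability at least
    [eps], uniformly in the history. On that event the run after this mismatch, or after a later
    one, had length exactly [k] at some time [n + n' - i]; the union bound over [i] concludes. *)
Lemma mismatch_le_exactly n : (k0 <= n)%N ->
  (eps * prob_after J n mismatch <=
   \sum_(0 <= i < m.+1) prob_after J (n' + n - i) (agree_exactly k))%R.
Proof.
move=> k0n; rewrite -lee_fin EFinM -sumEFin prob_afterE//.
pose G y : \bar R := (mismatch (drop n' y))%:R%:E * indic_seq (agree k) y.
have G0 y : 0 <= G y by rewrite mule_ge0 ?lee_fin//; exact: indic_seq_ge0.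
have eps0 : (0 <= eps)%R.
  by rewrite mulr_ge0//; apply: prodr_ge0 => l _; exact: al_ge0.
apply: (@le_trans _ _ (iter (n + n') step G [::])).
  rewrite -iter_stepZ//; last by move=> y; exact: indic_seq_ge0.
  rewrite iterD; apply: le_iter_step => // y; rewrite addn0 => yn.
  rewrite /G (@iter_step_drop _ _ _ _ n' _ (fun y => (mismatch y)%:R%R))//; last first.
    by move=> z; exact: indic_seq_ge0.
  rewrite muleC; apply: lee_wpmul2l; first exact: indic_seq_ge0.
  by apply: agree_return_ge; rewrite yn.
apply: (@le_trans _ _ (iter (n + n') step (fun y =>
    \sum_(0 <= i < m.+1) indic_seq (agree_exactly k) (drop i y)) [::])).
  apply: le_iter_step => // y _; rewrite /G /indic_seq.
  have s0 : 0 <= \sum_(0 <= i < m.+1)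
      (agree_exactly k (drop i y))%:R%:E :> \bar R by apply: sume_ge0.
  case: (boolP (mismatch _)) => ym; last by rewrite mul0e.
  case: (boolP (agree k y)) => ya; last by rewrite mule0.
  (* Here [i <= n' - k = m - k0], so the [m.+1] terms of the sum include it, whatever [k] is. *)
  have [|i ik yi] := agree_mismatch_exactly _ ya ym.
    by rewrite /n'; lia.
  rewrite (@big_cat_nat _ _ _ i)//=; last by rewrite /n' in ik; lia.
  rewrite (@big_ltn _ _ _ i)/=; last by rewrite /n' in ik; lia.
  rewrite yi !mule1 addeCA leeDl// adde_ge0// sume_ge0//.
rewrite iter_step_sum//; last by move=> i y; exact: indic_seq_ge0.
rewrite !big_seq; apply: lee_sum => i; rewrite mem_index_iota /= => im.
rewrite prob_afterE//.
have -> : (n + n' = (n' + n - i) + i)%N by rewrite /n'; lia.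
rewrite iterD; apply: le_iter_step => // y _.
by rewrite (@iter_step_shift _ _ _ _ _ i (fun y => (agree_exactly k y)%:R%R)).
Qed.

(** A run of at least [k] has length exactly [k] or at least [k.+1], and the latter arises from a
    run of at least [k] one step earlier, which survives with probability at least [al k]. The
    increment of the probability of [agree k] is kept, since a shift-invariant limit annihilates
    it. *)
Lemma exactly_le n : (k < n)%N ->
  (prob_after J n (agree_exactly k) <= (1 - al k) +
     (prob_after J n (agree k) - prob_after J n.-1 (agree k)))%R.
Proof.
case: n => // n kn /=.
have dE : (prob_after J n.+1 (agree k) = prob_after J n.+1 (agree_exactly k) +
    prob_after J n.+1 (agree k.+1))%R.
  apply: EFin_inj; rewrite EFinD !prob_afterE// -iter_stepD//; try by
    move=> y; exact: indic_seq_ge0.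
  apply: eq_iter_step => // y; rewrite addn0 => yn; rewrite /indic_seq -EFinD -natrD.
  rewrite agreeS yn kn /agree_exactly andbT.
  by case: (agree k y); case: (mismatch _).
suff : (prob_after J n (agree k) <= (1 - al k) + prob_after J n.+1 (agree k.+1))%R.
  by move: dE; lra.
rewrite -lee_fin EFinD !prob_afterE// -addn1 iterD.
have c0 : (0 <= 1 - al k)%R by rewrite subr_ge0.
rewrite -(@iter_step_cst _ _ J _ _ n (1 - al k) [::])// -iter_stepD//.
- apply: le_iter_step => // y _ /=; rewrite {1}/indic_seq.
  case: (boolP (agree k y)) => ya; last first.
    rewrite adde_ge0 ?lee_fin// step_ge0// => z; exact: indic_seq_ge0.
  have kk : (k0 <= k <= k)%N by rewrite k0k leqnn.
  apply: (@le_trans _ _ ((1 - al k)%:E + (al k)%:E)).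
    by rewrite -EFinD subrK.
  apply: leeD2l; apply: le_trans (match_ge kk ya) _.
  by apply: le_esum => t _; rewrite /indic_seq agree_cons ya andbT EFinM.
- by move=> y; apply: step_ge0 => // z; exact: indic_seq_ge0.
Qed.
End Bound.
End Mismatch.

(** * Banach limits *)

Section BanachLimit.
Context {R : realType}.

Definition bounded_seq (f : nat -> R) : Prop := exists M, forall n, `|f n| <= M.

Lemma bounded_seqD f g : bounded_seq f -> bounded_seq g ->
  bounded_seq (fun n => f n + g n).
Proof.
move=> [M fM] [K gK]; exists (M + K) => n.
by rewrite (le_trans (ler_normD _ _))// lerD.
Qed.

Lemma bounded_seqZ c f : bounded_seq f -> bounded_seq (fun n => c * f n).
Proof. by move=> [M fM]; exists (`|c| * M) => n; rewrite normrM ler_wpM2l. Qed.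

Lemma bounded_seq_cst c : bounded_seq (fun=> c).
Proof. by exists `|c|. Qed.

Lemma bounded_seq_shift i f : bounded_seq f -> bounded_seq (fun n => f (n + i)%N).
Proof. by move=> [M fM]; exists M. Qed.

Lemma bounded_seq_sum (I : Type) (r : seq I) (f : I -> nat -> R) :
  (forall i, bounded_seq (f i)) -> bounded_seq (fun n => \sum_(i <- r) f i n).
Proof.
move=> fb; elim: r => [|i r IHr].
  by exists 0 => n; rewrite big_nil normr0.
have [M HM] := bounded_seqD (fb i) IHr.
by exists M => n; rewrite big_cons.
Qed.

Record banach_limit (L : (nat -> R) -> R) : Prop := BanachLimit {
  blimD : forall f g, bounded_seq f -> bounded_seq g ->
    L (fun n => f n + g n) = L f + L g;
  blimZ : forall c f, bounded_seq f -> L (fun n => c * f n) = c * L f;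
  le_blim : forall f g, bounded_seq f -> bounded_seq g ->
    (forall n, f n <= g n) -> L f <= L g;
  blim_cst : forall c, L (fun=> c) = c;
  blim_shift : forall f, bounded_seq f -> L (fun n => f n.+1) = L f }.

Let mean (f : nat -> R) (n : nat) : R := n.+1%:R^-1 * \sum_(0 <= i < n.+1) f i.

Let mean_bounded f (M : R) n : (forall n, `|f n| <= M) -> `|mean f n| <= M.
Proof.
move=> fM; rewrite /mean normrM ger0_norm ?invr_ge0//.
rewrite ler_pdivrMl ?ltr0n// (le_trans (ler_norm_sum _ _ _))//.
rewrite (le_trans (ler_sum _ (fun i _ => fM i)))//.
by rewrite sumr_const_nat subn0 mulr_natl.
Qed.

(** Compactness of the segment gives a cluster point, and an ultrafilter converges to each of its
    cluster points. *)
Let ultra_bounded_cvg (U : set_system nat) (f : nat -> R) (M : R) : UltraFilter U ->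
  (forall n, `|f n| <= M) -> exists l : R, f @ U --> l.
Proof.
move=> UU fM; have := @segment_compact R (- M) M.
move=> /(_ (f @ U) _)[|l [_ lc]].
  apply: (@filterS _ U _ setT); last exact: filterT.
  by move=> n _ /=; rewrite in_itv /= -ler_norml.
exists l => A Al /=; have [//|UA] := in_ultra_setVsetC (f @^-1` A) UU.
by have [x [nAx Ax]] := lc (~` A) A UA Al.
Qed.

(* The Cesaro means along an ultrafilter finer than the Frechet filter. *)
Lemma exists_banach_limit : exists L, banach_limit L.
Proof.
have [U [UU sU]] := @ultraFilterLemma nat \oo _.
have cvg_mean f : bounded_seq f -> exists l : R, mean f @ U --> l.
  by move=> [M fM]; apply: (@ultra_bounded_cvg _ _ M) => // n; exact: mean_bounded.
pose L f := lim (mean f @ U).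
have LE f : bounded_seq f -> mean f @ U --> L f.
  by move=> /cvg_mean[l fl]; rewrite /L (cvg_lim _ fl).
have Luniq f (l : R) : mean f @ U --> l -> L f = l by move=> fl; rewrite /L (cvg_lim _ fl).
exists L; split.
- move=> f g fb gb; apply: Luniq.
  have -> : mean (fun n => f n + g n) = mean f + mean g.
    by apply/funext => n; rewrite /mean big_split/= mulrDr.
  by apply: cvgD; exact: LE.
- move=> c f fb; apply: Luniq.
  have -> : mean (fun n => c * f n) = fun n => c * mean f n.
    by apply/funext => n; rewrite /mean -big_distrr/= mulrCA.
  by apply: cvgMl_tmp; exact: LE.
- move=> f g fb gb fg; apply: ler_lim.
  + by apply/cvg_ex; exists (L f); exact: LE.
  + by apply/cvg_ex; exists (L g); exact: LE.
  + apply: nearW => n; rewrite /mean ler_wpM2l ?invr_ge0//.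
    by apply: ler_sum.
- move=> c; apply: Luniq.
  have -> : mean (fun=> c) = fun=> c.
    by apply/funext => n; rewrite /mean sumr_const_nat subn0 -[c *+ _]mulr_natl mulKf.
  exact: cvg_cst.
- move=> f fb; apply: Luniq.
  (* The shift changes the sum of the first [n.+1] terms only at its two ends, so the means differ
     by a quantity of order 1/n. This tends to 0 along the Frechet filter, hence along the finer
     [U]. *)
  have -> : mean (fun n => f n.+1) =
      mean f + (fun n => n.+1%:R^-1 * (f n.+1 - f 0%N)).
    apply/funext => n.
    transitivity (mean f n + n.+1%:R^-1 * (f n.+1 - f 0%N)); last by [].
    rewrite /mean -mulrDr.
    congr (_ * _); rewrite [in RHS]big_nat_recl// [in LHS]big_nat_recr//=; lra.
  rewrite -[L f]addr0; apply: cvgD; first exact: LE.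
  apply: (cvg_trans (cvg_app _ sU)).
  have [M fM] := fb.
  apply: (@squeeze_cvgr _ _ _ _ (fun n => - ((M + M) * n.+1%:R^-1))
     (fun n => (M + M) * n.+1%:R^-1)).
  + apply: nearW => n; rewrite -ler_norml normrM ger0_norm ?invr_ge0// [leLHS]mulrC.
    apply: ler_wpM2r; first by rewrite invr_ge0.
    by rewrite (le_trans (ler_normB _ _))// lerD.
  + rewrite -oppr0; apply: cvgN; rewrite -(mulr0 (M + M)); apply: cvgMl_tmp.
    exact: cvg_harmonic.
  + rewrite -(mulr0 (M + M)); apply: cvgMl_tmp; exact: cvg_harmonic.
Qed.

End BanachLimit.

Section BanachLimitTheory.
Context {R : realType} (L : (nat -> R) -> R).
Hypothesis HL : banach_limit L.

Lemma blim_ge0 f : bounded_seq f -> (forall n, 0 <= f n) -> 0 <= L f.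
Proof.
move=> fb f0; rewrite -(blim_cst HL 0).
by apply: (le_blim HL) => //; exact: bounded_seq_cst.
Qed.

Lemma blim_shiftn i f : bounded_seq f -> L (fun n => f (n + i)%N) = L f.
Proof.
move=> fb; elim: i => [|i IHi].
  by congr L; apply/funext => n; rewrite addn0.
rewrite -{}IHi -(blim_shift HL (bounded_seq_shift i fb)).
by congr L; apply/funext => n; rewrite addnS.
Qed.

Lemma le_blim_eventually n0 f g : bounded_seq f -> bounded_seq g ->
  (forall n, (n0 <= n)%N -> f n <= g n) -> L f <= L g.
Proof.
move=> fb gb fg; rewrite -(blim_shiftn n0 fb) -(blim_shiftn n0 gb).
by apply: (le_blim HL); try exact: bounded_seq_shift; move=> n; rewrite fg ?leq_addl.
Qed.

Lemma eq_blim_eventually n0 f g : bounded_seq f -> bounded_seq g ->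
  (forall n, (n0 <= n)%N -> f n = g n) -> L f = L g.
Proof.
move=> fb gb fg; apply/eqP; rewrite eq_le.
by rewrite !(@le_blim_eventually n0)// => n /fg ->.
Qed.

Lemma blim_sum (I : Type) (r : seq I) (f : I -> nat -> R) :
  (forall i, bounded_seq (f i)) ->
  L (fun n => \sum_(i <- r) f i n) = \sum_(i <- r) L (f i).
Proof.
move=> fb; elim: r => [|i r IHr].
  rewrite big_nil -[RHS](blim_cst HL); congr L.
  by apply/funext => n; rewrite big_nil.
rewrite big_cons -{}IHr -(blimD HL)//; last exact: bounded_seq_sum.
by congr L; apply/funext => n; rewrite big_cons.
Qed.

End BanachLimitTheory.

Section BanachLimitSums.
Context {R : realType} (L : (nat -> R) -> R).
Hypothesis HL : banach_limit L.
Local Open Scope ereal_scope.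

Lemma bounded_seq_itv (f : nat -> R) (c : R) : (forall n, 0 <= f n <= c)%R -> bounded_seq f.
Proof. by move=> f0; exists c => n; case/andP: (f0 n) => ? ?; rewrite ger0_norm. Qed.

(** A Fatou inequality: [L] commutes with finite sums only, and passing to the supremum over them
    leaves one direction, since mass may escape to infinity. *)
Lemma esum_blim_le (I : choiceType) (f : nat -> I -> R) (g : nat -> R) :
  (forall n i, 0 <= f n i)%R -> bounded_seq g ->
  (forall n, \esum_(i in [set: I]) (f n i)%:E <= (g n)%:E) ->
  \esum_(i in [set: I]) (L (f ^~ i))%:E <= (L g)%:E.
Proof.
move=> f0 gb fg.
have fleg n i : (f n i <= g n)%R.
  by rewrite -lee_fin (le_trans _ (fg n))// (@esum_ge_term _ _ i (EFin \o f n))// => j; rewrite lee_fin /=.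
have fb i : bounded_seq (f ^~ i).
  have [M gM] := gb; exists M => n; rewrite ger0_norm//.
  by rewrite (le_trans (fleg n i))// (le_trans _ (gM n))// ler_norm.
apply: ge_ereal_sup => _ [X [finX _] <-].
rewrite fsbig_finite//= sumEFin lee_fin -(blim_sum HL)//.
apply: (le_blim HL) => // [|n].
  exact: bounded_seq_sum.
rewrite -lee_fin -sumEFin (le_trans _ (fg n))// -fsbig_finite//.
by apply: ereal_sup_ubound; exists X.
Qed.

(** Dominated convergence for [L]: the Fatou inequality for [f] and the one for [h - f] together
    give equality. *)
Lemma esum_blim_dominated (I : choiceType) (f : nat -> I -> R) (g : nat -> R)
    (h : I -> R) (H : R) :
  (forall n i, 0 <= f n i <= h i)%R -> \esum_(i in [set: I]) (h i)%:E = H%:E ->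
  (forall n, \esum_(i in [set: I]) (f n i)%:E = (g n)%:E) ->
  \esum_(i in [set: I]) (L (f ^~ i))%:E = (L g)%:E.
Proof.
move=> fh hH fg.
have f0 n i : (0 <= f n i)%R by case/andP: (fh n i).
have g0 n : (0 <= g n <= H)%R.
  rewrite -!lee_fin -fg -hH esum_ge0 /=; last by move=> i _; rewrite lee_fin.
  by apply: le_esum => i _; rewrite lee_fin; case/andP: (fh n i).
have gb : bounded_seq g by exact: bounded_seq_itv g0.
have fb i : bounded_seq (f ^~ i) by exact: bounded_seq_itv (fh ^~ i).
have Lfh i : (0 <= L (f ^~ i) <= h i)%R.
  rewrite (blim_ge0 HL)//= -(blim_cst HL (h i)).
  apply: (le_blim HL) => // [|n]; first exact: bounded_seq_cst.
  by case/andP: (fh n i).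
have le1 : \esum_(i in [set: I]) (L (f ^~ i))%:E <= (L g)%:E.
  by apply: esum_blim_le => // n; rewrite fg.
have [s _ sE] := esum_EFin (fun i => proj1 (andP (Lfh i))) le1.
apply/eqP; rewrite eq_le le1 /=.
have LN c (u : nat -> R) : bounded_seq u -> L (fun n => c - u n)%R = (c - L u)%R.
  move=> ub; rewrite -[X in (X - _)%R](blim_cst HL) -mulN1r -(blimZ HL)// -(blimD HL).
  - by congr L; apply/funext => n; rewrite mulN1r.
  - exact: bounded_seq_cst.
  - exact: bounded_seqZ.
have : \esum_(i in [set: I]) (L (fun n => h i - f n i)%R)%:E <= (L (fun n => H - g n)%R)%:E.
  apply: esum_blim_le => [n i||n].
  - by rewrite subr_ge0; case/andP: (fh n i).
  - by apply: (@bounded_seq_itv _ H) => n; have := g0 n; lra.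
  - by rewrite (esum_subE _ hH (fg n)).
under eq_esum do rewrite LN//.
by rewrite LN// (esum_subE _ hH sE)// sE !lee_fin; lra.
Qed.

End BanachLimitSums.

(** * Marginals of a joint history *)

Section Projection.
Context {R : realType} (A B T : choiceType).
Variables (pr : T -> A) (mk : A -> B -> T).
Variables (K : seq A -> A -> R) (J : seq T -> T -> R).
Local Open Scope ereal_scope.
Hypothesis mk_bij : bijective (fun ab : A * B => mk ab.1 ab.2).
Hypothesis pr_mk : forall a b, pr (mk a b) = a.
Hypothesis J_ge0 : forall z t, (0 <= J z t)%R.
Hypothesis K_ge0 : forall s a, (0 <= K s a)%R.
Hypothesis K_sum : forall s, \esum_(a in [set: A]) (K s a)%:E = 1.
Hypothesis J_pr : forall z a,
  \esum_(b in [set: B]) (J z (mk a b))%:E = (K (map pr z) a)%:E.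

(** The pairing [mk] is abstract so that one argument serves both coordinates: the second is
    obtained by exchanging the arguments of the pair. *)
Lemma esum_mk (f : T -> \bar R) : (forall t, 0 <= f t) ->
  \esum_(t in [set: T]) f t =
  \esum_(a in [set: A]) \esum_(b in [set: B]) f (mk a b).
Proof.
move=> f0; rewrite -esum_pair//.
rewrite (@reindex_esum R _ _ [set: A * B] setT (fun ab => mk ab.1 ab.2))//.
by rewrite setTT_bijective.
Qed.

Lemma J_sum_pr z : \esum_(t in [set: T]) (J z t)%:E = 1.
Proof.
rewrite esum_mk; last by move=> *; rewrite lee_fin.
by under eq_esum do rewrite J_pr.
Qed.

(** Lumpability: the marginal of [J z] depends on [z] only through its projection, so the projected
    history evolves by itself with kernel [K]. *)
Lemma iter_step_pr n (E : pred (seq A)) z :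
  iter n (step J) (indic_seq (E \o map pr)) z =
  iter n (step K) (indic_seq E) (map pr z).
Proof.
elim: n z => [//|n IHn] z /=.
rewrite /step esum_mk; last first.
  move=> t; rewrite mule_ge0 ?lee_fin ?iter_step_ge0// => y.
  exact: indic_seq_ge0.
apply: eq_esum => a _; under eq_esum do rewrite IHn /= pr_mk muleC.
rewrite muleC -J_pr.
have := @iter_step_indic_fin _ _ K K_ge0 K_sum n E (a :: map pr z).
move=> /fineK <-; rewrite esumZl// => [|b]; last by rewrite lee_fin.
by rewrite fine_ge0// iter_step_ge0// => y; exact: indic_seq_ge0.
Qed.

Lemma prob_after_pr n (E : pred (seq A)) :
  prob_after J n (E \o map pr) = prob_after K n E.
Proof. by rewrite /prob_after iter_step_pr. Qed.

Variable p : seq A -> R.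
Hypothesis p_nil : p [::] = 1%R.
Hypothesis p_cons : forall a s, p (a :: s) = (K s a * p s)%R.
Hypothesis p_rcons : forall s,
  \esum_(a in [set: A]) (p (rcons s a))%:E = (p s)%:E.

Lemma law_ge0 s : (0 <= p s)%R.
Proof. by elim: s => [|a s IHs]; rewrite ?p_nil// p_cons mulr_ge0. Qed.

(* Before time [size s] no history ends with [s], hence the inequality. *)
Lemma prob_after_law n s : (prob_after K n (has_recent s) <= p s)%R.
Proof.
have [sn|ns] := leqP (size s) n.
  by rewrite (prob_after_recent K_ge0 K_sum p_nil p_cons).
rewrite (_ : prob_after _ _ _ = 0%R) ?law_ge0//; apply: EFin_inj.
rewrite prob_afterE// -(@iter_step_cst _ _ K K_ge0 K_sum n 0 [::])//.
apply: eq_iter_step => // y; rewrite addn0 => yn; rewrite /indic_seq /has_recent.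
case: eqP => // ys; have := size_take (size s) y.
by rewrite ys yn; case: ltnP => //; lia.
Qed.

(* At most one of the windows [W i] is seen, and it projects to [s]. *)
Lemma esum_prob_after_le (I : choiceType) (W : I -> seq T) s n :
  injective W -> (forall i, map pr (W i) = s) ->
  \esum_(i in [set: I]) (prob_after J n (has_recent (W i)))%:E <= (p s)%:E.
Proof.
move=> Winj Ws; apply: (@le_trans _ _ (prob_after K n (has_recent s))%:E); last first.
  by rewrite lee_fin prob_after_law.
have J_sum := J_sum_pr.
under eq_esum do rewrite prob_afterE//.
rewrite -iter_step_esum//; last by move=> *; exact: indic_seq_ge0.
rewrite -prob_after_pr prob_afterE//; apply: le_iter_step => // y _.
have [[i yi]|yW] := pselect (exists i, has_recent (W i) y); last first.
  rewrite esum1 ?indic_seq_ge0// => i _; rewrite /indic_seq.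
  by case: (boolP (has_recent (W i) y)) => // ?; exfalso; apply: yW; exists i.
have sz j : size (W j) = size s by rewrite -(Ws j) size_map.
rewrite (@esum_single _ _ i); last 2 first.
- exact: indic_seq_ge0.
- move=> j ji; rewrite /indic_seq /has_recent sz; case: eqP => //= yj.
  have := yi; rewrite /has_recent sz yj => /eqP/Winj ij.
  by rewrite ij eqxx in ji.
rewrite /indic_seq /= {1}/has_recent lee_fin ler_nat.
have := yi; rewrite /has_recent sz => /eqP yiE.
by rewrite yiE eqxx -map_take yiE Ws eqxx.
Qed.

End Projection.

(** * The stationary limit law and its marginals *)

Section StationaryCoupling.
Context {R : realType} (A : choiceType).
Variables (K K' : seq A -> A -> R) (J : seq (A * A) -> A * A -> R).
Variables (p p' : seq A -> R) (L : (nat -> R) -> R).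
Local Open Scope ereal_scope.
Hypothesis HL : banach_limit L.
Hypothesis J_ge0 : forall z t, (0 <= J z t)%R.
Hypothesis J_fst : forall z a,
  \esum_(b in [set: A]) (J z (a, b))%:E = (K (map fst z) a)%:E.
Hypothesis J_snd : forall z b,
  \esum_(a in [set: A]) (J z (a, b))%:E = (K' (map snd z) b)%:E.
Hypothesis K_ge0 : forall s a, (0 <= K s a)%R.
Hypothesis K'_ge0 : forall s a, (0 <= K' s a)%R.
Hypothesis K_sum : forall s, \esum_(a in [set: A]) (K s a)%:E = 1.
Hypothesis K'_sum : forall s, \esum_(a in [set: A]) (K' s a)%:E = 1.
Hypothesis p_nil : p [::] = 1%R.
Hypothesis p'_nil : p' [::] = 1%R.
Hypothesis p_cons : forall a s, p (a :: s) = (K s a * p s)%R.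
Hypothesis p'_cons : forall a s, p' (a :: s) = (K' s a * p' s)%R.
Hypothesis p_rcons : forall s,
  \esum_(a in [set: A]) (p (rcons s a))%:E = (p s)%:E.
Hypothesis p'_rcons : forall s,
  \esum_(a in [set: A]) (p' (rcons s a))%:E = (p' s)%:E.
Hypothesis p_tuple : forall l, \esum_(t in [set: l.-tuple A]) (p t)%:E = 1.
Hypothesis p'_tuple : forall l, \esum_(t in [set: l.-tuple A]) (p' t)%:E = 1.

Let pair_bij : bijective (fun ab : A * A => (ab.1, ab.2)).
Proof. by exists id => -[]. Qed.

Let swap_bij : bijective (fun ab : A * A => (ab.2, ab.1)).
Proof. by exists (fun ab => (ab.2, ab.1)) => -[]. Qed.

Let p_ge0 s : (0 <= p s)%R. Proof. exact: law_ge0 p_cons _. Qed.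
Let p'_ge0 s : (0 <= p' s)%R. Proof. exact: law_ge0 p'_cons _. Qed.

Lemma J_sum z : \esum_(t in [set: A * A]) (J z t)%:E = 1.
Proof. exact: (J_sum_pr pair_bij J_ge0 K_sum J_fst). Qed.

Let fst_le (I : choiceType) (W : I -> seq (A * A)) s n :
  injective W -> (forall i, map fst (W i) = s) ->
  \esum_(i in [set: I]) (prob_after J n (has_recent (W i)))%:E <= (p s)%:E.
Proof.
apply: (esum_prob_after_le (mk := fun a b => (a, b)) pair_bij _ J_ge0 K_ge0
  K_sum J_fst p_nil p_cons p_rcons) => //.
Qed.

Let snd_le (I : choiceType) (W : I -> seq (A * A)) s n :
  injective W -> (forall i, map snd (W i) = s) ->
  \esum_(i in [set: I]) (prob_after J n (has_recent (W i)))%:E <= (p' s)%:E.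
Proof.
apply: (esum_prob_after_le (mk := fun b a => (a, b)) swap_bij _ J_ge0 K'_ge0
  K'_sum J_snd p'_nil p'_cons p'_rcons) => //.
Qed.

Let term_le (q : seq A -> R) (f : A * A -> A) n w :
  (forall (I : choiceType) (W : I -> seq (A * A)) s m, injective W ->
     (forall i, map f (W i) = s) ->
     \esum_(i in [set: I]) (prob_after J m (has_recent (W i)))%:E <= (q s)%:E) ->
  (prob_after J n (has_recent w) <= q (map f w))%R.
Proof.
move=> H; have /(_ unit (fun=> w) (map f w) n) := H.
rewrite (@esum_single _ _ tt) ?lee_fin ?prob_after_ge0//; last exact: J_sum.
  by apply => // -[] [].
Qed.

Definition limit_law (w : seq (A * A)) : R :=
  L (fun n => prob_after J n (has_recent w)).

Let prob_bounded w : bounded_seq (fun n => prob_after J n w).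
Proof.
apply: (@bounded_seq_itv _ _ 1) => n.
by rewrite prob_after_ge0 ?prob_after_le1//; exact: J_sum.
Qed.

Lemma limit_law_ge0 w : (0 <= limit_law w)%R.
Proof.
by apply: (blim_ge0 HL) => // n; rewrite prob_after_ge0//; exact: J_sum.
Qed.

Lemma limit_law_nil : limit_law [::] = 1%R.
Proof.
rewrite -[RHS](blim_cst HL); congr L; apply/funext => n; apply: EFin_inj.
rewrite prob_afterE//; last exact: J_sum.
rewrite -(@iter_step1 _ _ J J_sum n [::]).
by apply: eq_iter_step => // y _; rewrite /indic_seq /has_recent take0.
Qed.

(* Twofold dominated exchange: for a fixed first letter the windows are
   dominated by the law [p'] of the second coordinates, and their sums by [p]. *)
Let limit_law_exchange (V : A * A -> seq (A * A)) (v v' : A -> seq A)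
    (g : nat -> R) (c c' : R) n0 : 
  injective V ->
  (forall t, map fst (V t) = v t.1) -> (forall t, map snd (V t) = v' t.2) ->
  \esum_(a in [set: A]) (p (v a))%:E = c%:E ->
  \esum_(b in [set: A]) (p' (v' b))%:E = c'%:E ->
  bounded_seq g ->
  (forall n, (n0 <= n)%N ->
   \esum_(t in [set: A * A]) (prob_after J n (has_recent (V t)))%:E = (g n)%:E) ->
  \esum_(t in [set: A * A]) (limit_law (V t))%:E = (L g)%:E.
Proof.
move=> Vinj Vv Vv' pc p'c gb gE.
have Va_inj a : injective (fun b => V (a, b)) by move=> b b' /Vinj[].
have Vle a n : \esum_(b in [set: A]) (prob_after J n (has_recent (V (a, b))))%:E
    <= (p (v a))%:E by apply: fst_le.
pose f n t : R := prob_after J n (has_recent (V t)).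
have f0 n t : (0 <= f n t)%R by rewrite prob_after_ge0//; exact: J_sum.
pose G n a := fine (\esum_(b in [set: A]) (f n (a, b))%:E).
have GE n a : \esum_(b in [set: A]) (f n (a, b))%:E = (G n a)%:E.
  by have [s _ sE] := esum_EFin (fun b => f0 n (a, b)) (Vle a n); rewrite /G sE.
have G0 n a : (0 <= G n a <= p (v a))%R.
  by rewrite -!lee_fin -GE Vle andbT esum_ge0// => b _; rewrite lee_fin.
pose H n := fine (\esum_(a in [set: A]) (G n a)%:E).
have HE n : \esum_(a in [set: A]) (G n a)%:E = (H n)%:E.
  have [s _ sE] : exists2 s, (0 <= s <= c)%R & \esum_(a in [set: A]) (G n a)%:E = s%:E.
    apply: esum_EFin; first by move=> a; case/andP: (G0 n a).
    by rewrite -pc; apply: le_esum => a _; rewrite lee_fin; case/andP: (G0 n a).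
  by rewrite /H sE.
rewrite (@esum_mk _ _ _ _ (fun a b => (a, b)) pair_bij); last first.
  by move=> t; rewrite lee_fin limit_law_ge0.
have -> : L g = L H.
  apply: (@eq_blim_eventually _ _ HL n0) => //; last first.
    move=> n nn; apply: EFin_inj; rewrite -gE// -HE.
    rewrite (@esum_mk _ _ _ _ (fun a b => (a, b)) pair_bij); last first.
      by move=> t; rewrite lee_fin; exact: f0.
    by apply: eq_esum => a _; rewrite -GE.
  apply: (@bounded_seq_itv _ _ c) => n; rewrite -!lee_fin -HE -pc.
  rewrite esum_ge0/=; last by move=> a _; rewrite lee_fin; case/andP: (G0 n a).
  by apply: le_esum => a _; rewrite lee_fin; case/andP: (G0 n a).
rewrite -(esum_blim_dominated HL G0 pc HE); apply: eq_esum => a _.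
apply: (esum_blim_dominated HL (f := fun n b => f n (a, b)) _ p'c).
  by move=> n b; rewrite f0 -(Vv' (a, b)) (term_le _ _ snd_le).
by move=> n; rewrite GE.
Qed.

Lemma limit_law_cons w :
  \esum_(t in [set: A * A]) (limit_law (t :: w))%:E = (limit_law w)%:E.
Proof.
(* The delay by one matches [prob_after_cons]; shift invariance identifies [L g] with
   [limit_law w]. *)
pose g n := prob_after J n.-1 (has_recent w).
have gb : bounded_seq g.
  apply: (@bounded_seq_itv _ _ 1) => n.
  by rewrite prob_after_ge0 ?prob_after_le1//; exact: J_sum.
have -> : limit_law w = L g by rewrite -(blim_shift HL gb).
apply: (@limit_law_exchange _ (fun a => a :: map fst w) (fun b => b :: map snd w)
  g (p (map fst w)) (p' (map snd w)) 1) => //.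
- by move=> t u [].
- under eq_esum do rewrite p_cons mulrC EFinM.
  by rewrite esumZl// ?K_sum ?mule1// => a; rewrite lee_fin.
- under eq_esum do rewrite p'_cons mulrC EFinM.
  by rewrite esumZl// ?K'_sum ?mule1// => a; rewrite lee_fin.
- by case=> // n _; rewrite prob_after_cons//; exact: J_sum.
Qed.

Lemma limit_law_rcons w :
  \esum_(t in [set: A * A]) (limit_law (rcons w t))%:E = (limit_law w)%:E.
Proof.
apply: (@limit_law_exchange _ (fun a => rcons (map fst w) a)
  (fun b => rcons (map snd w) b) (fun n => prob_after J n (has_recent w))
  (p (map fst w)) (p' (map snd w)) (size w).+1) => //.
- by move=> t u /rcons_inj[].
- by move=> t; rewrite map_rcons.
- by move=> t; rewrite map_rcons.
- by move=> n wn; rewrite prob_after_rcons//; exact: J_sum.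
Qed.

Let fst_zip n (s : n.-tuple A) (t : n.-tuple A) : map fst (zip s t) = s.
Proof. by rewrite -/(unzip1 _) unzip1_zip// !size_tuple. Qed.

Let snd_zip n (s : n.-tuple A) (t : n.-tuple A) : map snd (zip s t) = t.
Proof. by rewrite -/(unzip2 _) unzip2_zip// !size_tuple. Qed.

(** One coordinate's window is fixed to [s] and the other is summed out. The terms are dominated by
    the law [q'] of the latter, whose total mass over windows of length [n] is 1, so no mass escapes
    in the limit. *)
Let zip_exchange n (q q' : seq A -> R) (f' : A * A -> A)
    (s : n.-tuple A) (W : n.-tuple A -> seq (A * A)) (E : pred (seq (A * A))) :
  (forall (I : choiceType) (V : I -> seq (A * A)) u m, injective V ->
     (forall i, map f' (V i) = u) ->
     \esum_(i in [set: I]) (prob_after J m (has_recent (V i)))%:E <= (q' u)%:E) ->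
  \esum_(t in [set: n.-tuple A]) (q' t)%:E = 1 ->
  (forall t, map f' (W t) = t) ->
  (forall m, (n <= m)%N -> prob_after J m E = q s) ->
  (forall y, (n <= size y)%N -> indic_seq (R := R) E y =
     \esum_(t in [set: n.-tuple A]) indic_seq (R := R) (has_recent (W t)) y) ->
  (forall y t, (size y < n)%N -> ~~ has_recent (W t) y) ->
  \esum_(t in [set: n.-tuple A]) (limit_law (W t))%:E = (q s)%:E.
Proof.
move=> q'le q'1 Wf' qE EW EN; have Jsum := J_sum.
(* Before time [n] no history contains a window of length [n], so the sum is 0 there; [L] ignores
   these finitely many terms. *)
pose g m := if (n <= m)%N then q s else 0%R.
have -> : q s = L g.
  rewrite -[LHS](blim_cst HL); apply: (@eq_blim_eventually _ _ HL n).
  - exact: bounded_seq_cst.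
  - by exists `|q s|%R => m; rewrite /g; case: ifP; rewrite // normr0.
  - by move=> m nm; rewrite /g nm.
apply: (esum_blim_dominated HL (f := fun m t => prob_after J m (has_recent (W t))) _ q'1).
  move=> m t; rewrite prob_after_ge0//= -[X in q' X]Wf'.
  exact: term_le q'le.
move=> m; under eq_esum do rewrite prob_afterE//.
rewrite -iter_step_esum//; last by move=> *; exact: indic_seq_ge0.
rewrite /g; case: ifPn => [nm|]; last first.
  rewrite -ltnNge => mn; rewrite -(@iter_step_cst _ _ J J_ge0 Jsum m 0%R [::])//.
  apply: eq_iter_step => // y; rewrite addn0 => ym.
  by apply: esum1 => t _; rewrite /indic_seq (negbTE (EN _ _ _))// ym.
rewrite -(qE m nm) prob_afterE//; apply: eq_iter_step => // y.
by rewrite addn0 => ym; rewrite EW// ym.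
Qed.

Lemma limit_law_fst n (s : n.-tuple A) :
  \esum_(t in [set: n.-tuple A]) (limit_law (zip s t))%:E = (p s)%:E.
Proof.
have szip (t : n.-tuple A) : size (zip s t) = n by rewrite size_zip !size_tuple minnn.
apply: (zip_exchange (f' := snd) (E := has_recent s \o map fst) snd_le (p'_tuple n)) => //.
- move=> m nm; rewrite (prob_after_pr (mk := fun a b => (a, b)) pair_bij _ J_ge0 K_ge0 K_sum J_fst)//.
  by rewrite (prob_after_recent K_ge0 K_sum p_nil p_cons p_rcons)// size_tuple.
- move=> y ny; rewrite /indic_seq /=.
  have st : size (map snd (take n y)) == n by rewrite size_map size_take_min; apply/eqP/minn_idPl.
  rewrite (@esum_single _ _ (Tuple st)) ?lee_fin//.
    rewrite /has_recent szip /= size_tuple -map_take; congr ((nat_of_bool _)%:R%:E).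
    apply/eqP/eqP => [yz|->].
      by rewrite -[in RHS]yz /= zip_unzip.
    by rewrite (fst_zip s (Tuple st)).
  move=> t tn; rewrite /has_recent szip; case: eqP => // yz; exfalso.
  by move/eqP: tn; apply; apply/val_inj; rewrite /= yz snd_zip.
- move=> y t yn; rewrite /has_recent szip; apply/eqP => yz.
  by have := szip t; rewrite -yz size_take_min => /minn_idPl; rewrite leqNgt yn.
Qed.

Lemma limit_law_snd n (s : n.-tuple A) :
  \esum_(t in [set: n.-tuple A]) (limit_law (zip t s))%:E = (p' s)%:E.
Proof.
have szip (t : n.-tuple A) : size (zip t s) = n by rewrite size_zip !size_tuple minnn.
apply: (zip_exchange (f' := fst) (E := has_recent s \o map snd) fst_le (p_tuple n)) => //.
- move=> m nm; rewrite (prob_after_pr (mk := fun b a => (a, b)) swap_bij _ J_ge0 K'_ge0 K'_sum J_snd)//.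
  by rewrite (prob_after_recent K'_ge0 K'_sum p'_nil p'_cons p'_rcons)// size_tuple.
- move=> y ny; rewrite /indic_seq /=.
  have st : size (map fst (take n y)) == n by rewrite size_map size_take_min; apply/eqP/minn_idPl.
  rewrite (@esum_single _ _ (Tuple st)) ?lee_fin//.
    rewrite /has_recent szip /= size_tuple -map_take; congr ((nat_of_bool _)%:R%:E).
    apply/eqP/eqP => [yz|->].
      by rewrite -[in RHS]yz /= zip_unzip.
    by rewrite (snd_zip (Tuple st) s).
  move=> t tn; rewrite /has_recent szip; case: eqP => // yz; exfalso.
  by move/eqP: tn; apply; apply/val_inj; rewrite /= yz fst_zip.
- move=> y t yn; rewrite /has_recent szip; apply/eqP => yz.
  by have := szip t; rewrite -yz size_take_min => /minn_idPl; rewrite leqNgt yn.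
Qed.

(** Only an upper bound on the disagreement is wanted, and this is the direction that the Fatou
    inequality gives. *)
Lemma limit_law_mismatch :
  \esum_(t in [set: A * A]) ((t.1 != t.2)%:R * limit_law [:: t])%:E <=
  (L (fun n => prob_after J n (mismatch (fun t => t.1 == t.2))))%:E.
Proof.
under eq_esum do rewrite -(blimZ HL)//.
have Jsum := J_sum; have ge0 := @indic_seq_ge0 R (A * A)%type.
apply: (@esum_blim_le _ _ HL _ (fun n t => (t.1 != t.2)%:R * prob_after J n (has_recent [:: t]))%R) => //.
  by move=> n t; rewrite mulr_ge0// prob_after_ge0.
move=> n; under eq_esum do rewrite EFinM prob_afterE//.
under eq_esum do rewrite -iter_stepZ//.
rewrite -iter_step_esum//; last first.
  by move=> t y; rewrite mule_ge0 ?lee_fin//; exact: indic_seq_ge0.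
rewrite prob_afterE//; apply: le_iter_step => // -[|t y] _.
  by rewrite esum1// => t _; rewrite /indic_seq mule0.
rewrite (@esum_single _ _ t).
- by rewrite /indic_seq /has_recent /= take0 eqxx mule1.
- by rewrite mule_ge0 ?lee_fin//; exact: indic_seq_ge0.
- move=> u ut; rewrite /indic_seq /has_recent /= take0 eqseq_cons [t == u]eq_sym.
  by rewrite (negbTE ut) mule0.
Qed.

End StationaryCoupling.

(** * Frequency of disagreements in the limit *)

Section MismatchLimit.
Context {R : realType} (T : choiceType) (J : seq T -> T -> R) (dg : pred T).
Variables (k0 m k : nat) (al : nat -> R) (rho0 : R) (L : (nat -> R) -> R).
Hypothesis HL : banach_limit L.
Hypothesis J_ge0 : forall z t, (0 <= J z t)%R.
Hypothesis J_sum : forall z, (\esum_(t in [set: T]) (J z t)%:E = 1)%E.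
Hypothesis (k0k : (k0 <= k)%N) (k0m : (k0 <= m)%N).
Hypothesis al_itv : forall j, 0 <= al j <= 1.
Hypothesis rho0_ge0 : 0 <= rho0.
Hypothesis match_ge : forall j z, (k0 <= j <= k)%N -> agree dg j z ->
  ((al j)%:E <= \esum_(t in [set: T]) (J z t * (dg t)%:R)%:E)%E.
Hypothesis coalesce_ge : forall z, (k0 <= size z)%N ->
  (rho0%:E <= iter m (step J) (indic_seq (agree dg k0)) z)%E.

(* In the long run disagreements that are exactly [k] letters old are as
   frequent as disagreements that end a run of [k] agreements, and the latter
   have probability at most [1 - al k]. *)
Lemma blim_mismatch_le :
  rho0 * (\prod_(k0 <= l < k) al l) * L (fun n => prob_after J n (mismatch dg)) <=
  m.+1%:R * (1 - al k).
Proof.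
have al_ge0 j : 0 <= al j by case/andP: (al_itv j).
have al_le1 j : al j <= 1 by case/andP: (al_itv j).
have pb E i : bounded_seq (fun n => prob_after J (n + i) E).
  apply: (@bounded_seq_itv _ _ 1) => n.
  by rewrite prob_after_ge0 ?prob_after_le1.
have pb0 E : bounded_seq (fun n => prob_after J n E).
  by apply: (@bounded_seq_itv _ _ 1) => n; rewrite prob_after_ge0 ?prob_after_le1.
set n' := (m + (k - k0))%N.
rewrite -(blimZ HL)//; pose D n := prob_after J n (agree_exactly dg k).
(* The bound of [exactly_le] at time [n.+1]; its increment has Banach limit 0, so
   [L H = 1 - al k]. *)
pose H n := (1 - al k) + (prob_after J n.+1 (agree dg k) +
  (-1) * prob_after J n (agree dg k)).
have Hb : bounded_seq H.
  apply: bounded_seqD; first exact: bounded_seq_cst.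
  apply: bounded_seqD; last exact: bounded_seqZ.
  have := pb (agree dg k) 1%N; by under eq_fun do rewrite addn1.
have LH : L H = 1 - al k.
  rewrite (blimD HL); last 2 first.
  - exact: bounded_seq_cst.
  - apply: bounded_seqD; last exact: bounded_seqZ.
    have := pb (agree dg k) 1%N; by under eq_fun do rewrite addn1.
  rewrite (blim_cst HL) (blimD HL); last 2 first.
  - have := pb (agree dg k) 1%N; by under eq_fun do rewrite addn1.
  - exact: bounded_seqZ.
  by rewrite (blimZ HL)// (blim_shift HL (pb0 _)) mulN1r subrr addr0.
have LD : L D <= 1 - al k.
  rewrite -LH -(blim_shift HL (pb0 _)).
  apply: (@le_blim_eventually _ _ HL k) => //.
    have := pb (agree_exactly dg k) 1%N; by under eq_fun do rewrite addn1.
  move=> n kn; rewrite /H mulN1r.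
  exact: (exactly_le J_ge0 J_sum k0k al_le1 match_ge (n := n.+1)).
apply: (@le_trans _ _ (L (fun n => \sum_(0 <= i < m.+1) D (n + (n' - i))%N))).
  apply: (@le_blim_eventually _ _ HL k0).
  - exact: bounded_seqZ.
  - by apply: bounded_seq_sum => i; exact: pb.
  - move=> n k0n.
    have := mismatch_le_exactly J_ge0 J_sum k0k k0m al_ge0 rho0_ge0 match_ge coalesce_ge k0n.
    rewrite -/n' => /le_trans; apply.
    rewrite le_eqVlt; apply/orP; left; apply/eqP; apply: eq_big_nat => i im.
    by rewrite /D; congr (prob_after J _ _); rewrite /n'; lia.
rewrite (blim_sum HL)//; last by move=> i; exact: pb.
have Db : bounded_seq D by exact: pb0.
under eq_bigr do rewrite (blim_shiftn HL _ Db).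
by rewrite sumr_const_nat subn0 -[leLHS]mulr_natl ler_wpM2l.
Qed.

End MismatchLimit.

(** * The joint transition kernel *)

Section CouplingKernel.
Context {R : realType} (A : choiceType).
Variables (K K' : seq A -> A -> R) (beta r : seq A -> A -> R).
Variables (c : seq A -> seq A -> A -> A -> R) (k0 m k : nat) (al : nat -> R).
Local Open Scope ereal_scope.
Hypothesis k0k : (k0 <= k)%N.
Hypothesis K_sum : forall s, \esum_(a in [set: A]) (K s a)%:E = 1.
Hypothesis K'_sum : forall s, \esum_(a in [set: A]) (K' s a)%:E = 1.
Hypothesis K_ge0 : forall s a, (0 <= K s a)%R.
Hypothesis K'_ge0 : forall s a, (0 <= K' s a)%R.
Hypothesis K_ge : forall j s a, (k0 <= j <= k)%N -> (j <= size s)%N ->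
  (beta (take j s) a <= K s a)%R.
Hypothesis K'_ge : forall j s a, (k0 <= j <= k)%N -> (j <= size s)%N ->
  (beta (take j s) a <= K' s a)%R.
Hypothesis beta_sum : forall j s, size s = j ->
  (al j)%:E <= \esum_(a in [set: A]) (beta s a)%:E.
Hypothesis c_ge0 : forall s s' a b, (0 <= c s s' a b)%R.
Hypothesis c_row : forall s s' a,
  \esum_(b in [set: A]) (c s s' a b)%:E = (r s a)%:E.
Hypothesis c_col : forall s s' b,
  \esum_(a in [set: A]) (c s s' a b)%:E = (r s' b)%:E.
Hypothesis r_le : forall s a, size s = k0 -> (r s a <= beta s a)%R.
Hypothesis c_diag : forall s a b, a != b -> c s s a b = 0%R.

(* The probability under [c] that two [k0]-step chains started at [s] and [s']
   are at the same string after [n] steps. *)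
Fixpoint coalesce (n : nat) (s s' : seq A) : \bar R :=
  if n is n'.+1 then
    \esum_(t in [set: A * A]) ((c s s' t.1 t.2)%:E *
       coalesce n' (take k0 (t.1 :: s)) (take k0 (t.2 :: s')))
  else (s == s')%:R%:E.

Lemma coalesce_ge0 n s s' : 0 <= coalesce n s s'.
Proof.
elim: n s s' => [|n IHn] s s' //=.
by apply: esum_ge0 => t _; rewrite mule_ge0 ?lee_fin.
Qed.

Let dg (t : A * A) := t.1 == t.2.

Lemma agree_take j (z : seq (A * A)) : (j <= size z)%N ->
  agree dg j z = (take j (map fst z) == take j (map snd z)).
Proof.
elim: j z => [|j IHj] [|[a b] z] //= jz.
by rewrite agree_cons /= eqseq_cons IHj.
Qed.

(** [coupling_extension] is applied after every history, with [c] at the last [k0] letters as the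
    part to be preserved. Dominating [c] gives the bound by [coalesce]. Where these letters agree,
    [c] is diagonal, so adding the matched residuals brings the diagonal up to the minimum of the
    two kernels, hence above [beta]. *)
Lemma exists_coupling_kernel : exists J : seq (A * A) -> A * A -> R,
  [/\ forall z t, (0 <= J z t)%R,
      forall z a, \esum_(b in [set: A]) (J z (a, b))%:E = (K (map fst z) a)%:E,
      forall z b, \esum_(a in [set: A]) (J z (a, b))%:E = (K' (map snd z) b)%:E,
      forall j z, (k0 <= j <= k)%N -> agree dg j z ->
        (al j)%:E <= \esum_(t in [set: A * A]) (J z t * (dg t)%:R)%:E
    & forall n z, (k0 <= size z)%N ->
        coalesce n (take k0 (map fst z)) (take k0 (map snd z)) <=
        iter n (step J) (indic_seq (agree dg k0)) z].
Proof.
(* Until [k0] letters are available nothing is imposed on the coupling, and the preserved part is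
   0. *)
pose cc (z : seq (A * A)) a b : R := if (k0 <= size z)%N then
  c (take k0 (map fst z)) (take k0 (map snd z)) a b else 0%R.
pose rr (z : seq (A * A)) a : R := if (k0 <= size z)%N then r (take k0 (map fst z)) a else 0%R.
pose rr' (z : seq (A * A)) a : R := if (k0 <= size z)%N then r (take k0 (map snd z)) a else 0%R.
have k0kk : (k0 <= k0 <= k)%N by rewrite leqnn k0k.
have ex z : exists w : A -> A -> R,
    [/\ forall a b, (cc z a b <= w a b)%R,
        forall a, \esum_(b in [set: A]) (w a b)%:E = (K (map fst z) a)%:E,
        forall b, \esum_(a in [set: A]) (w a b)%:E = (K' (map snd z) b)%:E
      & forall a, (cc z a a + Num.min (K (map fst z) a - rr z a) (K' (map snd z) a - rr' z a)
                   <= w a a)%R].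
  rewrite /cc /rr /rr'; case: leqP => [k0z|_]; apply: coupling_extension => //.
  - move=> a; apply: le_trans (r_le _ _) (K_ge _ _ _) => //.
      by rewrite size_take_min size_map; exact/minn_idPl.
    by rewrite size_map.
  - move=> a; apply: le_trans (r_le _ _) (K'_ge _ _ _) => //.
      by rewrite size_take_min size_map; exact/minn_idPl.
    by rewrite size_map.
  - by move=> a; rewrite esum1.
  - by move=> a; rewrite esum1.
have [w wP] := choice ex.
have cc0 z a b : (0 <= cc z a b)%R by rewrite /cc; case: ifP.
have w0 z a b : (0 <= w z a b)%R.
  by case: (wP z) => /(_ a b)/(le_trans (cc0 z a b)).
exists (fun z t => w z t.1 t.2); split.
- by [].
- by move=> z a; case: (wP z) => _ /(_ a).
- by move=> z b; case: (wP z) => _ _ /(_ b).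
- move=> j z jk za; have jz : (j <= size z)%N by case/andP: za.
  have k0j : (k0 <= j)%N by case/andP: jk.
  have k0z := leq_trans k0j jz.
  have := agreeW k0j za; rewrite agree_take// => /eqP z0.
  have := za; rewrite agree_take// => /eqP zj.
  rewrite (_ : \esum_(t in _) _ = \esum_(t in [set: A * A])
      (fun a b => (w z a b * (dg (a, b))%:R)%:E) t.1 t.2); last first.
    by apply: eq_esum => -[].
  rewrite (@esum_pair _ _ _ (fun a b => (w z a b * (dg (a, b))%:R)%:E)); last first.
    by move=> a b; rewrite lee_fin mulr_ge0.
  apply: le_trans (beta_sum _) _; last first.
    apply: (@le_esum _ _ _ (fun a => (beta (take j (map fst z)) a)%:E)) => a _.
    rewrite (@esum_single _ _ a) ?lee_fin ?mulr_ge0//; last first.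
      by move=> b; rewrite /dg /= eq_sym => /negbTE ->; rewrite mulr0.
    rewrite /dg eqxx mulr1; case: (wP z) => _ _ _ /(_ a); apply: le_trans.
    (* From equal strings a row of [c] has only its diagonal entry, so
       [cc + min (K - rr) (K' - rr')] at [a] is the minimum of [K] and [K']. *)
    have -> : rr z a = cc z a a.
      apply: EFin_inj; rewrite /rr /cc k0z -(c_row _ (take k0 (map snd z))) z0.
      rewrite (@esum_single _ _ a) ?lee_fin// => b; rewrite eq_sym => ab.
      by rewrite c_diag.
    have -> : rr' z a = cc z a a.
      apply: EFin_inj; rewrite /rr' /cc k0z -(c_row _ (take k0 (map snd z))) z0.
      rewrite (@esum_single _ _ a) ?lee_fin// => b; rewrite eq_sym => ab.
      by rewrite c_diag.
    have := K_ge a jk (_ : j <= size (map fst z))%N.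
    have := K'_ge a jk (_ : j <= size (map snd z))%N.
    rewrite !size_map -zj => /(_ jz) h1 /(_ jz) h2.
    by rewrite -lerBlDl le_min !lerD2r h1 h2.
  by rewrite size_take_min size_map; exact/minn_idPl.
- elim=> [|n IHn] z k0z /=.
    by rewrite /indic_seq agree_take.
  apply: le_esum => -[a b] _ /=.
  apply: lee_pmul; [by rewrite lee_fin|exact: coalesce_ge0| |].
    case: (wP z) => /(_ a b); rewrite /cc k0z.
    by rewrite lee_fin.
  apply: le_trans (IHn ((a, b) :: z) _); last by rewrite /= leqW.
  (* Cutting to [k0] letters before adding a letter changes nothing after the next cut, so the
     [k0]-step chain of [coalesce] follows the full history. *)
  have tk (x : A) s : take k0 (x :: take k0 s) = take k0 (x :: s).
    case: (k0) => // i /=; congr (_ :: _).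
    by rewrite -take_min; congr (take _ s); lia.
  by rewrite !tk.
Qed.

End CouplingKernel.

(** * Realising consistent cylinder probabilities on the unit interval *)

Section UnitInterval.
Context {R : realType}.
Local Open Scope ereal_scope.

Local Notation unif := (uniform_prob (@ltr01 R)).

Lemma unif_sub (U : set R) : measurable U -> U `<=` `[0%R, 1%R] ->
  unif U = lebesgue_measure U.
Proof.
move=> mU U01; rewrite /uniform_prob.
rewrite (eq_integral (fun=> 1)); last first.
  move=> x; rewrite inE => /U01; rewrite /= in_itv /= /uniform_pdf => ->.
  by rewrite subr0 invr1.
by rewrite integral_cst// mul1e.
Qed.

Lemma unif_itv (a b : R) : (0 <= a)%R -> (a <= b)%R -> (b <= 1)%R ->
  unif `[a, b[ = (b - a)%:E.
Proof.
move=> a0 ab b1; rewrite unif_sub//; last first.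
  move=> x /=; rewrite !in_itv /= => /andP[ax xb].
  by rewrite (le_trans a0)//= (le_trans (ltW xb)).
rewrite lebesgue_measure_itv /= lte_fin; case: ltP => [//|ba].
by rewrite (_ : b = a) ?subrr//; apply/eqP; rewrite eq_le ab ba.
Qed.

Lemma unif_unit_itv : unif `[0%R, 1%R[ = 1.
Proof. by rewrite unif_itv// subr0. Qed.

Lemma unif_itvI (U : set R) : measurable U -> unif (U `&` `[0%R, 1%R[) = unif U.
Proof.
move=> mU; apply/eqP; rewrite eq_le le_measure ?inE//=; last exact: measurableI.
have m1 : measurable (`[0%R, 1%R[ : set R) by exact: measurable_itv.
rewrite -{1}(setIT U) -(setUv (`[0%R, 1%R[ : set R)) setIUr.
rewrite (le_trans (measureU2 _ _ _))//; try (by apply: measurableI => //; exact: measurableC).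
have : unif (U `&` ~` `[0%R, 1%R[) <= unif (~` `[0%R, 1%R[).
  by apply: le_measure; rewrite ?inE//; [apply: measurableI => //|]; exact: measurableC.
by rewrite probability_setC// [X in 1 - X]unif_unit_itv subee// measure_le0 => /eqP ->; rewrite adde0.
Qed.

End UnitInterval.

Section PartialSums.
Context {R : realType} (f : nat -> R) (S : R).
Hypothesis f_ge0 : forall n, 0 <= f n.
Hypothesis f_sum : (\esum_(n in [set: nat]) (f n)%:E = S%:E)%E.

Definition psum (n : nat) : R := \sum_(0 <= i < n) f i.

Lemma psumS n : psum n.+1 = psum n + f n.
Proof. by rewrite /psum big_nat_recr. Qed.

Lemma psum_ge0 n : 0 <= psum n.
Proof. exact: sumr_ge0. Qed.

Lemma psum_homo i j : (i <= j)%N -> psum i <= psum j.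
Proof.
move=> /subnK <-; elim: (j - i)%N => [//|n IHn]; rewrite addSn psumS.
by rewrite (le_trans IHn)// lerDl.
Qed.

Lemma psum_le n : psum n <= S.
Proof.
rewrite -lee_fin -f_sum -nneseries_esumT; last by move=> i; rewrite lee_fin.
rewrite /psum -sumEFin; apply: nneseries_lim_ge => i _ _.
by rewrite lee_fin.
Qed.

Lemma psum_locate u : 0 <= u < S -> exists n, psum n <= u < psum n.+1.
Proof.
move=> /andP[u0 uS].
have ex : exists n, u < psum n.
  apply: contrapT => /forallNP nex.
  have : (S%:E <= u%:E)%E; last by rewrite lee_fin leNgt uS.
  rewrite -f_sum -nneseries_esumT; last by move=> i; rewrite lee_fin.
  apply: lime_le; first by apply: is_cvg_nneseries => i _ _; rewrite lee_fin.
  apply: nearW => n; rewrite sumEFin lee_fin leNgt; apply/negP; exact: nex.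
case: (ex_minnP ex) => -[|n] un nmin.
  by rewrite /psum big_geq// ltNge u0 in un.
exists n; rewrite un andbT leNgt; apply/negP => /nmin; by rewrite ltnn.
Qed.

End PartialSums.

Section NestedIntervals.
Context {R : realType} (D : countType) (d0 : D) (mass : seq D -> R).
Hypothesis mass_ge0 : forall d, 0 <= mass d.
Hypothesis mass_nil : mass [::] = 1.
Hypothesis mass_cons : forall d,
  (\esum_(e in [set: D]) (mass (e :: d))%:E = (mass d)%:E)%E.
Local Notation unif := (uniform_prob (@ltr01 R)).

(** The codes of [D] in nat give the children a left-to-right order. A number coding no element gets
    weight 0, hence an empty interval, so partial sums over nat serve as end points and the children
    tile their parent. *)
Let wt (d : seq D) (n : nat) : R := oapp (fun e => mass (e :: d)) 0 (@pickle_inv D n).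

Let wt_ge0 d n : 0 <= wt d n.
Proof. by rewrite /wt; case: pickle_inv => /=. Qed.

Let wt_pickle d e : wt d (pickle e) = mass (e :: d).
Proof. by rewrite /wt pickleK_inv. Qed.

Let wt_sum d : (\esum_(n in [set: nat]) (wt d n)%:E = (mass d)%:E)%E.
Proof.
rewrite -mass_cons; under [RHS]eq_esum do rewrite -wt_pickle.
rewrite -(esum_image setT (@pickle D) (EFin \o wt d)); last first.
  by move=> x y _ _; exact: (pcan_inj pickleK).
rewrite [RHS]esum_mkcond; apply: eq_esum => n _; case: ifPn => //= nD.
rewrite /wt; case E : (@pickle_inv D n) => [e|//].
have := @pickle_invK D n; rewrite E /= => en.
by exfalso; move/negP: nD; apply; rewrite inE; exists e.
Qed.

(* The cylinder of [d] is realised by an interval of length [mass d]; its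
   children are placed in it from left to right. *)
Fixpoint left_end (d : seq D) : R :=
  if d is e :: d' then left_end d' + psum (wt d') (pickle e) else 0.

Definition cylinder_itv (d : seq D) : set R :=
  `[left_end d, left_end d + mass d[%classic.

Lemma cylinder_itv_sub e d : cylinder_itv (e :: d) `<=` cylinder_itv d.
Proof.
move=> u; rewrite /cylinder_itv /= !in_itv /= => /andP[lu ur].
rewrite (le_trans _ lu)/=; last by rewrite lerDl psum_ge0.
rewrite (lt_le_trans ur)// -addrA lerD2l -wt_pickle -psumS.
exact: psum_le (wt_ge0 d) (wt_sum d) _.
Qed.

Lemma cylinder_itv_inj e e' d u :
  cylinder_itv (e :: d) u -> cylinder_itv (e' :: d) u -> e = e'.
Proof.
have H a b : cylinder_itv (a :: d) u -> cylinder_itv (b :: d) u ->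
    (pickle b <= pickle a)%N.
  rewrite /cylinder_itv /= !in_itv /= => /andP[_ ua] /andP[bu _].
  rewrite leqNgt; apply/negP => ab; have := lt_le_trans ua (le_trans _ bu).
  rewrite ltxx => /(_ _) h; have : false; last by [].
  apply: h; rewrite -addrA lerD2l -wt_pickle -psumS.
  exact: psum_homo (wt_ge0 d) _ _ ab.
move=> ue ue'; apply: (pcan_inj pickleK); apply/eqP.
by rewrite eqn_leq !H.
Qed.

Lemma cylinder_itv_cover d u : cylinder_itv d u ->
  exists e, cylinder_itv (e :: d) u.
Proof.
rewrite {1}/cylinder_itv /= in_itv /= => /andP[lu ur].
have [|n] := psum_locate (wt_ge0 d) (wt_sum d) (u := u - left_end d).
  by rewrite subr_ge0 lu ltrBlDl.
rewrite psumS /wt; case E : (@pickle_inv D n) => [e|] /=; last first.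
  by rewrite addr0 => /andP[/le_lt_trans h /h]; rewrite ltxx.
have := @pickle_invK D n; rewrite E /= => <- /andP[nu un].
exists e; rewrite /cylinder_itv /= in_itv /=; apply/andP; split.
  by rewrite -lerBrDl.
by rewrite -addrA -ltrBlDl.
Qed.

Lemma left_end_ge0 d : 0 <= left_end d.
Proof. by elim: d => [|e d IHd] //=; rewrite addr_ge0// psum_ge0. Qed.

Lemma right_end_le1 d : left_end d + mass d <= 1.
Proof.
elim: d => [|e d IHd] /=; first by rewrite mass_nil add0r.
rewrite (le_trans _ IHd)// -addrA lerD2l -wt_pickle -psumS.
exact: psum_le (wt_ge0 d) (wt_sum d) _.
Qed.

Fixpoint node (n : nat) (u : R) : seq D :=
  if n is n'.+1 then
    xget d0 [set e | cylinder_itv (e :: node n' u) u] :: node n' u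
  else [::].

Lemma size_node n u : size (node n u) = n.
Proof. by elim: n => //= n ->. Qed.

Lemma nodeP d u : 0 <= u < 1 -> node (size d) u = d <-> cylinder_itv d u.
Proof.
move=> u01; elim: d => [|e d IHd] /=.
  by split=> // _; rewrite /cylinder_itv /= in_itv /= mass_nil add0r.
split=> [[ue ud]|ud].
  have {}ud' := ud; move/IHd: ud => ud.
  have [e' ue'] := cylinder_itv_cover ud.
  by move: ue; rewrite ud'; case: xgetP => [x _ ux <- //|/(_ e')].
have /IHd -> : cylinder_itv d u by exact: cylinder_itv_sub ud.
congr (_ :: _); case: xgetP => [x _ ux|/(_ e)//].
exact: cylinder_itv_inj ux ud.
Qed.

(** Points outside [0, 1[ have uniform measure 0 but lie in no cylinder. Sending them all to 0 makes
    [digits] constant there, hence measurable on the whole line. *)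
Let clamp (u : R) : R := if 0 <= u < 1 then u else 0.

Let clampE u : 0 <= u < 1 -> clamp u = u.
Proof. by rewrite /clamp => ->. Qed.

Lemma cylinder_itv_unit d u : cylinder_itv d u -> 0 <= u < 1.
Proof.
rewrite /cylinder_itv /= in_itv /= => /andP[lu ur].
by rewrite (le_trans (left_end_ge0 d))//= (lt_le_trans ur (right_end_le1 d)).
Qed.

Lemma measurable_cylinder_itv d : measurable (cylinder_itv d).
Proof. exact: measurable_itv. Qed.

Definition digits (n : nat) (u : R) : seq D := node n (clamp u).

Lemma size_digits n u : size (digits n u) = n.
Proof. exact: size_node. Qed.

Lemma digits_unitE d :
  digits (size d) @^-1` [set d] `&` `[0, 1[ = cylinder_itv d.
Proof.
apply/seteqP; split=> u /=.
  rewrite in_itv /= => -[+ u01]; rewrite /digits clampE// => /nodeP; exact.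
move=> ud; have u01 := cylinder_itv_unit ud; split.
  by rewrite /digits clampE//; exact/nodeP.
by rewrite in_itv.
Qed.

Lemma measurable_digits n d : measurable (digits n @^-1` [set d]).
Proof.
have [dn|/eqP dn] := eqVneq (size d) n; last first.
  rewrite (_ : _ @^-1` _ = set0)//; apply/seteqP; split=> u //= ud.
  by apply: dn; rewrite -ud size_digits.
have m01 : measurable (`[0, 1[ : set R) by exact: measurable_itv.
rewrite -[_ @^-1` _]setIT -(setUv (`[0, 1[ : set R)) setIUr -{1}dn digits_unitE.
apply: measurableU; first exact: measurable_cylinder_itv.
have [d0d|d0d] := pselect (digits n 0 = d).
  rewrite (_ : _ `&` _ = ~` `[0, 1[); first exact: measurableC.
  apply/seteqP; split=> [u [] //|u u01]; split=> //=.
  by rewrite -d0d /digits /clamp lexx ltr01 /=; case: ifPn.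
rewrite (_ : _ `&` _ = set0)//; apply/seteqP; split=> u //= [ud u01].
by apply: d0d; rewrite -ud /digits /clamp lexx ltr01 /=; case: ifPn.
Qed.

Lemma unif_digits d : unif (digits (size d) @^-1` [set d]) = (mass d)%:E.
Proof.
rewrite -unif_itvI ?digits_unitE; last exact: measurable_digits.
rewrite /cylinder_itv unif_itv ?left_end_ge0 ?right_end_le1 ?lerDl//.
by rewrite addrC addKr.
Qed.

End NestedIntervals.

(** * Countable partitions and finite windows *)

Section Partition.
Context d (Omega : measurableType d) {R : realType} (I : countType).
Local Open Scope ereal_scope.

Lemma measurable_count_preimage (X : Omega -> I) (E : set I) :
  (forall i, measurable (X @^-1` [set i])) -> measurable (X @^-1` E).
Proof.
move=> mX; rewrite (_ : X @^-1` E = \bigcup_i (if i \in E then X @^-1` [set i] else set0)).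
  apply: countable_bigcupT_measurable => [|i]; first exact: countableP.
  by case: ifP.
apply/seteqP; split=> x /= => [Ex|[i _]].
  by exists (X x) => //; rewrite mem_set.
by case: ifPn => // /set_mem Ei /= ->.
Qed.

(** Disjointness is supplied by [X], which recovers the index from the point; the codes of the
    indices reduce the claim to sequences. *)
Lemma measure_count_bigcup (mu : {measure set Omega -> \bar R}) (X : Omega -> I)
    (F : I -> set Omega) : (forall i, measurable (F i)) ->
  (forall i x, F i x -> X x = i) ->
  mu (\bigcup_i F i) = \esum_(i in [set: I]) mu (F i).
Proof.
move=> mF FX; pose G n := \bigcup_(i in [set i | pickle i = n]) F i.
have mG n : measurable (G n).
  rewrite /G bigcup_mkcond; apply: countable_bigcupT_measurable => [|i].
    exact: countableP.
  by case: ifP.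
have tG : trivIset setT G.
  apply/trivIsetP => m n _ _ /eqP mn; apply/seteqP; split=> x //.
  move=> [[i /= im /FX xi] [j /= jn /FX xj]].
  by case: mn; rewrite -im -jn -xi -xj.
transitivity (mu (\bigcup_n G n)).
  congr (mu _); apply/seteqP; split=> x; last by move=> [n _ [i _ xi]]; exists i.
  by move=> [i _ xi]; exists (pickle i) => //; exists i.
rewrite measure_semi_bigcup//; last exact: bigcupT_measurable.
rewrite nneseries_esumT//.
have FE i : F i = G (pickle i).
  apply/seteqP; split=> x xi; first by exists i.
  by case: xi => j /= /(pcan_inj pickleK) ->.
under [RHS]eq_esum do rewrite FE.
rewrite -(esum_image setT (@pickle I) (fun n => mu (G n))); last first.
  by move=> x y _ _; exact: (pcan_inj pickleK).
rewrite [RHS]esum_mkcond; apply: eq_esum => n _; case: ifPn => // nI.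
rewrite (_ : G n = set0) ?measure0//; apply/seteqP; split=> x // [i /= xn _].
by move/negP: nI; apply; rewrite inE; exists i.
Qed.

Lemma measure_partition (mu : {measure set Omega -> \bar R}) (X : Omega -> I)
    (E : set Omega) : (forall i, measurable (X @^-1` [set i])) -> measurable E ->
  mu E = \esum_(i in [set: I]) mu (E `&` X @^-1` [set i]).
Proof.
move=> mX mE; rewrite -(@measure_count_bigcup mu X); last 2 first.
- by move=> i; exact: measurableI.
- by move=> i x [].
congr (mu _); apply/seteqP; split=> x; last by move=> [i _ []].
by move=> Ex; exists (X x).
Qed.

End Partition.

Section Windows.
Context d (Omega : measurableType d) {R : realType} (T : countType).
Variable xi : int -> Omega -> T.
Hypothesis measurable_xi : forall i t, measurable (xi i @^-1` [set t]).

(* Most recent letter first. *)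
Definition window (e : int) (l : nat) (x : Omega) : seq T :=
  mkseq (fun i => xi (e - i%:Z) x) l.

Lemma size_window e l x : size (window e l x) = l.
Proof. exact: size_mkseq. Qed.

Lemma window_cons e l x : window e l.+1 x = xi e x :: window (e - 1) l x.
Proof.
rewrite /window /mkseq /= subr0; congr (_ :: _).
rewrite (iotaDl 1 0) -map_comp; apply: eq_map => i /=.
by congr (xi _ x); rewrite PoszD; lia.
Qed.

Lemma window1 e x : window e 1 x = [:: xi e x].
Proof. by rewrite window_cons. Qed.

Lemma window_rcons e l x : window e l.+1 x = rcons (window e l x) (xi (e - l%:Z) x).
Proof. by rewrite /window mkseqS. Qed.

Lemma measurable_window e l w : measurable (window e l @^-1` [set w]).
Proof.
elim: l e w => [|l IHl] e w.
  have [->|w0] := eqVneq w [::].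
    by rewrite (_ : _ @^-1` _ = setT)//; apply/seteqP; split.
  rewrite (_ : _ @^-1` _ = set0)//; apply/seteqP; split=> x //= /esym/eqP.
  by rewrite (negbTE w0).
case: w => [|t w].
  by rewrite (_ : _ @^-1` _ = set0)//; apply/seteqP; split=> x.
rewrite (_ : _ @^-1` _ = xi e @^-1` [set t] `&` window (e - 1) l @^-1` [set w]).
  exact: measurableI.
apply/seteqP; split=> x /=; rewrite window_cons; first by case=> -> ->.
by move=> [-> ->].
Qed.

Section Consistency.
Variables (mu : {measure set Omega -> \bar R}) (q : seq T -> \bar R).
Hypothesis q_cons : forall w, (\esum_(t in [set: T]) q (t :: w) = q w)%E.
Hypothesis q_rcons : forall w, (\esum_(t in [set: T]) q (rcons w t) = q w)%E.

Let window_law e l := forall w, size w = l -> mu (window e l @^-1` [set w]) = q w.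

Let window_law_cons e l : window_law (e + 1) l.+1 -> window_law e l.
Proof.
move=> H w wl; rewrite (measure_partition mu (measurable_xi (e + 1))); last first.
  exact: measurable_window.
rewrite -q_cons; apply: eq_esum => t _; rewrite -H /= ?wl//; congr (mu _).
apply/seteqP; split=> x /=; rewrite window_cons addrK; first by move=> [-> ->].
by case=> -> ->.
Qed.

Let window_law_rcons e l : window_law e l.+1 -> window_law e l.
Proof.
move=> H w wl; rewrite (measure_partition mu (measurable_xi (e - l%:Z))); last first.
  exact: measurable_window.
rewrite -q_rcons; apply: eq_esum => t _; rewrite -H ?size_rcons ?wl//; congr (mu _).
apply/seteqP; split=> x /=; rewrite window_rcons; first by move=> [-> ->].
by move/rcons_inj=> [-> ->].
Qed.

(** Every window is contained in a centred one, covering the times from [-n] to [n - 1]. Summing out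
    the newest letters by [q_cons] and the oldest by [q_rcons] leads down to it. *)
Lemma window_law_all :
  (forall n w, size w = n.*2 -> mu (window (n%:Z - 1) n.*2 @^-1` [set w]) = q w) ->
  forall e l w, size w = l -> mu (window e l @^-1` [set w]) = q w.
Proof.
move=> H e l; pose n := (`|e|%N + l).+1.
have consn i e' l' : window_law (e' + i%:Z) (l' + i)%N -> window_law e' l'.
  elim: i e' l' => [|i IHi] e' l'; first by rewrite addr0 addn0.
  move=> h; apply: window_law_cons; apply: IHi.
  have -> : e' + 1 + i%:Z = e' + i.+1%:Z by lia.
  by rewrite addSnnS.
have rconsn i e' l' : window_law e' (l' + i)%N -> window_law e' l'.
  elim: i l' => [|i IHi] l'; first by rewrite addn0.
  by move=> h; apply: window_law_rcons; apply: IHi; rewrite addSnnS.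
have [i ei] : exists i : nat, n%:Z - 1 = e + i%:Z.
  by exists `|(n%:Z - 1 - e)%R|%N; rewrite /n; lia.
apply: (consn i); rewrite -ei.
apply: (rconsn (n.*2 - (l + i))%N).
have -> : (l + i + (n.*2 - (l + i)) = n.*2)%N by rewrite /n in ei *; lia.
exact: H.
Qed.

End Consistency.

Hypothesis measurable_generated :
  measurable `<=` <<s [set B | exists i t, B = xi i @^-1` [set t]] >>.

(** Centred windows are nested, so two events prescribing such windows are either disjoint or one
    contains the other. They thus form a pi-system, and by countability of [T] it generates the
    coordinate events. *)
Lemma windows_unique (mu nu : probability Omega R) :
  (forall e l w, mu (window e l @^-1` [set w]) = nu (window e l @^-1` [set w])) ->
  forall B, measurable B -> mu B = nu B.
Proof.
move=> munu B mB.
pose cw (n : nat) := window n%:Z n.*2.+1.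
pose G := [set B | B = set0 \/ B = setT \/ exists n w, B = cw n @^-1` [set w]].
have cw_sub n n' x : (n <= n')%N -> cw n x = take n.*2.+1 (drop (n' - n) (cw n' x)).
  move=> nn'; rewrite /cw /window; apply: (@eq_from_nth _ (xi 0 x)).
    rewrite size_mkseq size_take size_drop size_mkseq; case: ltnP => //; lia.
  rewrite size_mkseq => i i_n; rewrite nth_mkseq// nth_take// nth_drop nth_mkseq; last by lia.
  by congr (xi _ x); lia.
have Gm : G `<=` measurable.
  by move=> _ [->|[->|[n [w ->]]]]//; exact: measurable_window.
have GI : setI_closed G.
  have cwI n n' w w' : (n <= n')%N -> G (cw n @^-1` [set w] `&` cw n' @^-1` [set w']).
    move=> nn'; have [ww'|ww'] := eqVneq (take n.*2.+1 (drop (n' - n) w')) w.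
      right; right; exists n', w'; apply/seteqP; split=> x /=; first by case.
      by move=> xw'; split=> //; rewrite (cw_sub _ _ _ nn') xw'.
    left; apply/seteqP; split=> x //= [xw xw'].
    by move/eqP: ww'; apply; rewrite -xw' -xw -cw_sub.
  move=> A A' [->|[->|[n [w ->]]]]; first by move=> _; left; rewrite set0I.
    by rewrite setTI.
  move=> [->|[->|[n' [w' ->]]]]; first by left; rewrite setI0.
    by rewrite setIT; right; right; exists n, w.
  have [nn'|/ltnW nn'] := leqP n n'; first exact: cwI.
  by rewrite setIC; exact: cwI.
apply: (@g_sigma_algebra_measure_unique _ _ _ G Gm (fun=> setT) _ _ mu nu GI) => //.
- by move=> _; right; left.
- by rewrite bigcup_const.
- move=> A [->|[->|[n [w ->]]]]; [by rewrite !measure0| |exact: munu].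
  by transitivity (1 : \bar R)%E; [|apply/esym]; exact: probability_setT.
- by move=> _; apply: le_lt_trans (ltry 1); apply: probability_le1.
have := measurable_generated mB; apply: smallest_sub; first exact: smallest_sigma_algebra.
move=> _ [i [t ->]].
have -> : xi i @^-1` [set t] =
    cw `|i|%N @^-1` [set w | nth t w `|(`|i|%N%:Z - i)%R|%N = t].
  have ii : (`|(`|i|%N%:Z - i)%R|%N < `|i|%N.*2.+1)%N by lia.
  have E x : nth t (cw `|i|%N x) `|(`|i|%N%:Z - i)%R|%N = xi i x.
    by rewrite /cw /window nth_mkseq//; congr (xi _ x); lia.
  by apply/seteqP; split=> x /=; rewrite E.
apply: (@measurable_count_preimage _ (g_sigma_algebraType G) (seq T)) => w.
by apply: sub_sigma_algebra; right; right; exists `|i|%N, w.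
Qed.

End Windows.

(** * Trajectories and their string laws *)

Section Trajectories.
Context {R : realType} {N : option nat}.
Local Notation A := (letter N).
Local Notation unif := (uniform_prob (@ltr01 R)).

Definition letter_at (i : int) (w : trajectory N) : A := w i.
Definition letters_at (i : int) (w : trajectory N * trajectory N) : A * A :=
  (w.1 i, w.2 i).

Lemma measurable_letter_at i a : measurable (letter_at i @^-1` [set a]).
Proof. by apply: sub_sigma_algebra; exists i, a. Qed.

Lemma measurable_trajectoryE :
  @measurable _ (trajectory N) = <<s coordinate_events int N >>.
Proof. by []. Qed.

Lemma letter_at_generated : (measurable : set (set (trajectory N))) `<=`
  <<s [set B | exists i t, B = letter_at i @^-1` [set t]] >>.
Proof. by []. Qed.

Lemma measurable_letters_at i t : measurable (letters_at i @^-1` [set t]).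
Proof.
rewrite (_ : _ @^-1` _ = fst @^-1` (letter_at i @^-1` [set t.1]) `&`
                         snd @^-1` (letter_at i @^-1` [set t.2])).
  apply: measurableI; rewrite -[X in measurable X]setTI.
    exact: measurable_fst (measurable_letter_at _ _).
  exact: measurable_snd (measurable_letter_at _ _).
apply/seteqP; split=> w /=; rewrite /letters_at /letter_at; first by move=> <-.
by case: t => a b /= [-> ->].
Qed.

(** It suffices that both projections are measurable for the algebra generated by the joint letters;
    an event on one coordinate is a countable union over the letters of the other. *)
Lemma letters_at_generated :
  (measurable : set (set (trajectory N * trajectory N))) `<=`
  <<s [set B | exists i t, B = letters_at i @^-1` [set t]] >>.
Proof.
set G := [set B | _].
have m2 i t : (measurable : set (set (g_sigma_algebraType G))) (letters_at i @^-1` [set t]).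
  by apply: sub_sigma_algebra; exists i, t.
have mf : @measurable_fun _ _ (g_sigma_algebraType G) (trajectory N) setT fst.
  apply: (@measurability _ _ _ _ _ _ _ measurable_trajectoryE).
  move=> _ [_ [i [a ->]] <-]; rewrite setTI.
  rewrite (_ : _ @^-1` _ = letters_at i @^-1` [set t | t.1 = a])//.
  exact: measurable_count_preimage.
have ms : @measurable_fun _ _ (g_sigma_algebraType G) (trajectory N) setT snd.
  apply: (@measurability _ _ _ _ _ _ _ measurable_trajectoryE).
  move=> _ [_ [i [a ->]] <-]; rewrite setTI.
  rewrite (_ : _ @^-1` _ = letters_at i @^-1` [set t | t.2 = a])//.
  exact: measurable_count_preimage.
move=> B mB; have := mB; apply: smallest_sub; first exact: smallest_sigma_algebra.
by move=> _ [[C mC <-]|[C mC <-]]; [exact: mf|exact: ms].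
Qed.

Lemma measurable_into_trajectory d (Omega : measurableType d) (f : Omega -> trajectory N) :
  (forall i a, measurable ((fun x => f x i) @^-1` [set a])) -> measurable_fun setT f.
Proof.
move=> mf; apply: (@measurability _ _ _ _ _ _ _ measurable_trajectoryE).
by move=> _ [_ [i [a ->]] <-]; rewrite setTI; exact: mf.
Qed.

Lemma exists_pushforward d d' (Omega : measurableType d) (Omega' : measurableType d')
    (P : probability Omega R) (f : Omega -> Omega') : measurable_fun setT f ->
  exists Q : probability Omega' R, forall B, Q B = P (f @^-1` B).
Proof.
move=> mf; pose f' := HB.pack_for {mfun Omega >-> Omega'} f
  (isMeasurableFun.Build _ _ _ _ f mf).
by exists (distribution P f').
Qed.

Section PairProcess.
Variable Q : seq (A * A) -> R.
Hypothesis Q_ge0 : forall w, 0 <= Q w.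
Hypothesis Q_nil : Q [::] = 1.
Hypothesis Q_cons : forall w, (\esum_(t in [set: A * A]) (Q (t :: w))%:E = (Q w)%:E)%E.
Hypothesis Q_rcons : forall w, (\esum_(t in [set: A * A]) (Q (rcons w t))%:E = (Q w)%:E)%E.

Let T := (A * A)%type.

(* The n-th digit carries the letters at times [- n - 1] and [n]. *)
Let string (d : seq (T * T)) : seq T := map snd d ++ rev (map fst d).
Let mass (d : seq (T * T)) : R := Q (string d).

Let string_cons e d : string (e :: d) = e.2 :: rcons (string d) e.1.
Proof. by rewrite /string /= rev_cons rcons_cat. Qed.

Let mass_ge0 d : 0 <= mass d. Proof. exact: Q_ge0. Qed.
Let mass_nil : mass [::] = 1. Proof. exact: Q_nil. Qed.

Let mass_cons d : (\esum_(e in [set: T * T]) (mass (e :: d))%:E = (mass d)%:E)%E.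
Proof.
rewrite /mass -Q_rcons; under [RHS]eq_esum do rewrite -Q_cons.
rewrite -(@esum_pair _ _ _ (fun l r => (Q (r :: rcons (string d) l))%:E)); last first.
  by move=> *; rewrite lee_fin.
by apply: eq_esum => -[l r] _; rewrite string_cons.
Qed.

Let t0 : T := (point, point).
Let dig n u := digits (t0, t0) mass n u.

Let Z (i : int) (u : measurableTypeR R) : T := match i with
  | Posz n => (head (t0, t0) (dig n.+1 u)).2
  | Negz n => (head (t0, t0) (dig n.+1 u)).1
  end.

Let Z_window n u : window Z (n%:Z - 1) n.*2 u = string (dig n u).
Proof.
elim: n => [|n IHn]; first by [].
have -> : dig n.+1 u = head (t0, t0) (dig n.+1 u) :: dig n u by [].
rewrite string_cons -IHn doubleS window_cons; congr (_ :: _).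
  by rewrite /Z (_ : n.+1%:Z - 1 = Posz n)//; lia.
rewrite window_rcons (_ : n.+1%:Z - 1 - 1 = n%:Z - 1); last by lia.
congr (rcons _ _).
by rewrite /Z (_ : n%:Z - 1 - n.*2%:Z = Negz n)//; lia.
Qed.

Let string_surj (w : seq T) n : size w = n.*2 -> exists2 d, size d = n & string d = w.
Proof.
move=> wn; exists (zip (rev (drop n w)) (take n w)).
  by rewrite size_zip size_rev size_drop size_take; case: ltnP; lia.
have sz : size (rev (drop n w)) = size (take n w).
  by rewrite size_rev size_drop size_take; case: ltnP; lia.
rewrite /string -/(unzip1 _) -/(unzip2 _) unzip1_zip ?sz// unzip2_zip ?sz//.
by rewrite revK cat_take_drop.
Qed.

Let string_inj d d' : size d = size d' -> string d = string d' -> d = d'.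
Proof.
elim: d d' => [|e d IHd] [|e' d'] //= [sd]; rewrite !string_cons.
move=> [e2] /rcons_inj[/(IHd _ sd) -> e1].
by rewrite [e]surjective_pairing [e']surjective_pairing e1 e2.
Qed.

Let measurable_dig n (E : set (seq (T * T))) : measurable (dig n @^-1` E).
Proof.
apply: measurable_count_preimage => d.
exact: (measurable_digits _ mass_ge0 mass_nil mass_cons).
Qed.

Let measurable_Z i t : measurable (Z i @^-1` [set t]).
Proof.
case: i => n.
  exact: (measurable_dig n.+1 [set d | (head (t0, t0) d).2 = t]).
exact: (measurable_dig n.+1 [set d | (head (t0, t0) d).1 = t]).
Qed.

Let Z_law e l w : size w = l -> unif (window Z e l @^-1` [set w]) = (Q w)%:E.
Proof.
have H := @window_law_all _ (measurableTypeR R) R T Z measurable_Z (uniform_prob (@ltr01 R))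
  (fun w => (Q w)%:E) Q_cons Q_rcons.
move: e l w; apply: H.
move=> n w wn; have [d dn dw] := string_surj wn.
rewrite (_ : _ @^-1` _ = dig (size d) @^-1` [set d]); last first.
  apply/seteqP; split=> u /=; rewrite Z_window dn -dw; last by move=> ->.
  by apply: string_inj; rewrite size_digits dn.
by rewrite [LHS](unif_digits _ mass_ge0 mass_nil mass_cons) /mass dw.
Qed.

Lemma exists_pair_process : exists pi : probability (trajectory N * trajectory N)%type R,
  forall e l w, size w = l -> pi (window letters_at e l @^-1` [set w]) = (Q w)%:E.
Proof.
pose Phi u : trajectory N * trajectory N := (fun i => (Z i u).1, fun i => (Z i u).2).
have mPhi : measurable_fun setT Phi.
  apply: measurable_fun_pair; apply: measurable_into_trajectory => i a.
    exact: (measurable_count_preimage [set t | t.1 = a] (measurable_Z i)).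
  exact: (measurable_count_preimage [set t | t.2 = a] (measurable_Z i)).
have [pi piE] := @exists_pushforward _ _ (measurableTypeR R) _ unif Phi mPhi.
exists pi => e l w wl; rewrite piE -(Z_law e wl); congr (unif _).
have E u : window letters_at e l (Phi u) = window Z e l u.
  by apply: eq_map => i; rewrite /letters_at /=; case: (Z _ u).
by apply/seteqP; split=> u /=; rewrite E.
Qed.

End PairProcess.

End Trajectories.

(** * Laws of finite strings in a stationary chain *)

Section StationaryLaw.
Context {R : realType} {N : option nat}.
Local Notation A := (letter N).
Local Open Scope ereal_scope.

Lemma recentE (w : trajectory N) k : recent (past_of w) k = window letter_at (- 1) k w.
Proof.
apply: eq_map => i; rewrite /past_of /letter_at; congr (w _); lia.
Qed.

Let measurable_pastE : @measurable _ (past N) = <<s coordinate_events nat N >>.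
Proof. by []. Qed.

Let mwin e l s : measurable (window (@letter_at N) e l @^-1` [set s]).
Proof. by apply: measurable_window => i a; exact: measurable_letter_at. Qed.

Section Law.
Variable mu : probability (trajectory N) R.
Hypothesis mu_stationary : stationary mu.

Definition string_law (s : seq A) : R :=
  fine (mu (window letter_at (- 1) (size s) @^-1` [set s])).

Lemma string_law_ge0 s : (0 <= string_law s)%R.
Proof. by rewrite fine_ge0. Qed.

Let string_lawE0 s :
  mu (window letter_at (- 1) (size s) @^-1` [set s]) = (string_law s)%:E.
Proof.
rewrite fineK// ge0_fin_numE//; apply: le_lt_trans (ltry 1).
by apply: probability_le1; apply: measurable_window => i a; exact: measurable_letter_at.
Qed.

Let window_shift e l s :
  mu (window letter_at (e + 1) l @^-1` [set s]) = mu (window letter_at e l @^-1` [set s]).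
Proof.
rewrite -[RHS](mu_stationary (mwin _ _ _)); congr (mu _).
have E w : window letter_at e l (time_shift w) = window letter_at (e + 1) l w.
  by apply: eq_map => i; rewrite /letter_at /time_shift; congr (w _); lia.
by apply/seteqP; split=> w /=; rewrite E.
Qed.

Lemma string_lawE e l s : size s = l ->
  mu (window letter_at e l @^-1` [set s]) = (string_law s)%:E.
Proof.
move=> <-{l}; rewrite -string_lawE0.
have shiftn n e' : mu (window letter_at (e' + n%:Z) (size s) @^-1` [set s]) =
    mu (window letter_at e' (size s) @^-1` [set s]).
  elim: n => [|n IHn]; first by rewrite addr0.
  by rewrite -IHn -[RHS]window_shift (_ : (e' + n.+1%:Z = e' + n%:Z + 1)%R)//; lia.
have [h|h] := lerP (-1) e.
- by rewrite (_ : (e = -1 + `|(e + 1)%R|%N%:Z)%R) ?shiftn//; lia.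
- by rewrite (_ : (-1 = e + `|(-1 - e)%R|%N%:Z)%R) ?shiftn//; lia.
Qed.

Lemma string_law_nil : string_law [::] = 1%R.
Proof.
apply: EFin_inj; rewrite -(string_lawE 0 (erefl _)) -(@probability_setT _ _ _ mu).
by congr (mu _); apply/seteqP; split.
Qed.

Lemma string_law_rcons s :
  \esum_(a in [set: A]) (string_law (rcons s a))%:E = (string_law s)%:E.
Proof.
rewrite -(string_lawE (-1) (erefl _)).
rewrite (measure_partition mu (measurable_letter_at (-1 - (size s)%:Z))); last first.
  exact: mwin.
apply: eq_esum => a _; rewrite -(string_lawE (-1) (size_rcons _ _)).
congr (mu _); apply/seteqP; split=> x /=; rewrite window_rcons.
  by move/rcons_inj=> [-> ->].
by move=> [-> ->].
Qed.

Lemma string_law_cons s :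
  \esum_(a in [set: A]) (string_law (a :: s))%:E = (string_law s)%:E.
Proof.
rewrite -(string_lawE (0 - 1) (erefl _)).
rewrite (measure_partition mu (measurable_letter_at 0)); last first.
  exact: mwin.
apply: eq_esum => a _; rewrite -(string_lawE 0 (l := (size s).+1))//.
congr (mu _); apply/seteqP; split=> x /=; rewrite window_cons.
  by case=> -> ->.
by move=> [-> ->].
Qed.

Lemma string_law_take k s : (string_law s <= string_law (take k s))%R.
Proof.
elim/last_ind: s => [//|s a IHs]; have [ks|ks] := leqP k (size s).
  rewrite -cats1 takel_cat// (le_trans _ IHs)// -lee_fin -[leRHS]string_law_rcons cats1.
  apply: (@esum_ge_term _ _ a (fun a => (string_law (rcons s a))%:E)) => b.
  by rewrite lee_fin string_law_ge0.
by rewrite take_oversize// size_rcons.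
Qed.

Lemma string_law_tuple l : \esum_(t in [set: l.-tuple A]) (string_law t)%:E = 1.
Proof.
have wl (w : trajectory N) : size (window letter_at (-1) l w) == l by rewrite size_window.
have E t : (fun w => Tuple (wl w)) @^-1` [set t] = window letter_at (-1) l @^-1` [set (t : seq A)].
  apply/seteqP; split=> w /=; first by move=> <-.
  by move=> wt; apply/val_inj.
rewrite -(@probability_setT _ _ _ mu).
rewrite (measure_partition mu (X := fun w => Tuple (wl w)))//; last first.
  by move=> t; rewrite E; exact: mwin.
by apply: eq_esum => t _; rewrite setTI E; apply/esym/string_lawE; rewrite size_tuple.
Qed.

Variable P : A -> past N -> R.
Hypothesis mu_compatible : compatible mu P.

Let measurable_recent k s :
  measurable [set x : past N | recent x k = s].
Proof.
have mi i a : measurable [set x : past N | x i = a].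
  by apply: sub_sigma_algebra; exists i, a.
rewrite (_ : [set _ | _] = if size s == k then
    \bigcap_(i in `I_k) [set x : past N | x i = nth point s i] else set0).
  case: ifP => // _; apply: fin_bigcap_measurable => // i _; exact: mi.
case: eqP => [sk|sk]; apply/seteqP; split=> x /=.
- by move=> <- i /= ik; rewrite nth_mkseq.
- move=> h; apply: (@eq_from_nth _ point); first by rewrite size_mkseq.
  by rewrite size_mkseq => i ik; rewrite nth_mkseq// h.
- by move=> xs; apply: sk; rewrite -xs size_mkseq.
- by [].
Qed.

Lemma string_law_integral a s :
  (string_law (a :: s))%:E =
  \int[mu]_(w in window letter_at (-1) (size s) @^-1` [set s]) (P a (past_of w))%:E.
Proof.
have := mu_compatible a (measurable_recent (size s) s).
have E : @past_of N @^-1` [set x | recent x (size s) = s] =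
    window letter_at (-1) (size s) @^-1` [set s].
  by apply/seteqP; split=> w /=; rewrite recentE.
rewrite E => <-; rewrite -(string_lawE 0 (l := (size s).+1))//.
congr (mu _); apply/seteqP; split=> w /=; rewrite window_cons.
  by case.
by move=> [<- ws]; congr (_ :: _).
Qed.

Lemma string_law_ge a s (c : R) :
  (forall x, recent x (size s) = s -> (c <= P a x)%R) -> (0 <= c)%R ->
  (forall x, 0 <= P a x)%R -> measurable_fun setT (P a) ->
  (c * string_law s <= string_law (a :: s))%R.
Proof.
move=> cP c0 P0 mP.
rewrite -lee_fin string_law_integral EFinM -(string_lawE (-1) (erefl (size s))).
rewrite -integral_cst//.
apply: ge0_le_integral => //.
- apply/measurable_EFinP; apply: measurable_funTS; apply: (measurableT_comp mP).
  apply: (@measurability _ _ _ _ _ _ _ measurable_pastE).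
  move=> _ [_ [i [b ->]] <-]; rewrite setTI.
  exact: (measurable_letter_at (- i.+1%:Z) b).
- by move=> w /= ws; rewrite lee_fin cP// recentE.
Qed.

Lemma string_law_eq a s (c : R) :
  (forall x, recent x (size s) = s -> P a x = c) ->
  string_law (a :: s) = (c * string_law s)%R.
Proof.
move=> cP; apply: EFin_inj.
rewrite string_law_integral EFinM -(string_lawE (-1) (erefl (size s))).
rewrite -integral_cst//.
by apply: eq_integral => w; rewrite inE /= => ws; rewrite cP// recentE.
Qed.

End Law.

(** By stationarity the window may end at time [size s], so that it covers the times from 1 and is
    read off [first_letters]. That tuple lists the oldest letter first, whence the reversal in
    [f]. *)
Lemma string_law_markov (mu nu : probability (trajectory N) R) k s :
  stationary mu -> stationary nu ->
  (forall D : set (k.-tuple A),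
    nu (first_letters k @^-1` D) = mu (first_letters k @^-1` D)) ->
  (size s <= k)%N -> string_law nu s = string_law mu s.
Proof.
move=> smu snu D sk; apply: EFin_inj.
rewrite -(string_lawE snu (size s)%:Z (erefl (size s))).
rewrite -(string_lawE smu (size s)%:Z (erefl (size s))).
pose f (t : k.-tuple A) := rev (take (size s) t).
have E (w : trajectory N) : window (@letter_at N) (size s)%:Z (size s) w = f (first_letters k w).
  rewrite /f; apply: (@eq_from_nth _ point).
    by rewrite size_window size_rev size_take size_tuple; case: ltnP; lia.
  rewrite size_window => i si.
  have ss : size (take (size s) (first_letters k w)) = size s.
    by rewrite size_take size_tuple; case: ltnP; lia.
  rewrite nth_rev ?ss// nth_take; last by lia.
  rewrite nth_mkseq// /first_letters.
  have h : (size s - i.+1 < k)%N by lia.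
  rewrite -[RHS](tnth_nth point (first_letters k w) (Ordinal h)) tnth_mktuple /letter_at /=.
  by congr (w _); lia.
have F (m : probability (trajectory N) R) :
    m (window (@letter_at N) (size s)%:Z (size s) @^-1` [set s]) =
    m (first_letters k @^-1` [set t | f t = s]).
  by congr (m _); apply/seteqP; split=> w /=; rewrite E.
by rewrite !F D.
Qed.

End StationaryLaw.

(** * The update function *)

Section UpdateFunction.
Context {R : realType} {N : option nat}.
Local Notation A := (letter N).
Variable P : A -> past N -> R.
Hypothesis P_kernel : is_kernel P.

Let P_ge0 a x : 0 <= P a x.
Proof. by case: P_kernel => _ /(_ a x)/andP[]. Qed.

Let P_sum x : (\esum_(a in [set: A]) (P a x)%:E = 1)%E.
Proof. by case: P_kernel => _ _; exact. Qed.

Let inf_ok a s : has_inf (range (fun z => P a (extend_past s z))).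
Proof.
split; first by exists (P a (extend_past s point)), point.
by exists 0 => _ [z _ <-].
Qed.

Lemma alpha_letter_ge0 a s : 0 <= alpha_letter P a s.
Proof.
by apply: lb_le_inf; [case: (inf_ok a s)|move=> _ [z _ <-]].
Qed.

Lemma alpha_letter_le a s x : recent x (size s) = s -> alpha_letter P a s <= P a x.
Proof.
move=> xs; apply: ge_inf; first by case: (inf_ok a s).
(* Deleting the last [size s] letters of [x] leaves a past whose extension by [s] is [x] again. *)
exists (fun i => x (i + size s)%N) => //; congr (P a _); apply/funext => i.
rewrite /extend_past; have [si|is_] := leqP (size s) i.
  by rewrite nth_default// subnK.
by rewrite (set_nth_default point)// -xs nth_mkseq.
Qed.

Lemma recent_extend_past (s : seq A) (z : past N) : recent (extend_past s z) (size s) = s.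
Proof.
apply: (@eq_from_nth _ point); rewrite size_mkseq// => i si.
by rewrite nth_mkseq// /extend_past (set_nth_default point).
Qed.

Lemma take_recent (x : past N) i j : (i <= j)%N -> take i (recent x j) = recent x i.
Proof. by move=> ij; rewrite /recent /mkseq -map_take take_iota (minn_idPl ij). Qed.

Lemma le_alpha_letter a (x : past N) i j : (i <= j)%N ->
  alpha_letter P a (recent x i) <= alpha_letter P a (recent x j).
Proof.
move=> ij; apply: lb_le_inf; first by case: (inf_ok a (recent x j)).
move=> _ [z _ <-]; apply: alpha_letter_le; rewrite size_mkseq.
rewrite -[LHS](take_recent _ ij) -[RHS](take_recent _ ij); congr (take _ _).
by have := recent_extend_past (recent x j) z; rewrite size_mkseq.
Qed.

Lemma esum_alpha_letter s : (\esum_(a in [set: A]) (alpha_letter P a s)%:E <= 1)%E.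
Proof.
rewrite -(P_sum (extend_past s point)); apply: le_esum => a _; rewrite lee_fin.
by apply: alpha_letter_le; exact: recent_extend_past.
Qed.

Lemma alpha_stringE s :
  (alpha_string P s)%:E = (\esum_(a in [set: A]) (alpha_letter P a s)%:E)%E.
Proof.
rewrite fineK// ge0_fin_numE; first exact: le_lt_trans (esum_alpha_letter s) (ltry 1).
by apply: esum_ge0 => a _; rewrite lee_fin alpha_letter_ge0.
Qed.

Lemma alpha_string_itv s : 0 <= alpha_string P s <= 1.
Proof.
rewrite -!lee_fin alpha_stringE esum_alpha_letter andbT.
by apply: esum_ge0 => a _; rewrite lee_fin alpha_letter_ge0.
Qed.

Lemma alpha_le j s : size s = j -> alpha P j <= alpha_string P s.
Proof.
move=> sj; apply: ge_inf; first by exists 0 => _ [t _ <-]; case/andP: (alpha_string_itv t).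
by exists (Tuple (introT eqP sj)).
Qed.

Lemma alpha_itv j : 0 <= alpha P j <= 1.
Proof.
apply/andP; split.
  apply: lb_le_inf; first by exists (alpha_string P (nseq_tuple j point)); exists (nseq_tuple j point).
  by move=> _ [t _ <-]; case/andP: (alpha_string_itv t).
rewrite (@le_trans _ _ (alpha_string P (nseq j point)))//.
  by rewrite alpha_le// size_nseq.
by case/andP: (alpha_string_itv (nseq j (point : A))).
Qed.

Lemma le_alpha i j : (i <= j)%N -> alpha P i <= alpha P j.
Proof.
move=> ij; apply: lb_le_inf.
  by exists (alpha_string P (nseq_tuple j point)); exists (nseq_tuple j point).
move=> _ [t _ <-]; rewrite (@le_trans _ _ (alpha_string P (take i t)))//.
  by rewrite alpha_le// size_take size_tuple; case: ltnP => //; lia.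
rewrite -lee_fin !alpha_stringE; apply: le_esum => a _; rewrite lee_fin.
have := @le_alpha_letter a (extend_past t point) _ _ ij.
rewrite -(take_recent _ ij).
by have := recent_extend_past t point; rewrite size_tuple => ->.
Qed.

Section Intervals.
Variable x : past N.
Local Notation index := (option nat * A)%type.
Local Notation len := (interval_length P x).
Local Notation left := (interval_left P x).

Let l (a : A) (j : nat) := alpha_letter P a (recent x j).

Let l_mono a : nondecreasing_seq (l a).
Proof. by move=> i j ij; exact: le_alpha_letter. Qed.

Let l_ub a j : l a j <= P a x.
Proof. by apply: alpha_letter_le; rewrite size_mkseq. Qed.

Let l_cvg a : cvgn (l a).
Proof.
apply: nondecreasing_is_cvgn => //.
by exists (P a x) => _ [n _ <-].
Qed.

Lemma interval_length_ge0 p : 0 <= len p.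
Proof.
case: p => -[[|k]|] a; rewrite /interval_length /=.
- exact: alpha_letter_ge0.
- by rewrite subr_ge0; exact: le_alpha_letter.
- rewrite subr_ge0; apply: limr_le; first exact: l_cvg.
  by apply: nearW => n; exact: l_ub.
Qed.

Lemma sum_interval_length a k : \sum_(0 <= j < k.+1) len (Some j, a) = l a k.
Proof.
elim: k => [|k IHk]; first by rewrite big_nat1.
by rewrite big_nat_recr//= IHk /interval_length /= addrC subrK.
Qed.

(** For a fixed letter the finite levels telescope to the limit of the [alpha_letter], and the last
    level adds what is missing to [P a x]; summing over letters first therefore gives at most 1. The
    finiteness makes the left end points genuine real numbers. *)
Lemma esum_interval_length : (\esum_(p in [set: index]) (len p)%:E <= 1)%E.
Proof.
have le0 p : (0 <= (len p)%:E)%E by rewrite lee_fin interval_length_ge0.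
rewrite (_ : \esum_(p in _) _ =
  \esum_(p in [set: index]) (fun o a => (len (o, a))%:E) p.1 p.2)%E; last first.
  by apply: eq_esum => -[].
rewrite (@esum_pair _ _ _ (fun o a => (len (o, a))%:E))// esum_exchange//.
rewrite -(P_sum x); apply: le_esum => a _.
rewrite (esumID [set None])//.
rewrite !setTI esum_set1//.
have -> : ~` [set None] = Some @` [set: nat].
  apply/seteqP; split=> [[n|]//= _|_ [n _ <-]//]; by exists n.
rewrite esum_image; last by move=> m n _ _ [].
rewrite -nneseries_esumT//.
apply: (@le_trans _ _ ((P a x - limn (l a))%:E + (limn (l a))%:E)%E); last first.
  by rewrite -EFinD subrK.
apply: leeD2l; apply: lime_le; first by apply: is_cvg_nneseries => n _ _.
apply: nearW => -[|n]; rewrite sumEFin lee_fin.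
  rewrite big_geq//; apply: limr_ge; first exact: l_cvg.
  by apply: nearW => n; exact: alpha_letter_ge0.
rewrite sum_interval_length; apply: nondecreasing_cvgn_le; first exact: l_mono.
exact: l_cvg.
Qed.

Let esum_fin (S : set index) : (\esum_(p in S) (len p)%:E)%E \is a fin_num.
Proof.
rewrite ge0_fin_numE; last by apply: esum_ge0 => p _; rewrite lee_fin interval_length_ge0.
apply: le_lt_trans (ltry 1); apply: le_trans esum_interval_length.
rewrite esum_mkcond; apply: le_esum => p _; case: ifP => // _.
by rewrite lee_fin interval_length_ge0.
Qed.

Let le_esum_subset (S S' : set index) : S `<=` S' ->
  (\esum_(p in S) (len p)%:E <= \esum_(p in S') (len p)%:E)%E.
Proof.
move=> SS'; rewrite esum_mkcond [leRHS]esum_mkcond; apply: le_esum => p _.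
case: ifPn => [/set_mem/SS' Sp|_]; first by rewrite mem_set.
by case: ifP => // _; rewrite lee_fin interval_length_ge0.
Qed.

Lemma interval_leftE p :
  (left p)%:E = (\esum_(q in [set q | interval_before q p]) (len q)%:E)%E.
Proof. by rewrite /interval_left fineK// esum_fin. Qed.

Lemma interval_before_irr (p : index) : interval_before p p = false.
Proof.
by case: p => -[k|] a; rewrite /interval_before /= ?ltnn ?andbF// eqxx ltnn.
Qed.

Lemma interval_before_trans (p q r : index) :
  interval_before p q -> interval_before q r -> interval_before p r.
Proof.
case: p q r => -[i|] a [[j|] b] [[k|] c]; rewrite /interval_before /=.
all: try by rewrite ?orbF ?andbF.
all: rewrite ?(inj_eq Some_inj) ?eqxx /= => h1 h2.
- apply/orP; case/orP: h1 => [ij|/andP[/eqP -> ab]].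
    left; case/orP: h2 => [jk|/andP[/eqP <- _]//]; exact: ltn_trans jk.
  case/orP: h2 => [jk|/andP[jk bc]]; [by left|right]; rewrite jk /=.
  exact: ltn_trans bc.
- exact: ltn_trans h2.
Qed.

Lemma interval_before_total (p q : index) :
  [|| p == q, interval_before p q | interval_before q p].
Proof.
case: p q => -[i|] a [[j|] b]; rewrite /interval_before /= ?orbT//=.
- rewrite xpair_eqE !(inj_eq Some_inj) [j == i]eq_sym.
  case: ltngtP => //= _; rewrite -val_eqE /=; by case: ltngtP.
- by rewrite xpair_eqE !eqxx /= -val_eqE /=; case: ltngtP.
Qed.

Lemma interval_rightE p : ((left p + len p)%:E =
  \esum_(q in [set q | interval_before q p] `|` [set p]) (len q)%:E)%E.
Proof.
have le0 q : (0 <= (len q)%:E)%E by rewrite lee_fin interval_length_ge0.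
rewrite (esumID [set p])// setIUl setIid (_ : _ `&` [set p] = set0); last first.
  by apply/seteqP; split=> q //= [/[swap] ->]; rewrite interval_before_irr.
rewrite set0U esum_set1// EFinD interval_leftE addeC; congr (_ + esum _ _)%E.
apply/seteqP; split=> q /=; last by move=> [[]].
by move=> qp; split; [left|move=> qE; move: qp; rewrite qE interval_before_irr].
Qed.

Lemma interval_right_le p (S : set index) : S p ->
  [set q | interval_before q p] `<=` S ->
  ((left p + len p)%:E <= \esum_(q in S) (len q)%:E)%E.
Proof.
move=> Sp pS; rewrite interval_rightE; apply: le_esum_subset => q.
by case=> [/pS|->].
Qed.

Lemma interval_left_ge0 p : 0 <= left p.
Proof.
rewrite -lee_fin interval_leftE esum_ge0// => q _.
by rewrite lee_fin interval_length_ge0.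
Qed.

Lemma interval_right_le1 p : left p + len p <= 1.
Proof.
by rewrite -lee_fin (le_trans (@interval_right_le p setT _ _))// esum_interval_length.
Qed.

Lemma I1_disjoint p q u : I1 P x p u -> I1 P x q u -> p = q.
Proof.
have H a b : I1 P x a u -> I1 P x b u -> interval_before a b = false.
  rewrite /I1 /= !in_itv /= => /andP[_ ua] /andP[bu _]; apply/negP => ab.
  have : left a + len a <= left b.
    rewrite -lee_fin interval_leftE; apply: interval_right_le => //= c ca.
    exact: interval_before_trans ca ab.
  by move=> /(lt_le_trans ua)/lt_le_trans/(_ bu); rewrite ltxx.
move=> pu qu; have := interval_before_total p q.
by rewrite (H _ _ pu qu) (H _ _ qu pu) !orbF => /eqP.
Qed.

Lemma exists_last_interval (Y : seq index) : Y != [::] ->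
  exists2 q, q \in Y & (forall p, p \in Y -> p = q \/ interval_before p q).
Proof.
elim: Y => // p Y IHY _; have [->|Y0] := eqVneq Y [::].
  by exists p; rewrite ?mem_head// => q; rewrite inE => /eqP ->; left.
have [q qY qmax] := IHY Y0; case/or3P: (interval_before_total p q) => [/eqP ->|pq|qp].
- exists q; first by rewrite mem_head.
  by move=> r; rewrite inE => /orP[/eqP ->|/qmax//]; left.
- exists q; first by rewrite inE qY orbT.
  by move=> r; rewrite inE => /orP[/eqP ->|/qmax//]; right.
- exists p; first by rewrite mem_head.
  move=> r; rewrite inE => /orP[/eqP ->|/qmax[->|rq]]; [by left|by right|right].
  exact: interval_before_trans rq qp.
Qed.

(* A finite set of intervals fits to the left of the right end of its last
   element. *)
Lemma esum_interval_length_le (S : set index) u : 0 <= u ->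
  (forall q, S q -> left q + len q <= u) ->
  (\esum_(q in S) (len q)%:E <= u%:E)%E.
Proof.
move=> u0 Su; apply: ge_ereal_sup => _ [Y [finY YS] <-].
have [Y0|Y0] := eqVneq (finmap.enum_fset (fset_set Y)) [::].
  by rewrite fsbig_finite// Y0 big_nil lee_fin.
have [q qY qmax] := exists_last_interval Y0.
have Yq : Y q by move: qY; rewrite in_fset_set// inE.
apply: (@le_trans _ _ (left q + len q)%:E); last by rewrite lee_fin Su//; exact: YS.
rewrite interval_rightE; apply: ereal_sup_ubound; exists Y => //; split=> // p Yp.
have /qmax[->|] : p \in (finmap.enum_fset (fset_set Y)) by rewrite in_fset_set ?inE.
- by right.
- by left.
Qed.

Definition level_le (k : nat) (p : index) : bool := if p.1 is Some j then (j <= k)%N else false.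

Lemma esum_level_le k : (\esum_(p in [set p | level_le k p]) (len p)%:E =
  (alpha_string P (recent x k))%:E)%E.
Proof.
have le0 p : (0 <= (len p)%:E)%E by rewrite lee_fin interval_length_ge0.
rewrite alpha_stringE esum_mkcond.
pose f o a : \bar R := if level_le k (o, a) then (len (o, a))%:E else 0%E.
rewrite (eq_esum (b := fun p => f p.1 p.2)); last first.
  move=> [lv a] _; rewrite /f; case: ifPn => [/set_mem /= -> //|].
  by case: ifP => // oa /negP[]; rewrite inE.
rewrite (@esum_pair _ _ _ f); last by move=> o a; rewrite /f; case: ifP.
rewrite esum_exchange; last by move=> o a; rewrite /f; case: ifP.
apply: eq_esum => a _; rewrite /f.
rewrite -[RHS](_ : \sum_(0 <= j < k.+1) (len (Some j, a))%:E = _)%E; last first.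
  by rewrite sumEFin sum_interval_length.
rewrite big_mkord (@fsbig_ord _ _ _ k.+1 (fun j => (len (Some j, a))%:E)) -esum_fset//.
rewrite -(@esum_image _ _ _ `I_k.+1 Some (fun o => (len (o, a))%:E)); last first.
  by move=> i j _ _ [].
rewrite [RHS]esum_mkcond; apply: eq_esum => -[j|] _; rewrite /level_le /=.
  case: ifPn => jk; first by rewrite mem_set//; exists j.
  by rewrite memNset// => -[i /= ik [ij]]; rewrite -ij -ltnS ik in jk.
by rewrite memNset// => -[].
Qed.

(** With infinitely many letters the intervals of one level may accumulate, so [u] is not found by
    finite enumeration. Yet finitely many levels of letters are well ordered: the first interval
    ending after [u] works, since all earlier ones end at or before [u] and their total length is
    then at most [u]. *)
Lemma I1_cover k u : 0 <= u < alpha_string P (recent x k) ->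
  exists p, level_le k p /\ I1 P x p u.
Proof.
move=> /andP[u0 uk].
(* If all intervals of level at most [k] ended by [u], their total length, which is [alpha_string],
   would be at most [u]. *)
have [p0 [lp0 up0]] : exists p, level_le k p /\ u < left p + len p.
  apply: contrapT => /forallNP h.
  have : ((alpha_string P (recent x k))%:E <= u%:E)%E; last by rewrite lee_fin leNgt uk.
  rewrite -esum_level_le; apply: esum_interval_length_le => // q lq.
  by rewrite leNgt; apply/negP => uq; apply: (h q).
have exj : exists j, `[< exists a, (j <= k)%N /\ u < left (Some j, a) + len (Some j, a) >].
  case: p0 lp0 up0 => -[j|] a //= jk ua; exists j; apply/asboolP; exists a; split=> //.
case: (ex_minnP exj) => j /asboolP[a0 [jk ua0]] jmin.
have exa : exists n, `[< exists a : A, a = n :> nat /\ u < left (Some j, a) + len (Some j, a) >].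
  by exists a0; apply/asboolP; exists a0.
case: (ex_minnP exa) => n /asboolP[a [an ua]] amin.
exists (Some j, a); split=> //; rewrite /I1 /= in_itv /= ua andbT.
rewrite -lee_fin interval_leftE; apply: esum_interval_length_le => // -[[i|] b] //=.
rewrite /interval_before /= (inj_eq Some_inj) => h; rewrite leNgt; apply/negP => ub.
case/orP: h => [ij|/andP[/eqP ij ba]].
  have /jmin : `[< exists a, (i <= k)%N /\ u < left (Some i, a) + len (Some i, a) >].
    by apply/asboolP; exists b; split=> //; lia.
  lia.
have /amin : `[< exists a : A, a = b :> nat /\ u < left (Some j, a) + len (Some j, a) >].
  by apply/asboolP; exists b; rewrite -ij.
lia.
Qed.

(** [I1_cover] provides an interval of level at most [k] and [I1_disjoint] makes it the only one
    containing [u], so the default value of [get] never occurs here. *)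
Lemma F1P k a u : 0 <= u < alpha_string P (recent x k) ->
  F1 P x u = a <-> exists2 j, (j <= k)%N & I1 P x (Some j, a) u.
Proof.
move=> uk; have [[[j|] b] [//= jk ub]] := I1_cover uk.
have uniqb c o : I1 P x (o, c) u -> c = b by move=> uc; have [] := I1_disjoint uc ub.
have -> : F1 P x u = b.
  rewrite /F1; case: xgetP => [c _ [lv uc]|/(_ b)]; first exact: uniqb uc.
  by case; exists (Some j).
split=> [<-|[i _ /uniqb ->]//]; by exists j.
Qed.

Lemma measurable_I1 p : measurable (I1 P x p).
Proof. exact: measurable_itv. Qed.

Lemma unif_I1 p : uniform_prob (@ltr01 R) (I1 P x p) = (len p)%:E.
Proof.
rewrite /I1 unif_itv ?interval_left_ge0 ?interval_right_le1 ?lerDl ?interval_length_ge0//.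
by rewrite addrC addKr.
Qed.

Lemma F1_preimageE k a : [set u | 0 <= u < alpha_string P (recent x k) /\ F1 P x u = a] =
  `[0, alpha_string P (recent x k)[ `&` \big[setU/set0]_(j < k.+1) I1 P x (Some (j : nat), a).
Proof.
rewrite -(bigcup_mkord k.+1 (fun j => I1 P x (Some j, a))); apply/seteqP; split=> u /=.
  move=> [uk /(F1P a uk)[j jk ua]]; rewrite in_itv /=; split=> //.
  by exists j => //=; rewrite ltnS.
rewrite in_itv /= => -[uk [j /= jk ua]]; split=> //; apply/(F1P a uk).
by exists j.
Qed.

Lemma measurable_F1 k a :
  measurable [set u | 0 <= u < alpha_string P (recent x k) /\ F1 P x u = a].
Proof.
rewrite F1_preimageE; apply: measurableI; first exact: measurable_itv.
by apply: bigsetU_measurable => j _; exact: measurable_I1.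
Qed.

(** The union bound over the levels up to [k], whose lengths telescope. *)
Lemma unif_F1_le k a : (uniform_prob (@ltr01 R)
  [set u | (0 <= u < alpha_string P (recent x k))%R /\ F1 P x u = a] <=
  (alpha_letter P a (recent x k))%:E)%E.
Proof.
have mU : measurable (\big[setU/set0]_(j < k.+1) I1 P x (Some (j : nat), a)).
  by apply: bigsetU_measurable => j _; exact: measurable_I1.
have mF := measurable_F1 k a.
rewrite (@le_trans _ _ (uniform_prob (@ltr01 R) (\big[setU/set0]_(j < k.+1) I1 P x (Some (j : nat), a))))//.
  by apply: le_measure; rewrite ?inE// F1_preimageE; exact: subIsetr.
have mI (j : nat) : measurable (I1 P x (Some j, a)) by exact: measurable_I1.
apply: le_trans (@Boole_inequality _ _ (measurableTypeR R) (uniform_prob (@ltr01 R))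
  (fun j => I1 P x (Some j, a)) k.+1 (fun j _ => mI j)) _.
rewrite (eq_bigr (fun j : 'I_k.+1 => (len (Some (j : nat), a))%:E)); last by move=> j _; exact: unif_I1.
by rewrite sumEFin -(big_mkord xpredT (fun j => len (Some j, a))) sum_interval_length.
Qed.

End Intervals.

End UpdateFunction.

(** * Coalescence under a common uniform variable *)

Section Coalescence.
Context {R : realType} {N : option nat}.
Local Notation A := (letter N).
Variables (P : A -> past N -> R) (k0 : nat).
Hypothesis P_kernel : is_kernel P.
Local Notation al := (alpha P k0).
Hypothesis al_gt0 : 0 < al.
Local Notation unif := (uniform_prob (@ltr01 R)).

Let phi (s : seq A) (v : R) : A := Fstar P k0 s (v / al).

Let phiE s v : phi s v = F1 P (extend_past s point) v.
Proof. by rewrite /phi /Fstar divfK// gt_eqF. Qed.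

Let D1 s a : set R := [set v | 0 <= v < al /\ phi s v = a].
Let D2 s s' (t : A * A) : set R :=
  [set v | [/\ 0 <= v < al, phi s v = t.1 & phi s' v = t.2]].

Let D1E s a : D1 s a = `[0, al[ `&`
  [set v | 0 <= v < alpha_string P (recent (extend_past s point) k0) /\
           F1 P (extend_past s point) v = a].
Proof.
apply/seteqP; split=> v; rewrite /D1 /= in_itv /= phiE => -[val vF]; last first.
  by case: vF => _ ->.
split=> //; split=> //; case/andP: val => -> /lt_le_trans -> //.
by apply: alpha_le; rewrite ?size_mkseq.
Qed.

Let measurable_D1 s a : measurable (D1 s a).
Proof.
rewrite D1E; apply: measurableI; first exact: measurable_itv.
exact: measurable_F1.
Qed.

Let D2E s s' t : D2 s s' t = D1 s t.1 `&` D1 s' t.2.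
Proof. by apply/seteqP; split=> v /=; [case|case=> -[? ?] []]. Qed.

Let measurable_D2 s s' t : measurable (D2 s s' t).
Proof. by rewrite D2E; exact: measurableI. Qed.

Let unif_fin (U : set R) : measurable U -> unif U \is a fin_num.
Proof.
move=> mU; rewrite ge0_fin_numE//; apply: le_lt_trans (ltry 1).
exact: (@probability_le1 _ (measurableTypeR R) R (uniform_prob (@ltr01 R))).
Qed.

(* The joint law of one step of [Fstar] from [s] and from [s'] driven by the
   same uniform variable, on the event that this variable is less than [al]. *)
Definition common_step (s s' : seq A) (a b : A) : R := fine (unif (D2 s s' (a, b))).
Definition single_step (s : seq A) (a : A) : R := fine (unif (D1 s a)).

Lemma common_stepE s s' a b : (common_step s s' a b)%:E = unif (D2 s s' (a, b)).
Proof. by rewrite fineK// unif_fin. Qed.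

Lemma common_step_ge0 s s' a b : 0 <= common_step s s' a b.
Proof. by rewrite fine_ge0. Qed.

Lemma common_step_row s s' a :
  (\esum_(b in [set: A]) (common_step s s' a b)%:E = (single_step s a)%:E)%E.
Proof.
rewrite /single_step fineK ?unif_fin//; under eq_esum do rewrite common_stepE.
rewrite -(@measure_count_bigcup _ (measurableTypeR R) R A (uniform_prob (@ltr01 R)) (phi s')
  (fun b => D2 s s' (a, b))); last 2 first.
- by move=> b; exact: measurable_D2.
- by move=> b v [].
congr (unif _); apply/seteqP; split=> v; first by move=> [b _ []].
by move=> [val va]; exists (phi s' v).
Qed.

Lemma common_step_col s s' b :
  (\esum_(a in [set: A]) (common_step s s' a b)%:E = (single_step s' b)%:E)%E.
Proof.
rewrite /single_step fineK ?unif_fin//; under eq_esum do rewrite common_stepE.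
rewrite -(@measure_count_bigcup _ (measurableTypeR R) R A (uniform_prob (@ltr01 R)) (phi s)
  (fun a => D2 s s' (a, b))); last 2 first.
- by move=> a; exact: measurable_D2.
- by move=> a v [].
congr (unif _); apply/seteqP; split=> v; first by move=> [a _ []].
by move=> [val vb]; exists (phi s v).
Qed.

Lemma common_step_diag s a b : a != b -> common_step s s a b = 0.
Proof.
move=> ab; rewrite /common_step (_ : D2 _ _ _ = set0) ?measure0//.
by apply/seteqP; split=> v // [_ /= -> /eqP]; rewrite (negbTE ab).
Qed.

(** The interval [0, al[ lies inside [0, alpha_string s[, where the letter [a] takes up at most
    [alpha_letter P a s]. This leaves room for the F* part under both conditional laws. *)
Lemma single_step_le s a : size s = k0 -> single_step s a <= alpha_letter P a s.
Proof.
move=> sk; rewrite -lee_fin fineK ?unif_fin//.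
have sr : recent (extend_past s point) k0 = s by rewrite -sk recent_extend_past.
rewrite -{2}sr; apply: le_trans (unif_F1_le P_kernel (extend_past s point) k0 a).
apply: le_measure; rewrite ?inE; [exact: measurable_D1|exact: measurable_F1|].
by rewrite D1E; exact: subIsetr.
Qed.

Section Product.
Variables (m : nat) (rho : probability (m.-tuple R) R).
Hypothesis rho_iid : iid_uniform rho.
Local Notation coal := (coalesce common_step k0).

(** The sets [B] record the constraints already imposed on the first [i] coordinates. Unrolling one
    step of the generation adds one constraint and keeps this form, until at [i = m] only a
    rectangle remains, to which [rho_iid] applies. *)
Let tail_event (i : nat) (s s' : seq A) (B : nat -> set R) : set (m.-tuple R) :=
  [set u | [/\ forall j : 'I_m, (j < i)%N -> B j (tnth u j),
               forall j : 'I_m, (i <= j)%N -> 0 <= tnth u j < al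
             & generate P k0 s (drop i u) = generate P k0 s' (drop i u)]].

Let tail_event_step i s s' B : (i < m)%N ->
  tail_event i s s' B = \bigcup_t tail_event i.+1 (take k0 (t.1 :: s))
    (take k0 (t.2 :: s')) (fun j => if j == i then D2 s s' t else B j).
Proof.
move=> im; pose ii := Ordinal im.
have dropE (u : m.-tuple R) : drop i u = tnth u ii :: drop i.+1 u.
  by rewrite (drop_nth 0) ?size_tuple// -(tnth_nth 0 u ii).
apply/seteqP; split=> u.
  move=> [uB ual ug]; exists (phi s (tnth u ii), phi s' (tnth u ii)) => //.
  split.
  - move=> j; rewrite ltnS leq_eqVlt => /orP[/eqP ji|ji].
      rewrite ji eqxx (_ : j = ii); last exact/val_inj.
      by split=> //; apply: ual.
    by rewrite (ltn_eqF ji); exact: uB.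
  - by move=> j ij; apply: ual; exact: ltnW.
  - by move: ug; rewrite dropE.
move=> [[a b] _ [uB ual ug]].
have := uB ii (leqnn _); rewrite eqxx => -[ui /= ua ub].
split.
- by move=> j ji; have := uB j (ltnW ji); rewrite (ltn_eqF ji).
- move=> j; rewrite leq_eqVlt => /orP[/eqP ij|]; last exact: ual.
  by rewrite (_ : j = ii)//; exact/val_inj.
- by rewrite dropE /generate /= -/(phi _ _) -/(phi _ _) ua ub.
Qed.

Let tail_event_law i s s' B : (i <= m)%N -> (forall j, measurable (B j)) ->
  measurable (tail_event i s s' B) /\
  rho (tail_event i s s' B) =
    ((\prod_(j < i) unif (B j)) * coal (m - i) s s')%E.
Proof.
move=> im; have [n mi] : exists n, (m - i)%N = n by exists (m - i)%N.
rewrite mi; elim: n i im mi s s' B => [|n IHn] i im mi s s' B mB.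
  have {im mi}im : i = m by lia.
  subst i; rewrite /=; have [->|ss'] := eqVneq s s'; last first.
    rewrite mule0 (_ : tail_event _ _ _ _ = set0) ?measure0//.
    apply/seteqP; split=> u // [_ _]; rewrite drop_oversize ?size_tuple// /generate /=.
    by move/eqP; rewrite (negbTE ss').
  rewrite (_ : tail_event _ _ _ _ = [set u | forall j : 'I_m, B j (tnth u j)]); last first.
    apply/seteqP; split=> u /=; first by move=> [uB _ _] j; exact: uB.
    by move=> uB; split=> // j; rewrite leqNgt ltn_ord.
  split; last by rewrite mule1; exact: (rho_iid (B := fun j : 'I_m => B j) (fun j => mB j)).
  rewrite (_ : [set _ | _] = \bigcap_(j in [set: 'I_m]) ((fun u : m.-tuple R => tnth u j) @^-1` B j)).
    apply: fin_bigcap_measurable => // j _; rewrite -[X in measurable X]setTI.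
    exact: measurable_tnth.
  by apply/seteqP; split=> u /= h j; [move=> _|]; exact: h.
have {}im : (i < m)%N by lia.
rewrite tail_event_step//.
pose B' t j := if j == i then D2 s s' t else B j.
have mB' t j : measurable (B' t j) by rewrite /B'; case: ifP.
have H t := IHn i.+1 im (ltac:(lia)) (take k0 (t.1 :: s)) (take k0 (t.2 :: s')) (B' t) (mB' t).
have mU : measurable (\bigcup_t tail_event i.+1 (take k0 (t.1 :: s)) (take k0 (t.2 :: s')) (B' t)).
  by apply: countable_bigcupT_measurable => [|t]; [exact: countableP|case: (H t)].
split=> //.
rewrite (@measure_count_bigcup _ _ R (A * A)%type rho (fun u => (phi s (tnth u (Ordinal im)), phi s' (tnth u (Ordinal im))))); last 2 first.
- by move=> t; case: (H t).
- move=> [a b] u [uB _ _]; have := uB (Ordinal im) (leqnn _).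
  by rewrite eqxx => -[_ /= -> ->].
have prE : (\prod_(j < i) unif (B j) = (\prod_(j < i) fine (unif (B j)))%:E)%E.
  by rewrite -prodEFin; apply: eq_bigr => j _; rewrite fineK// unif_fin.
rewrite prE /= -esumZl; last 2 first.
- by apply: prodr_ge0 => j _; rewrite fine_ge0.
- move=> t; rewrite mule_ge0 ?lee_fin ?common_step_ge0//.
  by apply: coalesce_ge0 => *; exact: common_step_ge0.
apply: eq_esum => t _; have [_ ->] := H t.
rewrite big_ord_recr /= {2}/B' eqxx.
rewrite (eq_bigr (fun j : 'I_i => unif (B j))); last first.
  by move=> j _; rewrite /B' (ltn_eqF (ltn_ord j)).
by rewrite prE common_stepE muleA -surjective_pairing.
Qed.

(** The pairs of initial strings are countable in number, so this countable intersection yields the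
    measurability of the event even for an infinite alphabet. *)
Let coalescence_setE : @coalescence_set R N P k0 m =
  ~` \bigcup_(st : k0.-tuple A * k0.-tuple A) ~` tail_event 0 st.1 st.2 (fun=> setT).
Proof.
rewrite setC_bigcup; apply/seteqP; split=> u.
  move=> [ual ug] [s s'] _; rewrite setCK; split; [by []|by move=> j _; exact: ual|].
  by rewrite drop0; exact: ug.
move=> h; split=> [j|s s'].
  have := h (nseq_tuple k0 point, nseq_tuple k0 point) I; rewrite setCK => -[_ ual _].
  exact: ual.
by have := h (s, s') I; rewrite setCK => -[_ _]; rewrite drop0.
Qed.

Lemma measurable_coalescence_set : measurable (@coalescence_set R N P k0 m).
Proof.
rewrite coalescence_setE; apply: measurableC.
apply: countable_bigcupT_measurable => [|st]; first exact: countableP.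
apply: measurableC.
by have [] := @tail_event_law 0 st.1 st.2 (fun=> setT) isT (fun=> measurableT).
Qed.

(** The event asks for coalescence from all initial strings at once, so its probability bounds that
    of each pair from below, uniformly. *)
Lemma coalescence_set_le (s s' : seq A) : size s = k0 -> size s' = k0 ->
  (rho (@coalescence_set R N P k0 m) <= coal m s s')%E.
Proof.
move=> sk s'k; have mE := measurable_coalescence_set.
have [mT TE] := @tail_event_law 0 s s' (fun=> setT) isT (fun=> measurableT).
have -> : coal m s s' = rho (tail_event 0 s s' (fun=> setT)).
  by rewrite TE big_ord0 mul1e subn0.
apply: le_measure; rewrite ?inE// => u [ual ug]; split; [by []|by move=> j _; exact: ual|].
by rewrite drop0; exact: (ug (Tuple (introT eqP sk)) (Tuple (introT eqP s'k))).
Qed.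

End Product.

End Coalescence.

(** * Assembling the coupling *)

Section InfiniteProduct.
Context {R : realType} (a : nat -> R) (k0 : nat).
Hypothesis a_itv : forall n, 0 <= a n <= 1.
Hypothesis a_gt0 : forall n, (k0 <= n)%N -> 0 < a n.
Hypothesis a_summable : (\sum_(0 <= n <oo) (1 - a n)%:E < +oo)%E.

(** The Weierstrass product inequality. *)
Let le_prod_1B i j : 1 - \sum_(i <= l < j) (1 - a l) <= \prod_(i <= l < j) a l.
Proof.
have [ij|/ltnW ij] := leqP i j; last by rewrite !big_geq// subr0.
rewrite -(subnK ij); elim: (j - i)%N => [|n IHn].
  by rewrite add0n !big_geq// subr0.
rewrite addSn !big_nat_recr ?leq_addl//=.
have p01 : 0 <= \prod_(i <= l < n + i) a l <= 1.
  rewrite prodr_ge0 /=; last by move=> l _; case/andP: (a_itv l).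
  by apply: prodr_ile1 => l _; exact: a_itv.
have s0 : 0 <= \sum_(i <= l < n + i) (1 - a l).
  by apply: sumr_ge0 => l _; rewrite subr_ge0; case/andP: (a_itv l).
by have := a_itv (n + i)%N; move: IHn p01 s0; nra.
Qed.

Lemma prod_ge_of_summable :
  exists2 delta, 0 < delta & forall k, delta <= \prod_(k0 <= l < k) a l.
Proof.
have f0 n : 0 <= 1 - a n by rewrite subr_ge0; case/andP: (a_itv n).
have f0E n : (0 <= (1 - a n)%:E)%E by rewrite lee_fin.
pose S := fine (\sum_(0 <= n <oo) (1 - a n)%:E)%E.
have SE : (\esum_(n in [set: nat]) (1 - a n)%:E = S%:E)%E.
  rewrite -nneseries_esumT// /S fineK// ge0_fin_numE//.
  exact: nneseries_ge0.
(* Beyond [J] the defects sum to less than 1/2, so the tail products stay above 1/2; the finitely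
   many factors before are positive and enter [delta]. *)
have [J SJ] : exists J, S - 2^-1 < psum (fun n => 1 - a n) J.
  apply: contrapT => /forallNP h.
  have : (S%:E <= (S - 2^-1)%:E)%E; last by rewrite lee_fin; lra.
  rewrite -SE -nneseries_esumT//; apply: lime_le; first by apply: is_cvg_nneseries.
  by apply: nearW => n; rewrite sumEFin lee_fin leNgt; apply/negP; exact: h.
pose K := maxn J k0.
have SK : S - 2^-1 < psum (fun n => 1 - a n) K.
  by apply: (lt_le_trans SJ); apply: psum_homo => //; exact: leq_maxl.
have tail k : 2^-1 <= \prod_(K <= l < k) a l.
  apply: le_trans (le_prod_1B K k).
  have [Kk|/ltnW kK] := leqP K k; last by rewrite big_geq//; lra.
  have := psum_le f0 SE k; move: SK; rewrite /psum (@big_cat_nat _ _ _ K 0%N k)//=; lra.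
have pK : 0 < \prod_(k0 <= l < K) a l.
  rewrite big_seq; apply: prodr_gt0 => l; rewrite mem_index_iota => /andP[k0l _].
  exact: a_gt0.
exists (\prod_(k0 <= l < K) a l * 2^-1); first by rewrite mulr_gt0.
move=> k; have [Kk|/ltnW kK] := leqP K k.
  rewrite (@big_cat_nat _ _ _ K k0 k)//= ?leq_maxr//.
  by rewrite ler_wpM2l// ltW.
have [k0k|/ltnW kk0] := leqP k0 k; last first.
  rewrite [leRHS]big_geq//; have : \prod_(k0 <= l < K) a l <= 1.
    by apply: prodr_ile1 => l _; exact: a_itv.
  by move: pK; nra.
rewrite (@big_cat_nat _ _ _ k k0 K)//=.
have p0 i j : 0 <= \prod_(i <= l < j) a l <= 1.
  rewrite prodr_ge0 /=; last by move=> l _; case/andP: (a_itv l).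
  by apply: prodr_ile1 => l _; exact: a_itv.
by have := p0 k0 k; have := p0 k K; nra.
Qed.

End InfiniteProduct.

(** * Conditional laws given finite strings *)

Section ConditionalLaw.
Context {R : realType} {N : option nat}.
Local Notation A := (letter N).
Variables (P : A -> past N -> R) (p : seq A -> R) (k0 k : nat).
Hypothesis P_kernel : is_kernel P.
Hypothesis p_ge0 : forall s, 0 <= p s.
Hypothesis p_cons : forall s,
  (\esum_(a in [set: A]) (p (a :: s))%:E = (p s)%:E)%E.
Hypothesis p_ge : forall j s a, (k0 <= j <= k)%N -> (j <= size s)%N ->
  alpha_letter P a (take j s) * p s <= p (a :: s).

(* After a null string the next letter is drawn from [P], so that the lower
   bounds by [alpha_letter] hold after every string. *)
Definition cond_law (s : seq A) (a : A) : R :=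
  if p s == 0 then P a (extend_past s point) else p (a :: s) / p s.

Let P_ge0 a x : 0 <= P a x.
Proof. by case: P_kernel => _ /(_ a x)/andP[]. Qed.

Lemma cond_law_ge0 s a : 0 <= cond_law s a.
Proof. by rewrite /cond_law; case: ifP => // _; rewrite divr_ge0. Qed.

Lemma cond_law_sum s : (\esum_(a in [set: A]) (cond_law s a)%:E = 1)%E.
Proof.
rewrite /cond_law; case: eqVneq => [_|ps].
  by case: P_kernel => _ _; exact.
under eq_esum do rewrite mulrC EFinM.
rewrite esumZl ?invr_ge0//; last by move=> a; rewrite lee_fin.
by rewrite p_cons -EFinM mulVf.
Qed.

Lemma cond_lawE a s : p (a :: s) = cond_law s a * p s.
Proof.
rewrite /cond_law; case: eqVneq => [ps|ps]; last by rewrite divfK.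
rewrite ps mulr0; apply/eqP; rewrite eq_le p_ge0 andbT -ps -lee_fin -[leRHS]p_cons.
by apply: (@esum_ge_term _ _ a (fun a => (p (a :: s))%:E)) => b; rewrite lee_fin.
Qed.

Lemma cond_law_ge j s a : (k0 <= j <= k)%N -> (j <= size s)%N ->
  alpha_letter P a (take j s) <= cond_law s a.
Proof.
move=> jk js; rewrite /cond_law; case: eqVneq => [_|ps].
  apply: alpha_letter_le => //.
  rewrite size_takel// -(take_recent _ js); congr (take j _).
  exact: recent_extend_past.
by rewrite ler_pdivlMr ?p_ge// lt_neqAle eq_sym ps p_ge0.
Qed.

End ConditionalLaw.

Section CouplingLaw.
Context {R : realType} (A : choiceType).
Variables (K K' : seq A -> A -> R) (beta r : seq A -> A -> R).
Variables (c : seq A -> seq A -> A -> A -> R) (k0 m k : nat) (al : nat -> R).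
Variables (p p' : seq A -> R) (rho0 : R).
Hypothesis (k0k : (k0 <= k)%N) (k0m : (k0 <= m)%N).
Hypothesis K_sum : forall s, (\esum_(a in [set: A]) (K s a)%:E = 1)%E.
Hypothesis K'_sum : forall s, (\esum_(a in [set: A]) (K' s a)%:E = 1)%E.
Hypothesis K_ge0 : forall s a, 0 <= K s a.
Hypothesis K'_ge0 : forall s a, 0 <= K' s a.
Hypothesis K_ge : forall j s a, (k0 <= j <= k)%N -> (j <= size s)%N ->
  beta (take j s) a <= K s a.
Hypothesis K'_ge : forall j s a, (k0 <= j <= k)%N -> (j <= size s)%N ->
  beta (take j s) a <= K' s a.
Hypothesis al_itv : forall j, 0 <= al j <= 1.
Hypothesis beta_sum : forall j s, size s = j ->
  ((al j)%:E <= \esum_(a in [set: A]) (beta s a)%:E)%E.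
Hypothesis c_ge0 : forall s s' a b, 0 <= c s s' a b.
Hypothesis c_row : forall s s' a,
  (\esum_(b in [set: A]) (c s s' a b)%:E = (r s a)%:E)%E.
Hypothesis c_col : forall s s' b,
  (\esum_(a in [set: A]) (c s s' a b)%:E = (r s' b)%:E)%E.
Hypothesis r_le : forall s a, size s = k0 -> r s a <= beta s a.
Hypothesis c_diag : forall s a b, a != b -> c s s a b = 0.
Hypothesis rho0_ge0 : 0 <= rho0.
Hypothesis rho0_le : forall s s', size s = k0 -> size s' = k0 ->
  (rho0%:E <= coalesce c k0 m s s')%E.
Hypothesis p_nil : p [::] = 1.
Hypothesis p'_nil : p' [::] = 1.
Hypothesis p_cons : forall a s, p (a :: s) = K s a * p s.
Hypothesis p'_cons : forall a s, p' (a :: s) = K' s a * p' s.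
Hypothesis p_rcons : forall s,
  (\esum_(a in [set: A]) (p (rcons s a))%:E = (p s)%:E)%E.
Hypothesis p'_rcons : forall s,
  (\esum_(a in [set: A]) (p' (rcons s a))%:E = (p' s)%:E)%E.
Hypothesis p_tuple : forall l, (\esum_(t in [set: l.-tuple A]) (p t)%:E = 1)%E.
Hypothesis p'_tuple : forall l, (\esum_(t in [set: l.-tuple A]) (p' t)%:E = 1)%E.

Lemma exists_coupling_law : exists Q : seq (A * A) -> R,
  [/\ forall w, 0 <= Q w, Q [::] = 1,
      forall w, (\esum_(t in [set: A * A]) (Q (t :: w))%:E = (Q w)%:E)%E
    & forall w, (\esum_(t in [set: A * A]) (Q (rcons w t))%:E = (Q w)%:E)%E] /\
  [/\ forall n (s : n.-tuple A),
        (\esum_(t in [set: n.-tuple A]) (Q (zip s t))%:E = (p s)%:E)%E,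
      forall n (s : n.-tuple A),
        (\esum_(t in [set: n.-tuple A]) (Q (zip t s))%:E = (p' s)%:E)%E
    & exists2 q : R,
        (\esum_(t in [set: A * A]) ((t.1 != t.2)%:R * Q [:: t])%:E <= q%:E)%E &
        rho0 * (\prod_(k0 <= l < k) al l) * q <= m.+1%:R * (1 - al k)].
Proof.
have [L HL] := @exists_banach_limit R.
have [J [J_ge0 J_fst J_snd J_match J_coal]] := exists_coupling_kernel k0k
  K_sum K'_sum K_ge0 K'_ge0 K_ge K'_ge beta_sum c_ge0 c_row c_col r_le c_diag.
have JS := J_sum J_ge0 J_fst K_sum.
exists (limit_law J L); split; split.
- exact: (limit_law_ge0 HL J_ge0 J_fst K_sum).
- exact: (limit_law_nil HL J_ge0 J_fst K_sum).
- exact: (limit_law_cons HL J_ge0 J_fst J_snd K_ge0 K'_ge0 K_sum K'_sum p_nil p'_nil p_cons p'_cons p_rcons p'_rcons).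
- exact: (limit_law_rcons HL J_ge0 J_fst J_snd K_ge0 K'_ge0 K_sum K'_sum p_nil p'_nil p_cons p'_cons p_rcons p'_rcons).
- exact: (limit_law_fst HL J_ge0 J_fst J_snd K_ge0 K'_ge0 K_sum K'_sum p_nil p'_nil p_cons p'_cons p_rcons p'_rcons p'_tuple).
- exact: (limit_law_snd HL J_ge0 J_fst J_snd K_ge0 K'_ge0 K_sum K'_sum p_nil p'_nil p_cons p'_cons p_rcons p'_rcons p_tuple).
exists (L (fun n => prob_after J n (mismatch (fun t => t.1 == t.2)))).
  exact: (limit_law_mismatch HL J_ge0 J_fst K_sum).
apply: (blim_mismatch_le HL J_ge0 JS k0k k0m al_itv rho0_ge0 J_match) => z k0z.
apply: le_trans (J_coal m z k0z); apply: rho0_le.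
  by rewrite size_takel// size_map.
by rewrite size_takel// size_map.
Qed.

End CouplingLaw.

(** * From string laws to a coupling of measures *)

Section PairMeasure.
Context {R : realType} {N : option nat}.
Local Notation A := (letter N).
Variables (mu nu : probability (trajectory N) R).
Hypothesis mu_stationary : stationary mu.
Hypothesis nu_stationary : stationary nu.
Variable Q : seq (A * A) -> R.
Hypothesis Q_ge0 : forall w, 0 <= Q w.
Hypothesis Q_nil : Q [::] = 1.
Hypothesis Q_cons : forall w,
  (\esum_(t in [set: A * A]) (Q (t :: w))%:E = (Q w)%:E)%E.
Hypothesis Q_rcons : forall w,
  (\esum_(t in [set: A * A]) (Q (rcons w t))%:E = (Q w)%:E)%E.
Hypothesis Q_fst : forall n (s : n.-tuple A),
  (\esum_(t in [set: n.-tuple A]) (Q (zip s t))%:E = (string_law mu s)%:E)%E.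
Hypothesis Q_snd : forall n (s : n.-tuple A),
  (\esum_(t in [set: n.-tuple A]) (Q (zip t s))%:E = (string_law nu s)%:E)%E.

Let pairT := (trajectory N * trajectory N)%type.

Let window_fst e l (w : pairT) : window (@letter_at N) e l w.1 = unzip1 (window (@letters_at N) e l w).
Proof. by rewrite /unzip1 /window /mkseq -map_comp. Qed.

Let window_snd e l (w : pairT) : window (@letter_at N) e l w.2 = unzip2 (window (@letters_at N) e l w).
Proof. by rewrite /unzip2 /window /mkseq -map_comp. Qed.

Let measurable_pair_window e l w : measurable (window (@letters_at N) e l @^-1` [set w]).
Proof. by apply: measurable_window => i t; exact: measurable_letters_at. Qed.

Let fst_measurable : measurable_fun setT (fst : pairT -> trajectory N).
Proof. exact: measurable_fst. Qed.

Let snd_measurable : measurable_fun setT (snd : pairT -> trajectory N).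
Proof. exact: measurable_snd. Qed.

(** By [windows_unique] both marginals and the stationarity need checking on windows only. For a
    marginal, the event is partitioned by the window of the other coordinate and [Q_fst] or [Q_snd]
    sums it out; strings of the wrong length give empty events. *)
Lemma exists_coupling_of_law : exists pi : probability pairT R,
  is_coupling mu nu pi /\
  pi [set w | w.1 0 <> w.2 0] =
    (\esum_(t in [set: A * A]) ((t.1 != t.2)%:R * Q [:: t])%:E)%E.
Proof.
have [pi piE] := exists_pair_process Q_ge0 Q_nil Q_cons Q_rcons.
have tuple_window e l (w : pairT) : size (unzip1 (window (@letters_at N) e l w)) == l.
  by rewrite size_map size_window.
have tuple_window' e l (w : pairT) : size (unzip2 (window (@letters_at N) e l w)) == l.
  by rewrite size_map size_window.
exists pi; split; last first.
  rewrite (measure_partition pi (X := letters_at 0)); last 2 first.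
  - by move=> t; exact: measurable_letters_at.
  - rewrite (_ : [set w | _] = letters_at 0 @^-1` [set t | t.1 <> t.2])//.
    by apply: measurable_count_preimage => t; exact: measurable_letters_at.
  apply: eq_esum => t _; have := piE 0 1%N [:: t] erefl.
  case: eqVneq => tt wt; last first.
    rewrite mul1r -wt; congr (pi _); apply/seteqP; split=> w /=.
      by move=> [_ wE]; rewrite window1 wE.
    rewrite window1 => -[wE]; split=> //; move/eqP: tt.
    by rewrite -wE.
  rewrite mul0r (_ : _ `&` _ = set0) ?measure0//; apply/seteqP; split=> w //=.
  by move=> [ww wE]; apply: ww; move: tt; rewrite -wE.
split.
- have [pi1 pi1E] := exists_pushforward pi fst_measurable.
  move=> B mB; rewrite -pi1E.
  apply: (windows_unique (@measurable_letter_at N) (@letter_at_generated N)) => //.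
  move=> e l s; rewrite pi1E.
  have [sl|sl] := eqVneq (size s) l; last first.
    rewrite [RHS](_ : _ = 0%E); last first.
      rewrite (_ : _ @^-1` _ = set0) ?measure0//; apply/seteqP; split=> w //= ws.
      by move/eqP: sl; apply; rewrite -ws size_window.
    rewrite (_ : _ @^-1` _ = set0) ?measure0//; apply/seteqP; split=> w //= ws.
    by move/eqP: sl; apply; rewrite -ws size_window.
  rewrite (string_lawE mu_stationary e sl).
  have := Q_fst (Tuple (introT eqP sl)) => <- /=.
  rewrite (measure_partition pi (X := fun w => Tuple (tuple_window' e l w))); last 2 first.
  + move=> t; rewrite (_ : _ @^-1` _ = window (@letters_at N) e l @^-1` [set z | unzip2 z = t]).
      by apply: measurable_count_preimage => z; exact: measurable_pair_window.
    by apply/seteqP; split=> w /= => [<-//|wt]; exact/val_inj.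
  + rewrite (_ : _ @^-1` _ = window (@letters_at N) e l @^-1` [set z | unzip1 z = s]).
      by apply: measurable_count_preimage => z; exact: measurable_pair_window.
    by apply/seteqP; split=> w /=; rewrite window_fst.
  apply: eq_esum => t _; rewrite -(piE e l).
    congr (pi _); apply/seteqP; split=> w /=; rewrite window_fst.
      by move=> [<- <-]; rewrite /= zip_unzip.
    move=> wst; have ss : size s = size t by rewrite sl size_tuple.
    split; first by rewrite wst unzip1_zip// ss.
    by apply/val_inj; rewrite /= wst unzip2_zip// ss.
  by rewrite size_zip sl size_tuple minnn.
- have [pi2 pi2E] := exists_pushforward pi snd_measurable.
  move=> B mB; rewrite -pi2E.
  apply: (windows_unique (@measurable_letter_at N) (@letter_at_generated N)) => //.
  move=> e l s; rewrite pi2E.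
  have [sl|sl] := eqVneq (size s) l; last first.
    rewrite [RHS](_ : _ = 0%E); last first.
      rewrite (_ : _ @^-1` _ = set0) ?measure0//; apply/seteqP; split=> w //= ws.
      by move/eqP: sl; apply; rewrite -ws size_window.
    rewrite (_ : _ @^-1` _ = set0) ?measure0//; apply/seteqP; split=> w //= ws.
    by move/eqP: sl; apply; rewrite -ws size_window.
  rewrite (string_lawE nu_stationary e sl).
  have := Q_snd (Tuple (introT eqP sl)) => <- /=.
  rewrite (measure_partition pi (X := fun w => Tuple (tuple_window e l w))); last 2 first.
  + move=> t; rewrite (_ : _ @^-1` _ = window (@letters_at N) e l @^-1` [set z | unzip1 z = t]).
      by apply: measurable_count_preimage => z; exact: measurable_pair_window.
    by apply/seteqP; split=> w /= => [<-//|wt]; exact/val_inj.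
  + rewrite (_ : _ @^-1` _ = window (@letters_at N) e l @^-1` [set z | unzip2 z = s]).
      by apply: measurable_count_preimage => z; exact: measurable_pair_window.
    by apply/seteqP; split=> w /=; rewrite window_snd.
  apply: eq_esum => t _; rewrite -(piE e l).
    congr (pi _); apply/seteqP; split=> w /=; rewrite window_snd.
      by move=> [<- <-]; rewrite /= zip_unzip.
    move=> wst; have ss : size s = size t by rewrite sl size_tuple.
    split; first by rewrite wst unzip2_zip// ss.
    by apply/val_inj; rewrite /= wst unzip1_zip// ss.
  by rewrite size_zip sl size_tuple minnn.
- pose sh (w : pairT) : pairT := (time_shift w.1, time_shift w.2).
  have shm : measurable_fun setT sh.
    have tsm : measurable_fun setT (@time_shift N).
      by apply: measurable_into_trajectory => i a; exact: (measurable_letter_at (i + 1) a).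
    by apply: measurable_fun_pair; apply: measurableT_comp.
  have [pi' pi'E] := exists_pushforward pi shm.
  move=> B mB; rewrite -/sh -pi'E.
  apply: (windows_unique (@measurable_letters_at N) (@letters_at_generated N)) => //.
  move=> e l s; rewrite pi'E.
  have E w : window (@letters_at N) e l (sh w) = window (@letters_at N) (e + 1) l w.
    by apply: eq_map => i; rewrite /letters_at /sh /time_shift /= addrAC.
  rewrite (_ : sh @^-1` _ = window (@letters_at N) (e + 1) l @^-1` [set s]); last first.
    by apply/seteqP; split=> w /=; rewrite E.
  have [sl|sl] := eqVneq (size s) l; first by rewrite !piE.
  rewrite [RHS](_ : _ = 0%E); last first.
    rewrite (_ : _ @^-1` _ = set0) ?measure0//; apply/seteqP; split=> w //= ws.
    by move/eqP: sl; apply; rewrite -ws size_window.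
  rewrite (_ : _ @^-1` _ = set0) ?measure0//; apply/seteqP; split=> w //= ws.
  by move/eqP: sl; apply; rewrite -ws size_window.
Qed.

End PairMeasure.

(** * Lower bounds for the chain and its Markov approximation *)

Section LowerBounds.
Context {R : realType} {N : option nat}.
Local Notation A := (letter N).
Variables (P : A -> past N -> R) (mu : probability (trajectory N) R).
Hypothesis P_kernel : is_kernel P.
Hypothesis mu_stationary : stationary mu.
Hypothesis mu_compatible : compatible mu P.

Lemma string_law_cons_ge j s a : (j <= size s)%N ->
  alpha_letter P a (take j s) * string_law mu s <= string_law mu (a :: s).
Proof.
have [mP P01 _] := P_kernel; move=> js; apply: (string_law_ge mu_stationary mu_compatible).
- move=> x xs; apply: (alpha_letter_le P_kernel).
  by rewrite size_takel// -(take_recent _ js) xs.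
- exact: alpha_letter_ge0.
- by move=> x; case/andP: (P01 a x).
- exact: mP.
Qed.

Variables (k : nat) (nu : probability (trajectory N) R).
Hypothesis nu_markov : is_markov_approximation mu k nu.

(** Up to length [k] the string laws of [nu] and [mu] coincide. After longer strings the next letter
    is drawn from the conditional law of [mu] given the last [k] letters, an average of [P] over
    pasts sharing these letters, hence also those of [take j s]. *)
Lemma string_law_markov_ge j s a : (j <= k)%N -> (j <= size s)%N ->
  alpha_letter P a (take j s) * string_law nu s <= string_law nu (a :: s).
Proof.
move=> jk js; have [nu_stationary nu_compatible nuD] := nu_markov.
have eqm := string_law_markov mu_stationary nu_stationary nuD.
have [sk|ks] := ltnP (size s) k.
  by rewrite !eqm ?(ltnW sk)// string_law_cons_ge.
set r := take k s; have rk : size r = k by rewrite size_takel.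
have kE x : recent x (size s) = s -> markov_kernel mu k a x =
    string_law mu (a :: r) / string_law mu r.
  move=> xs; have xr : recent x k = r by rewrite /r -xs take_recent.
  have rE : [set w | recent (past_of w) k = r] = window (@letter_at N) (- 1) k @^-1` [set r].
    by apply/seteqP; split=> w /=; rewrite recentE.
  have arE : [set w | w 0 = a /\ recent (past_of w) k = r] =
      window (@letter_at N) 0 k.+1 @^-1` [set a :: r].
    apply/seteqP; split=> w /=; rewrite recentE window_cons; first by move=> [<- ->].
    by case=> <- ->.
  rewrite /markov_kernel xr rE arE (string_lawE mu_stationary _ rk).
  by have -> := @string_lawE R N mu mu_stationary 0 k.+1 (a :: r) (congr1 succn rk).
rewrite (string_law_eq nu_stationary nu_compatible kE).
(* If [r] is null for [mu], then [s] is null for [nu], so the default value of [markov_kernel]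
   carries no mass. *)
have [r0|r0] := eqVneq (string_law mu r) 0.
  have -> : string_law nu s = 0; last by rewrite !mulr0.
  apply/eqP; rewrite eq_le string_law_ge0 andbT.
  by rewrite -r0 -eqm ?rk// string_law_take.
rewrite ler_wpM2r ?string_law_ge0// ler_pdivlMr; last first.
  by rewrite lt_neqAle eq_sym r0 string_law_ge0.
have -> : take j s = take j r by rewrite /r take_takel.
by apply: string_law_cons_ge; rewrite rk.
Qed.

End LowerBounds.

Theorem theorem4p1 (R : realType) (N : option nat)
    (P : letter N -> past N -> R)
    (P_kernel : is_kernel P)
    (P_summable : summable_continuity_rate P)
    (P_non_null : very_weakly_non_null P)
    (mu : probability (trajectory N) R)
    (mu_stationary : stationary mu)
    (mu_compatible : compatible mu P) :
  exists C : R, \forall k \near \oo,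
    forall nu : probability (trajectory N) R,
      is_markov_approximation mu k nu ->
      (dbar mu nu <= (C * (1 - alpha P k))%:E)%E.
Proof.
have [k0 [m [rho [[al_gt0 _] k0m rho_iid rho_gt0]]]] := P_non_null.
have al_itv := alpha_itv P_kernel.
have [|delta delta_gt0 deltaP] := @prod_ge_of_summable _ (alpha P) k0 al_itv _ P_summable.
  by move=> n k0n; apply: lt_le_trans al_gt0 (le_alpha P_kernel k0n).
set E := @coalescence_set R N P k0 m in rho_gt0.
have coal := coalescence_set_le P_kernel al_gt0 rho_iid.
have sk0 : size (nseq k0 (point : letter N)) = k0 by exact: size_nseq.
have rho_fin : rho E \is a fin_num.
  rewrite ge0_fin_numE//; apply: le_lt_trans (ltry 1).
  by apply: probability_le1; exact: (measurable_coalescence_set P_kernel al_gt0 rho_iid).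
pose rho0 := fine (rho E).
have rho0_gt0 : 0 < rho0 by rewrite fine_gt0// rho_gt0 ltey_eq rho_fin.
(* [rho0] is the probability of the coalescence event and [delta] a lower bound, uniform in [k], for
   the probability that the agreement then lasts until length [k]. *)
exists (m.+1%:R / (rho0 * delta)).
exists k0 => // k /= k0k nu nu_markov.
have [nu_stationary nu_compatible nuD] := nu_markov.
have K_ge j s a : (k0 <= j <= k)%N -> (j <= size s)%N ->
    alpha_letter P a (take j s) * string_law mu s <= string_law mu (a :: s).
  by move=> _; exact: (string_law_cons_ge P_kernel mu_stationary mu_compatible).
have K'_ge j s a : (k0 <= j <= k)%N -> (j <= size s)%N ->
    alpha_letter P a (take j s) * string_law nu s <= string_law nu (a :: s).
  by move=> /andP[_ jk]; exact: (string_law_markov_ge P_kernel mu_stationary mu_compatible nu_markov).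
have mu_ge0 := string_law_ge0 mu; have nu_ge0 := string_law_ge0 nu.
have mu_cons := string_law_cons mu_stationary.
have nu_cons := string_law_cons nu_stationary.
have [||Q [[Q_ge0 Q_nil Q_cons Q_rcons] [Q_fst Q_snd [q Qq qle]]]] :=
  @exists_coupling_law R (letter N) (cond_law P (string_law mu)) (cond_law P (string_law nu))
  (fun s a => alpha_letter P a s) (single_step P k0) (common_step P k0) k0 m k (alpha P)
  (string_law mu) (string_law nu) rho0 k0k (ltnW k0m)
  (cond_law_sum P_kernel mu_ge0 mu_cons) (cond_law_sum P_kernel nu_ge0 nu_cons)
  (cond_law_ge0 P_kernel mu_ge0) (cond_law_ge0 P_kernel nu_ge0)
  (cond_law_ge P_kernel mu_ge0 K_ge) (cond_law_ge P_kernel nu_ge0 K'_ge)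
  al_itv _ (common_step_ge0 P k0) (common_step_row P_kernel al_gt0)
  (common_step_col P_kernel al_gt0) (single_step_le P_kernel al_gt0)
  (@common_step_diag R N P k0) (ltW rho0_gt0) _
  (string_law_nil mu_stationary) (string_law_nil nu_stationary)
  (cond_lawE P mu_ge0 mu_cons) (cond_lawE P nu_ge0 nu_cons)
  (string_law_rcons mu_stationary) (string_law_rcons nu_stationary)
  (string_law_tuple mu_stationary) (string_law_tuple nu_stationary).
- by move=> j s sj; rewrite -alpha_stringE// lee_fin alpha_le.
- by move=> s s' sk s'k; rewrite fineK// coal.
have [pi [pi_coupling piE]] := exists_coupling_of_law mu_stationary nu_stationary
  Q_ge0 Q_nil Q_cons Q_rcons Q_fst Q_snd.
apply: (@le_trans _ _ (pi [set w | w.1 0 <> w.2 0])).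
  by apply: ereal_inf_lbound; exists pi.
rewrite piE (le_trans Qq)// lee_fin mulrAC ler_pdivlMr ?mulr_gt0//.
(* Replacing the product by its lower bound [delta] in [qle] requires [q >= 0]; a negative [q] makes
   the inequality trivial. *)
have [q0|q0] := ltP q 0.
  apply: (@le_trans _ _ 0).
    by rewrite mulr_le0_ge0 ?ltW// mulr_gt0.
  by rewrite mulr_ge0// subr_ge0; case/andP: (al_itv k).
apply: le_trans qle; rewrite mulrC; apply: ler_wpM2r => //.
by apply: ler_wpM2l; [exact: ltW|exact: deltaP].
Qed.
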